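(* Let $\omega$ be a quantum principal connection on the trivial quantum principal $U(1)$-bundle over the Moyal--Weyl algebra $B$ with the differential calculus described in the context, with non-commutative gauge potential $A^\omega$, curvature $R^\omega$ and field strength $F^\omega$. Then the non-commutative Yang--Mills equation $$(d^{\nabla^\omega_{\mathrm{ad}}\star}-d^{S^\omega\star})R^\omega=0$$ is, in terms of the non-commutative field strength $F^\omega$, the equation $$(d^\star-d^{S^\omega\star})F^\omega(\vartheta)=0,$$ where $d^\star$ is the quantum codifferential and (abusing notation) $d^{S^\omega\star}$ now denotes the formal adjoint, with respect to $\langle-|-\rangle$, of the operator $d^{S^\omega}$ on linear maps ${}_{\mathrm{inv}}\Gamma\to\Omega^\bullet(B)$. Concretely, for every linear map $T:{}_{\mathrm{inv}}\Gamma\to\Omega^{k+1}(B)$ the map $d^{S^\omega\star}T:{}_{\mathrm{inv}}\Gamma\to\Omega^k(B)$ is given by $$d^{S^\omega\star}T(\vartheta)=(-1)^k\,i\,\star^{-1}\left([A^\omega(\vartheta),\star T(\vartheta)]^\partial\right),$$ i.e. $d^{S^\omega\star}=(-1)^{k+1}\star^{-1}\circ\,d^{S^\omega}\circ\star$.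
   Context: Base space. Fix an antisymmetric $4\times4$ matrix $(\theta^{\mu\nu})$; its entries are treated as formal central parameters fixed by complex conjugation. $B=C^\infty_{\mathbb C}(\mathbb R^4)[[\theta^{\mu\nu}]]$ is the space of formal power series in $\theta^{\mu\nu}$ with coefficients in complex-valued smooth functions, with the Moyal product $f\cdot h=m\circ\exp\left(\frac{i\theta^{\mu\nu}}{2}\frac{\partial}{\partial x^\mu}\otimes\frac{\partial}{\partial x^\nu}\right)(f\otimes h)$ ($m$ the pointwise product, $i=\sqrt{-1}$), unit $\mathbf 1$, $*$ = complex conjugation. $\Omega^\bullet(B)=\Omega^\bullet_{\mathbb C}(\mathbb R^4)[[\theta^{\mu\nu}]]$ with the usual $d$ and the product $(f\,dx^I)\wedge(h\,dx^J)=(f\cdot h)\,dx^I\wedge dx^J$. Metric and Hodge operator. With $\eta=\mathrm{diag}(1,-1,-1,-1)$, $\langle f\,dx^I,h\,dx^J\rangle=f\cdot h^*\,\langle dx^I,dx^J\rangle$, where $\langle dx^I,dx^J\rangle$ is the usual Minkowski metric on forms, $\langle dx^{\mu_1}\wedge\cdots\wedge dx^{\mu_k},dx^{\nu_1}\wedge\cdots\wedge dx^{\nu_k}\rangle=\det(\eta^{\mu_a\nu_b})$, and forms of different degree are orthogonal. $\mathrm{dvol}=dx^0\wedge dx^1\wedge dx^2\wedge dx^3$ and $\langle\hat\mu|\mu\rangle:=\int_B\langle\hat\mu,\mu\rangle\,\mathrm{dvol}$, with $\int_B$ the usual integral on $\mathbb R^4$ (coefficientwise in $\theta^{\mu\nu}$).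 $\star:\Omega^k(B)\to\Omega^{4-k}(B)$ is the antilinear isomorphism, $\star(f\,dx^I)=f^*\cdot\star dx^I$, determined by $\hat\mu\cdot(\star\mu)=\langle\hat\mu,\mu\rangle\,\mathrm{dvol}$; e.g. $\star\mathbf 1=\mathrm{dvol}$, $\star\mathrm{dvol}=-\mathbf 1$, and $\star^2=(-1)^{k(4-k)+1}\mathrm{id}$. The quantum codifferential is $d^\star:=(-1)^{k+1}\star^{-1}\circ d\circ\star:\Omega^{k+1}(B)\to\Omega^k(B)$, the formal adjoint of $d$. ''Formal adjoint'' of an operator $L$ means $L^\star$ with $\langle L\hat\mu|\mu\rangle=\langle\hat\mu|L^\star\mu\rangle$ whenever one of the arguments has compactly supported coefficients. Structure group. $H=\mathbb C[z,z^{-1}]$ with $z^{-1}=z^*$, $\Delta(z^n)=z^n\otimes z^n$, $\epsilon(z^n)=1$, $S(z^n)=z^{-n}$. $(\Gamma,d)$ is a bicovariant $*$-first order differential calculus on $H$ whose space of (left-)invariant elements satisfies $\dim_{\mathbb C}({}_{\mathrm{inv}}\Gamma)=1$ and $z\,\pi(z)=-\pi(z)\,z$, where $\pi(g)=S(g^{(1)})\,dg^{(2)}$. ${}_{\mathrm{inv}}\Gamma=\mathrm{span}_{\mathbb C}\{\vartheta:=i\pi(z)\}$; the adjoint coaction is $\mathrm{ad}(\vartheta)=\vartheta\otimes\mathbf 1$. $\Gamma^\wedge$ is the universal differential envelope of $\Gamma$ (the tensor algebra of $\Gamma$ over $H$ modulo the graded ideal generated by all $\sum_k da_k\otimes_H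 db_k$ with $\sum_k a_k\,db_k=0$); in it $d\vartheta=i\vartheta\vartheta$, and the coproduct extends to $\Gamma^\wedge$. Bundle and connections. $P=B\otimes H$, $\Delta_P=\mathrm{id}\otimes\Delta$, $\Omega^\bullet(P)=\Omega^\bullet(B)\otimes\Gamma^\wedge$ (graded tensor product), $\Delta_{\Omega^\bullet(P)}=\mathrm{id}\otimes\Delta$, $\mathrm{Hor}^\bullet P=\Omega^\bullet(B)\otimes H$, $\Delta_{\mathrm{Hor}}$ the restriction of $\Delta_{\Omega^\bullet(P)}$ to $\mathrm{Hor}^\bullet P$. A quantum principal connection is a linear $\omega:{}_{\mathrm{inv}}\Gamma\to\Omega^1(P)$ with $\Delta_{\Omega^\bullet(P)}(\omega(\theta))=(\omega\otimes\mathrm{id}_H)(\mathrm{ad}(\theta))+\mathbf 1\otimes\theta$; equivalently $\omega(\theta)=A^\omega(\theta)\otimes\mathbf 1+\mathbf 1\otimes\theta$ for a linear $A^\omega:{}_{\mathrm{inv}}\Gamma\to\Omega^1(B)$. With $\Theta(\vartheta)=i\vartheta\otimes\vartheta$ and $\langle C,D\rangle:=m\circ(C\otimes D)\circ\Theta$, $R^\omega:=d\omega-\langle\omega,\omega\rangle$ and $F^\omega:=dA^\omega-\langle A^\omega,A^\omega\rangle$, so $R^\omega(\vartheta)=F^\omega(\vartheta)\otimes\mathbf 1$. $D^\omega\psi=d\psi-(-1)^k\psi^{(0)}\omega(\pi(\psi^{(1)}))$ for $\psi\in\mathrm{Hor}^kP$, $\Delta_{\mathrm{Hor}}(\psi)=\psi^{(0)}\otimes\psi^{(1)}$.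 $\mathrm{Mor}(\mathrm{ad},\Delta_{\mathrm{Hor}})$ is the set of linear $\tau:{}_{\mathrm{inv}}\Gamma\to\mathrm{Hor}^\bullet P$ with $(\tau\otimes\mathrm{id}_H)\circ\mathrm{ad}=\Delta_{\mathrm{Hor}}\circ\tau$ (i.e. $\tau(\vartheta)=\eta\otimes\mathbf 1$, $\eta\in\Omega^\bullet(B)$). For $\tau$ with values in degree $k$, $S^\omega\tau:=\langle\omega,\tau\rangle-(-1)^k\langle\tau,\omega\rangle-(-1)^k[\tau,\omega]$, $[\tau,\omega]:=m\circ(\tau\otimes\omega)\circ(\mathrm{id}_{{}_{\mathrm{inv}}\Gamma}\otimes\pi)\circ\mathrm{ad}$. For linear $T:{}_{\mathrm{inv}}\Gamma\to\Omega^k(B)$, $d^{S^\omega}T:{}_{\mathrm{inv}}\Gamma\to\Omega^{k+1}(B)$ is given by $d^{S^\omega}T(\vartheta)=i[A^\omega(\vartheta),T(\vartheta)]^\partial$, where for $\alpha\in\Omega^1(B)$, $\beta\in\Omega^k(B)$, $[\alpha,\beta]^\partial:=\alpha\wedge\beta-(-1)^k\beta\wedge\alpha$. Operators act on such maps $T$ by acting on the value $T(\vartheta)$, and $\langle T|T'\rangle=\langle T(\vartheta)|T'(\vartheta)\rangle$. Associated bundle. $E:=\mathrm{Mor}(\mathrm{ad},\Delta_P)$ (linear maps $T:{}_{\mathrm{inv}}\Gamma\to P$ with $(T\otimes\mathrm{id}_H)\circ\mathrm{ad}=\Delta_P\circ T$) is the associated left quantum vector bundle, free over $B$ on $T_{\mathbf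 1}$, $T_{\mathbf 1}(\vartheta)=\mathbf 1\otimes\mathbf 1$. $\Upsilon:\mathrm{Mor}(\mathrm{ad},\Delta_{\mathrm{Hor}})\to\Omega^\bullet(B)\otimes_BE$ is the canonical isomorphism $\tau\mapsto\eta\otimes_BT_{\mathbf 1}$ if $\tau(\vartheta)=\eta\otimes\mathbf 1$. The canonical pseudo inner product is $\langle\eta\otimes_BT_{\mathbf 1}|\eta'\otimes_BT_{\mathbf 1}\rangle=\langle\eta|\eta'\rangle$. The induced linear connection on $E$ has exterior derivative $\Upsilon\circ D^\omega\circ\Upsilon^{-1}$, whose formal adjoint is $d^{\nabla^\omega_{\mathrm{ad}}\star}$; in the Yang--Mills equation $d^{S^\omega\star}$ is the formal adjoint of $\Upsilon\circ S^\omega\circ\Upsilon^{-1}$, and the equation means $(d^{\nabla^\omega_{\mathrm{ad}}\star}-d^{S^\omega\star})\Upsilon(R^\omega)=0$. ''In terms of $F^\omega$'' refers to the identification $\Upsilon(R^\omega)=F^\omega(\vartheta)\otimes_BT_{\mathbf 1}$. *)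

(* Defs.v *)
From HB Require Import structures.
From mathcomp Require Import all_boot all_order all_algebra.
From mathcomp Require Import finmap generic_quotient complex.
From mathcomp Require Import all_classical all_reals all_analysis.

Set Implicit Arguments.
Unset Strict Implicit.
Unset Printing Implicit Defensive.

Import Order.TTheory GRing.Theory Num.Theory numFieldNormedType.Exports.
Local Open Scope classical_set_scope.
Local Open Scope quotient_scope.
Local Open Scope ring_scope.


Definition is_bilinear (K : nzRingType) (V W U : lmodType K)
  (b : V -> W -> U) : Prop :=
  (forall w, linear (b^~ w)) /\ (forall v, linear (b v)).

Section BalancedTensor.
Variables (K : comNzRingType) (V W : lmodType K).
Variables (X : Type) (ra : V -> X -> V) (la : X -> W -> W).

(* The tensor product V (x)_X W over K, balanced for a right action ra of X on V
   and a left action la of X on W: formal sums of pairs modulo the relations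
   imposed by all balanced K-bilinear maps. Without balancing (X = void) this is
   the tensor product over K. *)
Definition balanced (U : lmodType K) (b : V -> W -> U) :=
  forall v x w, b (ra v x) w = b v (la x w).

Definition tens_eq : rel (seq (V * W)) := fun s t =>
  `[< forall (U : lmodType K) (b : V -> W -> U), is_bilinear b -> balanced b ->
      \sum_(p <- s) b p.1 p.2 = \sum_(p <- t) b p.1 p.2 >].

Lemma tens_eq_refl : reflexive tens_eq.
Proof. by move=> s; apply/asboolP. Qed.

Lemma tens_eq_sym : symmetric tens_eq.
Proof.
by move=> s t; apply/asboolP/asboolP => st U b b1 b2; rewrite st.
Qed.

Lemma tens_eq_trans : transitive tens_eq.
Proof.
move=> t s u /asboolP st /asboolP tu; apply/asboolP => U b b1 b2.
by rewrite st ?tu.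
Qed.

Canonical tens_eq_equiv :=
  EquivRel tens_eq tens_eq_refl tens_eq_sym tens_eq_trans.

Definition btens := {eq_quot tens_eq_equiv}.

HB.instance Definition _ := Choice.on btens.

Definition tadd (x y : btens) : btens := \pi_btens (repr x ++ repr y).
Definition tscale (a : K) (x : btens) : btens :=
  \pi_btens [seq (a *: p.1, p.2) | p <- repr x].
Definition tzero : btens := \pi_btens [::].

(* The map induced by b; independent of the representative (tlift_pi) when b is
   bilinear and balanced, meaningless otherwise. *)
Definition tlift (U : lmodType K) (b : V -> W -> U) (x : btens) : U :=
  \sum_(p <- repr x) b p.1 p.2.
Definition tpure (v : V) (w : W) : btens := \pi_btens [:: (v, w)].

Section Lift.
Variables (U : lmodType K) (b : V -> W -> U).
Hypotheses (b1 : is_bilinear b) (b2 : balanced b).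

Lemma tlift_pi s : tlift b (\pi_btens s) = \sum_(p <- s) b p.1 p.2.
Proof.
have /eqmodP/asboolP e : \pi_btens (repr (\pi_btens s)) = \pi_btens s.
  by rewrite reprK.
exact: e.
Qed.

Lemma tlift_pure v w : tlift b (tpure v w) = b v w.
Proof. by rewrite tlift_pi big_seq1. Qed.

Lemma tlift_add x y : tlift b (tadd x y) = tlift b x + tlift b y.
Proof. by rewrite tlift_pi big_cat. Qed.

Lemma tlift_zero : tlift b tzero = 0.
Proof. by rewrite tlift_pi big_nil. Qed.

Lemma tlift_scale a x : tlift b (tscale a x) = a *: tlift b x.
Proof.
rewrite tlift_pi big_map scaler_sumr; apply: eq_bigr => p _ /=.
have := b1.1 p.2 a p.1 0.
have -> : b 0 p.2 = 0.
  have := b1.1 p.2 (-1) 0 0; rewrite scaler0 addr0 scaleN1r => h.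
  by rewrite h addNr.
by rewrite !addr0.
Qed.
End Lift.

Lemma btensP (x y : btens) :
  (forall (U : lmodType K) (b : V -> W -> U), is_bilinear b -> balanced b ->
     tlift b x = tlift b y) -> x = y.
Proof.
move=> h; rewrite -[x]reprK -[y]reprK; apply/eqmodP/asboolP => U b b1 b2.
exact: h.
Qed.

Fact tadd_assoc : associative tadd.
Proof. by move=> x y z; apply: btensP => U b *; rewrite !tlift_add// addrA. Qed.
Fact tadd_comm : commutative tadd.
Proof. by move=> x y; apply: btensP => U b *; rewrite !tlift_add// addrC. Qed.
Fact tadd_zero : left_id tzero tadd.
Proof.
by move=> x; apply: btensP => U b *; rewrite tlift_add// tlift_zero// add0r.
Qed.
Fact tadd_opp : left_inverse tzero (tscale (-1)) tadd.
Proof.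
move=> x; apply: btensP => U b *.
by rewrite tlift_add// tlift_scale// tlift_zero// scaleN1r addNr.
Qed.

HB.instance Definition _ :=
  GRing.isZmodule.Build btens tadd_assoc tadd_comm tadd_zero tadd_opp.

Fact tscaleA a b (x : btens) : tscale a (tscale b x) = tscale (a * b) x.
Proof. by apply: btensP => U f *; rewrite !tlift_scale// scalerA. Qed.
Fact tscale1 : left_id 1 tscale.
Proof. by move=> x; apply: btensP => U f *; rewrite tlift_scale// scale1r. Qed.
Fact tscaleDr : right_distributive tscale +%R.
Proof.
move=> a x y; apply: btensP => U f *.
by rewrite tlift_scale// !tlift_add// !tlift_scale// scalerDr.
Qed.
Fact tscaleDl (x : btens) : {morph tscale^~ x : a b / a + b}.
Proof.
move=> a b; apply: btensP => U f *.
by rewrite tlift_scale// !tlift_add// !tlift_scale// scalerDl.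
Qed.

HB.instance Definition _ :=
  GRing.Zmodule_isLmodule.Build K btens tscaleA tscale1 tscaleDr tscaleDl.

Lemma tlift_linear (U : lmodType K) (b : V -> W -> U) :
  is_bilinear b -> balanced b -> linear (tlift b).
Proof.
by move=> b1 b2 a x y; rewrite tlift_add// tlift_scale.
Qed.

Lemma tpure_bilinear : is_bilinear tpure.
Proof.
split=> [w|v] a x y; apply: btensP => U f f1 f2;
  by rewrite (tlift_linear f1 f2) !tlift_pure// ?f1.1 ?f1.2.
Qed.

End BalancedTensor.

Notation tens V W :=
  (btens (fun (v : V) (_ : void) => v) (fun (_ : void) (w : W) => w)).
Notation "v \ox w" :=
  (tpure (fun v' (_ : void) => v') (fun (_ : void) w' => w') v w)
  (at level 40, left associativity).

Section Laurent.
Variable R : realType.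
Notation C := (R[i]).

Definition fin_supp : {pred int -> C^o} :=
  fun f => `[< finite_set [set n | f n != 0] >].

Fact fin_supp_submod : submod_closed fin_supp.
Proof.
split; first by apply/asboolP; apply: sub_finite_set (finite_set0 int) => n /=; rewrite eqxx.
move=> a f g /asboolP ff /asboolP fg; apply/asboolP.
apply: (@sub_finite_set _ _ ([set n | f n != 0] `|` [set n | g n != 0])); last first.
  by rewrite finite_setU.
move=> n /=; case: (eqVneq (f n) 0) => [fn|]; last by left.
case: (eqVneq (g n) 0) => [gn|]; last by right.
by rewrite !fctE fn gn scaler0 addr0 eqxx.
Qed.
HB.instance Definition _ :=
  GRing.isSubmodClosed.Build C (int -> C^o) fin_supp fin_supp_submod.

Record laurent := Laurent { lcoef :> int -> C^o; _ : lcoef \in fin_supp }.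
HB.instance Definition _ := [isSub for lcoef].
HB.instance Definition _ := [Choice of laurent by <:].
HB.instance Definition _ := [SubChoice_isSubLmodule of laurent by <:].

End Laurent.


Section LaurentRing.
Variable R : realType.
Notation C := (R[i]).
Notation H := (laurent R).

Fact zpow_subproof (n : int) : (fun m => (m == n)%:R : C^o) \in @fin_supp R.
Proof.
apply/asboolP; apply: (sub_finite_set _ (finite_set1 n)) => m /=.
by case: (m =P n) => // _; rewrite eqxx.
Qed.
Definition zpow n : H := Laurent (zpow_subproof n).

Definition lext (V : lmodType C) (g : int -> V) (h : H) : V :=
  \sum_(n \in [set: int]) h n *: g n.

Fact laurent_fin (h : H) : finite_set [set n | h n != 0].
Proof. by case: h => f /= /asboolP. Qed.

Lemma lext_fset (V : lmodType C) (g : int -> V) (h : H) (A : set int) :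
  finite_set A -> [set n | h n != 0] `<=` A ->
  lext g h = \sum_(n <- fset_set A) h n *: g n.
Proof.
move=> fA hA; rewrite /lext -fsbig_finite//.
apply: esym; apply: fsbig_widen => // n [_ /= nA].
have [->|hn] := eqVneq (h n) 0; first by rewrite scale0r.
by case: nA; exact: hA.
Qed.

Lemma lext_linear (V : lmodType C) (g : int -> V) : linear (lext g).
Proof.
move=> a x y.
pose A := [set n | x n != 0] `|` [set n | y n != 0].
have fA : finite_set A by rewrite finite_setU; split; exact: laurent_fin.
rewrite !(@lext_fset _ _ _ A)//.
- rewrite scaler_sumr -big_split; apply: eq_bigr => n _ /=.
  by rewrite scalerA -scalerDl.
- by move=> n /=; right.
- by move=> n /=; left.
- move=> n /=; case: (eqVneq (x n) 0) => [xn|]; last by left.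
  case: (eqVneq (y n) 0) => [yn|]; last by right.
  by rewrite !fctE/= xn yn scaler0 addr0 eqxx.
Qed.

Lemma lext_zpow (V : lmodType C) (g : int -> V) n : lext g (zpow n) = g n.
Proof.
rewrite (@lext_fset _ _ _ [set n]) ?finite_set1//.
  by rewrite fset_set1 big_seq_fset1 /= eqxx scale1r.
by move=> m /=; case: (m =P n) => // _; rewrite eqxx.
Qed.

Lemma laurentE (h : H) : h = lext zpow h.
Proof.

apply: val_inj; apply/funext => m.
rewrite (lext_fset _ (laurent_fin h))//.
have -> : val (\sum_(n <- fset_set [set n | h n != 0]) h n *: zpow n) m =
   \sum_(n <- fset_set [set n | h n != 0]) (h n * (m == n)%:R : C).
  by elim/big_ind2: _ => // x1 x2 y1 y2 <- <-.
have fh := laurent_fin h.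
have [hm|hm] := eqVneq (h m) 0.
  rewrite [LHS]hm big1_seq// => n _.
  by case: eqP => [<-|_]; rewrite ?hm ?mul0r ?mulr0.
rewrite (big_fsetD1 m)/=; last by rewrite in_fset_set// inE.
rewrite eqxx mulr1 big1_seq ?addr0// => n /=; rewrite in_fsetD1 => /andP[nm _].
by rewrite eq_sym (negbTE nm) mulr0.
Qed.

Lemma laurent_ext (V : lmodType C) (f g : H -> V) :
  linear f -> linear g -> (forall n, f (zpow n) = g (zpow n)) -> f =1 g.
Proof.
move=> fl gl fg h; rewrite (laurentE h).
rewrite (lext_fset _ (laurent_fin h))//.
have l0 (k : H -> V) : linear k -> k 0 = 0.
  by move=> kl; have := kl (-1) 0 0; rewrite scaler0 addr0 scaleN1r addNr.
elim/big_rec: _ => [|n x _ fgx]; first by rewrite !l0.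
by rewrite fl gl fgx fg.
Qed.

Definition lmul (x y : H) : H := lext (fun m => lext (fun n => zpow (m + n)) y) x.

Fact lmul_linl y : linear (lmul^~ y). Proof. exact: lext_linear. Qed.
Fact lmul_linr x : linear (lmul x).
Proof.
move=> a u v.
have hl : linear (fun x => a *: lmul x u + lmul x v).
  by move=> b x1 x2; rewrite !lmul_linl !scalerDr !scalerA mulrC -!addrA; congr (_ + _); rewrite addrCA.
apply: (laurent_ext (lmul_linl _) hl) => n.
by rewrite /lmul !lext_zpow lext_linear.
Qed.
Lemma lmul_zpow m n : lmul (zpow m) (zpow n) = zpow (m + n).
Proof. by rewrite /lmul !lext_zpow. Qed.

Fact lmulA : associative lmul.
Proof.
move=> x y z.
apply: (@laurent_ext _ (fun x => lmul x (lmul y z)) (fun x => lmul (lmul x y) z)) => [||k].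
- exact: lmul_linl.
- by move=> a u v; rewrite !lmul_linl.
apply: (@laurent_ext _ (fun y => lmul (zpow k) (lmul y z)) (fun y => lmul (lmul (zpow k) y) z)) => [||m].
- by move=> a u v; rewrite !(lmul_linl,lmul_linr).
- by move=> a u v; rewrite !(lmul_linl,lmul_linr).
apply: (@laurent_ext _ (fun z => lmul (zpow k) (lmul (zpow m) z)) (fun z => lmul (lmul (zpow k) (zpow m)) z)) => [||n].
- by move=> a u v; rewrite !(lmul_linl,lmul_linr).
- by move=> a u v; rewrite !(lmul_linl,lmul_linr).
by rewrite !lmul_zpow addrA.
Qed.

Fact lmulC : commutative lmul.
Proof.
move=> x y.
apply: (@laurent_ext _ (fun x => lmul x y) (fun x => lmul y x)) => [||k]; [exact: lmul_linl|exact: lmul_linr|].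
apply: (@laurent_ext _ (fun y => lmul (zpow k) y) (fun y => lmul y (zpow k))) => [||m]; [exact: lmul_linr|exact: lmul_linl|].
by rewrite !lmul_zpow addrC.
Qed.

Fact lmul1 : left_id (zpow 0) lmul.
Proof.
move=> x; apply: (@laurent_ext _ (lmul (zpow 0)) id) => [|//|n]; first exact: lmul_linr.
by rewrite lmul_zpow add0r.
Qed.

Fact lmulDl : left_distributive lmul +%R.
Proof. by move=> x y z; have := lmul_linl z 1 x y; rewrite !scale1r. Qed.

Fact zpow_neq0 : zpow 0 != 0.
Proof.
apply/eqP => /(congr1 (fun h : H => h 0)) /=.
by move/eqP; rewrite oner_eq0.
Qed.

HB.instance Definition _ := GRing.Zmodule_isComNzRing.Build H
  lmulA lmulC lmul1 lmulDl zpow_neq0.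

Lemma zpow0 : zpow 0 = 1. Proof. by []. Qed.

Lemma zpowD m n : zpow (m + n) = zpow m * zpow n.
Proof. exact/esym/lmul_zpow. Qed.

Fact lmulZl (a : C) (x y : H) : a *: (x * y) = (a *: x) * y.
Proof.
have := lmul_linl y a x 0; rewrite addr0 => /esym.
by rewrite -[lmul (a *: x) y]/(a *: x * y) -[lmul x y]/(x * y)
           -[lmul 0 y]/(0 * y) mul0r addr0.
Qed.
HB.instance Definition _ := GRing.Lmodule_isLalgebra.Build C H lmulZl.
Fact lmulZr (a : C) (x y : H) : a *: (x * y) = x * (a *: y).
Proof. by rewrite mulrC lmulZl mulrC. Qed.
HB.instance Definition _ := GRing.Lalgebra_isAlgebra.Build C H lmulZr.



End LaurentRing.


Section TensorMaps.
Variable K : comNzRingType.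

Definition tmap (V1 V2 W1 W2 : lmodType K) (f : V1 -> V2) (g : W1 -> W2)
  (x : tens V1 W1) : tens V2 W2 := tlift (fun v w => f v \ox g w) x.

Definition tmap2 (V1 V2 V3 W1 W2 W3 : lmodType K)
  (f : V1 -> V2 -> V3) (g : W1 -> W2 -> W3)
  (x : tens V1 W1) (y : tens V2 W2) : tens V3 W3 :=
  tlift (fun v1 w1 => tlift (fun v2 w2 => f v1 v2 \ox g w1 w2) y) x.

Lemma balanced_void (V W U : lmodType K) (b : V -> W -> U) :
  balanced (fun (v : V) (_ : void) => v) (fun (_ : void) (w : W) => w) b.
Proof. by move=> v []. Qed.

Lemma tlift_ox (V W U : lmodType K) (b : V -> W -> U) v w :
  is_bilinear b -> tlift b (v \ox w : tens V W) = b v w.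
Proof. by move=> bb; apply: tlift_pure => //; exact: balanced_void. Qed.

Lemma tlift_lin (V W U : lmodType K) (b : V -> W -> U) :
  is_bilinear b -> linear (tlift b : tens V W -> U).
Proof. by move=> bb; apply: tlift_linear => //; exact: balanced_void. Qed.

Lemma tlift_tens0 (V W U : lmodType K) (b : V -> W -> U) :
  is_bilinear b -> tlift b (0 : tens V W) = 0.
Proof. by move=> bb; apply: tlift_zero => //; exact: balanced_void. Qed.

Lemma tlift_tensD (V W U : lmodType K) (b : V -> W -> U) v w y :
  is_bilinear b -> tlift b (v \ox w + y : tens V W) = b v w + tlift b y.
Proof.
move=> bb; rewrite -[v \ox w]scale1r tlift_lin// scale1r.
by rewrite tlift_ox.
Qed.

Lemma tens_ind (V W : lmodType K) (P : tens V W -> Prop) :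
  P 0 -> (forall v w x, P x -> P (v \ox w + x)) -> forall x, P x.
Proof.
move=> P0 Pa x; rewrite -[x]reprK; elim: (repr x) => [//|[v w] s IHs].
rewrite (_ : \pi_(tens V W) ((v, w) :: s) = v \ox w + \pi_(tens V W) s); first exact: Pa.
apply: btensP => U b b1 b2.
rewrite -[_ + _]/(tadd _ _) tlift_add// tlift_pure// !tlift_pi//.
by rewrite big_cons.
Qed.

Lemma ox_bilinear (V W : lmodType K) :
  is_bilinear (fun (v : V) (w : W) => v \ox w : tens V W).
Proof. exact: tpure_bilinear. Qed.

Lemma bilin_comp (V V' W W' U : lmodType K) (b : V -> W -> U)
  (f : V' -> V) (g : W' -> W) :
  is_bilinear b -> linear f -> linear g -> is_bilinear (fun v w => b (f v) (g w)).
Proof. by move=> [b1 b2] fl gl; split=> [w|v] a x y; rewrite (fl,gl) (b1,b2). Qed.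

Lemma tmap_ox (V1 V2 W1 W2 : lmodType K) (f : V1 -> V2) (g : W1 -> W2) v w :
  linear f -> linear g -> tmap f g (v \ox w) = f v \ox g w.
Proof.
by move=> fl gl; apply: tlift_ox; apply: bilin_comp (ox_bilinear _ _) _ _.
Qed.

Lemma tmap_lin (V1 V2 W1 W2 : lmodType K) (f : V1 -> V2) (g : W1 -> W2) :
  linear f -> linear g -> linear (tmap f g).
Proof.
by move=> fl gl; apply: tlift_lin; apply: bilin_comp (ox_bilinear _ _) _ _.
Qed.

Section Tmap2.
Variables (V1 V2 V3 W1 W2 W3 : lmodType K).
Variables (f : V1 -> V2 -> V3) (g : W1 -> W2 -> W3).
Hypotheses (bf : is_bilinear f) (bg : is_bilinear g).

Let b2 v1 w1 : is_bilinear (fun v2 w2 => f v1 v2 \ox g w1 w2 : tens V3 W3).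
Proof. by apply: bilin_comp (ox_bilinear _ _) _ _; [exact: bf.2|exact: bg.2]. Qed.

Let b1 y : is_bilinear (fun v1 w1 =>
  tlift (fun v2 w2 => f v1 v2 \ox g w1 w2 : tens V3 W3) (y : tens V2 W2)).
Proof.
split=> [w|v] a x z; elim/tens_ind: y => [|v2 w2 y IHy];
  rewrite ?tlift_tens0 ?scaler0 ?addr0 ?tlift_tensD//; try exact: b2;
  rewrite IHy ?bf.1 ?bg.1 ?(ox_bilinear _ _).1 ?(ox_bilinear _ _).2;
  by rewrite scalerDr !addrA; congr (_ + _); rewrite -!addrA; congr (_ + _);
     rewrite addrC.
Qed.

Lemma tmap2_ox v1 w1 v2 w2 :
  tmap2 f g (v1 \ox w1) (v2 \ox w2) = f v1 v2 \ox g w1 w2.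
Proof. by rewrite /tmap2 tlift_ox// tlift_ox. Qed.
End Tmap2.

(* gV and gW are the grading involutions x |-> (-1)^|x| x and half is 1/2, so that
   gt_mul is (a (x) b)(a' (x) b') = (-1)^(|b||a'|) aa' (x) bb' on homogeneous
   elements. *)
Section GradedTensor.
Variables (V W : lmodType K) (half : K).
Variables (mV : V -> V -> V) (gV : V -> V) (mW : W -> W -> W) (gW : W -> W).

Definition gt_mul (x y : tens V W) : tens V W :=
  let even a := half *: (a + gV a) in let odd a := half *: (a - gV a) in
  tlift (fun a b => tlift (fun a' b' =>
    mV a (even a') \ox mW b b' + mV a (odd a') \ox mW (gW b) b') y) x.

Definition gt_diff (dV : V -> V) (dW : W -> W) (x : tens V W) : tens V W :=
  tlift (fun a b => dV a \ox b + gV a \ox dW b) x.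
End GradedTensor.

End TensorMaps.

Section StructureGroup.
Variable R : realType.
Notation C := (R[i]).
Notation H := (laurent R).

Definition hcoprod : H -> tens H H := lext (fun n => zpow R n \ox zpow R n).
Definition hcounit : H -> C^o := lext (fun=> 1 : C^o).
Definition hantipode : H -> H := lext (fun n => zpow R (- n)).
Definition hstar (h : H) : H :=
  \sum_(n \in [set: int]) (h n)^* *: zpow R (- n).

(* Bicovariant *-first order differential calculi on H (Woronowicz): bicovariance
   is the existence of the coactions lcoact and rcoact, the *-condition that of
   bstar; the three maps are determined by their values on a db. *)
Record bcalc := BCalc {
  bgam :> lmodType C;
  lact : H -> bgam -> bgam;
  ract : bgam -> H -> bgam;
  bd : H -> bgam;
  lact_bilin : is_bilinear lact;
  ract_bilin : is_bilinear ract;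
  lact1 : forall x, lact 1 x = x;
  lactM : forall g h x, lact (g * h) x = lact g (lact h x);
  ract1 : forall x, ract x 1 = x;
  ractM : forall g h x, ract x (g * h) = ract (ract x g) h;
  lactrA : forall g h x, lact g (ract x h) = ract (lact g x) h;
  bd_lin : linear bd;
  bd_leibniz : forall g h, bd (g * h) = ract (bd g) h + lact g (bd h);
  bd_surj : forall x, exists s : seq (H * H),
    x = \sum_(p <- s) lact p.1 (bd p.2);
  bstar : bgam -> bgam;
  bstarZ : forall (a : C) x y, bstar (a *: x + y) = a^* *: bstar x + bstar y;
  bstarK : involutive bstar;
  bstar_d : forall g h,
    bstar (lact g (bd h)) = ract (bd (hstar h)) (hstar g);
  lcoact : {linear bgam -> tens H bgam};
  lcoact_d : forall g h, lcoact (lact g (bd h)) =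
    tmap2 *%R lact (hcoprod g) (tmap id bd (hcoprod h));
  rcoact : {linear bgam -> tens bgam H};
  rcoact_d : forall g h, rcoact (lact g (bd h)) =
    tmap2 lact *%R (hcoprod g) (tmap bd id (hcoprod h)) }.

Section Calculus.
Variable G : bcalc.

(* left-invariant elements *)
Definition linv : {pred G} := fun x => lcoact G x == 1 \ox x.

Fact linv_submod : submod_closed linv.
Proof.
have bl := ox_bilinear H G.
have o0 : 1 \ox 0 = 0 :> tens H G.
  by have := bl.2 1 (-1) 0 0; rewrite scaler0 addr0 scaleN1r addNr.
split; first by rewrite unfold_in linear0 o0.
by move=> a x y /eqP hx /eqP hy; rewrite unfold_in linearP/= hx hy bl.2.
Qed.
HB.instance Definition _ := GRing.isSubmodClosed.Build C G linv linv_submod.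

Record invG := InvG { ginv :> G; _ : ginv \in linv }.
HB.instance Definition _ := [isSub for ginv].
HB.instance Definition _ := [Choice of invG by <:].
HB.instance Definition _ := [SubChoice_isSubLmodule of invG by <:].

(* pi(g) = S(g_1) dg_2 *)
Definition germ (g : H) : G :=
  tlift (fun a b => lact (hantipode a) (bd G b)) (hcoprod g).

Let germ_bilin : is_bilinear (fun a b => lact (hantipode a) (bd G b)).
Proof.
by apply: bilin_comp (lact_bilin G) _ (bd_lin G); exact: lext_linear.
Qed.

Fact germ_lin : linear germ.
Proof.
move=> a x y; rewrite /germ /hcoprod lext_linear (tlift_lin germ_bilin)//.
Qed.

Fact germ_inv g : germ g \in linv.
Proof.
apply/eqP; move: g; apply: laurent_ext => [||n].
- by move=> a x y; rewrite germ_lin linearP.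
- by move=> a x y; rewrite germ_lin (ox_bilinear _ _).2.
rewrite /germ /hcoprod lext_zpow (tlift_ox _ _ germ_bilin).
rewrite lcoact_d /hantipode lext_zpow /hcoprod !lext_zpow.
rewrite tmap_ox//; last exact: bd_lin.
rewrite tmap2_ox; last exact: lact_bilin.
  by rewrite -zpowD addNr.
by split=> [w|v] a x y; rewrite ?mulrDl ?mulrDr -?scalerAl -?scalerAr.
Qed.

Definition qgerm (g : H) : invG := InvG (germ_inv g).

Definition dim_inv1 : Prop :=
  exists2 v : invG, v != 0 & forall x, exists a : C, x = a *: v.
Definition germ_anticomm : Prop :=
  lact (zpow R 1) (germ (zpow R 1)) = - ract (germ (zpow R 1)) (zpow R 1).

Definition vtheta : invG := 'i *: qgerm (zpow R 1).

Definition ad (x : invG) : tens invG H := x \ox 1.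

(* The coordinate in the basis (vtheta) of invG; it makes sense under dim_inv1. *)
Definition vcoord (x : invG) : C := xget 0 [set a | x = a *: vtheta].

(* The universal differential envelope: the tensor algebra of G over H, presented
   as the C-algebra generated by copies of H and G, modulo the ideal generated by
   the sums of da_k (x) db_k with sum_k a_k db_k = 0 (env_ideal). *)
Inductive eterm :=
  | EH of H | EG of G | EAdd of eterm & eterm | EMul of eterm & eterm
  | EScale of C & eterm.
HB.instance Definition _ := gen_eqMixin eterm.
HB.instance Definition _ := gen_choiceMixin eterm.

Inductive env_rel : eterm -> eterm -> Prop :=
  | env_refl t : env_rel t t
  | env_sym s t : env_rel s t -> env_rel t s
  | env_trans s t u : env_rel s t -> env_rel t u -> env_rel s u
  | env_addc s s' t t' :
      env_rel s s' -> env_rel t t' -> env_rel (EAdd s t) (EAdd s' t')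
  | env_mulc s s' t t' :
      env_rel s s' -> env_rel t t' -> env_rel (EMul s t) (EMul s' t')
  | env_scalec a s s' : env_rel s s' -> env_rel (EScale a s) (EScale a s')
  | env_addA s t u : env_rel (EAdd s (EAdd t u)) (EAdd (EAdd s t) u)
  | env_addC s t : env_rel (EAdd s t) (EAdd t s)
  | env_add0 t : env_rel (EAdd (EH 0) t) t
  | env_addN t : env_rel (EAdd (EScale (-1) t) t) (EH 0)
  | env_mulA s t u : env_rel (EMul s (EMul t u)) (EMul (EMul s t) u)
  | env_mul1l t : env_rel (EMul (EH 1) t) t
  | env_mul1r t : env_rel (EMul t (EH 1)) t
  | env_mulDl s t u : env_rel (EMul (EAdd s t) u) (EAdd (EMul s u) (EMul t u))
  | env_mulDr s t u : env_rel (EMul s (EAdd t u)) (EAdd (EMul s t) (EMul s u))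
  | env_scaleA a b t : env_rel (EScale a (EScale b t)) (EScale (a * b) t)
  | env_scale1 t : env_rel (EScale 1 t) t
  | env_scaleDr a s t :
      env_rel (EScale a (EAdd s t)) (EAdd (EScale a s) (EScale a t))
  | env_scaleDl a b t :
      env_rel (EScale (a + b) t) (EAdd (EScale a t) (EScale b t))
  | env_scaleAl a s t : env_rel (EScale a (EMul s t)) (EMul (EScale a s) t)
  | env_scaleAr a s t : env_rel (EScale a (EMul s t)) (EMul s (EScale a t))
  | env_H_lin a g h : env_rel (EH (a *: g + h)) (EAdd (EScale a (EH g)) (EH h))
  | env_H_mul g h : env_rel (EH (g * h)) (EMul (EH g) (EH h))
  | env_G_lin a x y : env_rel (EG (a *: x + y)) (EAdd (EScale a (EG x)) (EG y))
  | env_G_lact h x : env_rel (EG (lact h x)) (EMul (EH h) (EG x))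
  | env_G_ract h x : env_rel (EG (ract x h)) (EMul (EG x) (EH h))
  | env_ideal (s : seq (H * H)) : \sum_(p <- s) lact p.1 (bd G p.2) = 0 ->
      env_rel (foldr EAdd (EH 0) [seq EMul (EG (bd G p.1)) (EG (bd G p.2)) | p <- s])
              (EH 0).

Definition env_eq : rel eterm := fun s t => `[< env_rel s t >].
Fact env_eq_refl : reflexive env_eq.
Proof. by move=> s; apply/asboolP; constructor. Qed.
Fact env_eq_sym : symmetric env_eq.
Proof. by move=> s t; apply/asboolP/asboolP => ?; constructor. Qed.
Fact env_eq_trans : transitive env_eq.
Proof.
by move=> t s u /asboolP st /asboolP tu; apply/asboolP; exact: env_trans tu.
Qed.
Canonical env_eq_equiv := EquivRel env_eq env_eq_refl env_eq_sym env_eq_trans.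
Definition envelope := {eq_quot env_eq_equiv}.
HB.instance Definition _ := Choice.on envelope.

Notation epi := (\pi_envelope).
Definition eadd (x y : envelope) : envelope := epi (EAdd (repr x) (repr y)).
Definition emul (x y : envelope) : envelope := epi (EMul (repr x) (repr y)).
Definition escale a (x : envelope) : envelope := epi (EScale a (repr x)).

Lemma epiE s t : epi s = epi t <-> env_rel s t.
Proof. by split=> [/eqmodP/asboolP|h]; [|apply/eqmodP/asboolP]. Qed.
Lemma repr_epi t : env_rel (repr (epi t)) t.
Proof. by apply/epiE; rewrite reprK. Qed.
Lemma epi_add s t : eadd (epi s) (epi t) = epi (EAdd s t).
Proof. by apply/epiE; apply: env_addc; exact: repr_epi. Qed.
Lemma epi_mul s t : emul (epi s) (epi t) = epi (EMul s t).
Proof. by apply/epiE; apply: env_mulc; exact: repr_epi. Qed.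
Lemma epi_scale a t : escale a (epi t) = epi (EScale a t).
Proof. by apply/epiE; apply: env_scalec; exact: repr_epi. Qed.
Let epiP (P : envelope -> Prop) : (forall t, P (epi t)) -> forall x, P x.
Proof. by move=> h x; rewrite -[x]reprK. Qed.

Fact eaddA : associative eadd.
Proof.
by do 3![elim/epiP=> ?]; rewrite !epi_add; apply/epiE; constructor.
Qed.
Fact eaddC : commutative eadd.
Proof. by do 2![elim/epiP=> ?]; rewrite !epi_add; apply/epiE; constructor. Qed.
Fact eadd0 : left_id (epi (EH 0)) eadd.
Proof. by elim/epiP=> ?; rewrite epi_add; apply/epiE; constructor. Qed.
Fact eaddN : left_inverse (epi (EH 0)) (escale (-1)) eadd.
Proof.
by elim/epiP=> ?; rewrite epi_scale epi_add; apply/epiE; constructor.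
Qed.
HB.instance Definition _ := GRing.isZmodule.Build envelope eaddA eaddC eadd0 eaddN.

Fact escaleA a b x : escale a (escale b x) = escale (a * b) x.
Proof. by elim/epiP: x => ?; rewrite !epi_scale; apply/epiE; constructor. Qed.
Fact escale1 : left_id 1 escale.
Proof. by elim/epiP=> ?; rewrite epi_scale; apply/epiE; constructor. Qed.
Fact escaleDr : right_distributive escale +%R.
Proof.
move=> a; do 2![elim/epiP=> ?]; rewrite -![_ + _]/(eadd _ _).
by rewrite !(epi_add, epi_scale); apply/epiE; constructor.
Qed.
Fact escaleDl x : {morph escale^~ x : a b / a + b}.
Proof.
elim/epiP: x => ? a b; rewrite -[RHS]/(eadd _ _).
by rewrite !(epi_add, epi_scale); apply/epiE; constructor.
Qed.
HB.instance Definition _ :=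
  GRing.Zmodule_isLmodule.Build C envelope escaleA escale1 escaleDr escaleDl.

Fact emulA : associative emul.
Proof.
by do 3![elim/epiP=> ?]; rewrite !epi_mul; apply/epiE; constructor.
Qed.
Fact emul1l : left_id (epi (EH 1)) emul.
Proof. by elim/epiP=> ?; rewrite epi_mul; apply/epiE; constructor. Qed.
Fact emul1r : right_id (epi (EH 1)) emul.
Proof. by elim/epiP=> ?; rewrite epi_mul; apply/epiE; constructor. Qed.
Fact emulDl : left_distributive emul +%R.
Proof.
do 3![elim/epiP=> ?]; rewrite -![_ + _]/(eadd _ _).
by rewrite !(epi_add, epi_mul); apply/epiE; constructor.
Qed.
Fact emulDr : right_distributive emul +%R.
Proof.
do 3![elim/epiP=> ?]; rewrite -![_ + _]/(eadd _ _).
by rewrite !(epi_add, epi_mul); apply/epiE; constructor.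
Qed.

Fixpoint ecounit (t : eterm) : C :=
  match t with
  | EH h => hcounit h
  | EG _ => 0
  | EAdd s t => ecounit s + ecounit t
  | EMul s t => ecounit s * ecounit t
  | EScale a t => a * ecounit t
  end.

Lemma hcounitM g h : hcounit (g * h) = hcounit g * hcounit h.
Proof.
have cl : linear hcounit by exact: lext_linear.
move: g; apply: (@laurent_ext _ _ (fun g => hcounit (g * h)) (fun g => hcounit g * hcounit h : C^o)).
- by move=> a x y; rewrite mulrDl -scalerAl cl.
- by move=> a x y; rewrite cl mulrDl -scalerAl.
move=> m; move: h; apply: (@laurent_ext _ _ (fun h => hcounit (zpow R m * h)) (fun h => hcounit (zpow R m) * hcounit h : C^o)).
- by move=> a x y; rewrite mulrDr -scalerAr cl.
- by move=> a x y; rewrite cl mulrDr -scalerAr.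
by move=> n; rewrite -zpowD /hcounit !lext_zpow mulr1.
Qed.

Lemma ecounit_rel s t : env_rel s t -> ecounit s = ecounit t.
Proof.
have cl : linear hcounit by exact: lext_linear.
have c0 : hcounit 0 = 0.
  by have := cl (-1) 0 0; rewrite scaler0 addr0 scaleN1r addNr.
have c1 : hcounit 1 = 1 by rewrite -zpow0 /hcounit lext_zpow.
elim=> {s t} /=; rewrite ?c0 ?c1; try by move=> *; rewrite ?(mul0r,mulr0,mul1r,mulr1,add0r,addr0).
- by move=> s t u _ -> _ ->.
- by move=> s s' t t' _ -> _ ->.
- by move=> s s' t t' _ -> _ ->.
- by move=> a s s' _ ->.
- by move=> s t u; rewrite addrA.
- by move=> s t; rewrite addrC.
- by move=> t; rewrite mulN1r addNr.
- by move=> s t u; rewrite mulrA.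
- by move=> s t u; rewrite mulrDl.
- by move=> s t u; rewrite mulrDr.
- by move=> a b t; rewrite mulrA.
- by move=> a s t; rewrite mulrDr.
- by move=> a b t; rewrite mulrDl.
- by move=> a s t; rewrite mulrA.
- by move=> a s t; rewrite mulrCA.
- by move=> a g h; rewrite cl.
- by move=> g h; rewrite hcounitM.
- by move=> s _; elim: s => [|p s IHs] /=; rewrite ?c0// IHs mul0r addr0.
Qed.

Fact env_one_neq0 : epi (EH 1) != epi (EH 0).
Proof.
apply/eqP => /epiE/ecounit_rel /=.
rewrite -zpow0 /hcounit lext_zpow.
have := lext_linear (fun=> 1 : C^o) (-1) (0 : H) (0 : H).
rewrite scaler0 addr0 scaleN1r addNr => -> /eqP.
by rewrite oner_eq0.
Qed.
HB.instance Definition _ := GRing.Zmodule_isNzRing.Build envelope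
  emulA emul1l emul1r emulDl emulDr env_one_neq0.

Fact escaleAl (a : C) (x y : envelope) : a *: (x * y) = (a *: x) * y.
Proof.
elim/epiP: x => ?; elim/epiP: y => ?.
rewrite -[LHS]/(escale a (emul _ _)) -[RHS]/(emul (escale a _) _).
by rewrite !(epi_mul,epi_scale); apply/epiE; constructor.
Qed.
HB.instance Definition _ := GRing.Lmodule_isLalgebra.Build C envelope escaleAl.
Fact escaleAr (a : C) (x y : envelope) : a *: (x * y) = x * (a *: y).
Proof.
elim/epiP: x => ?; elim/epiP: y => ?.
rewrite -[LHS]/(escale a (emul _ _)) -[RHS]/(emul _ (escale a _)).
by rewrite !(epi_mul,epi_scale); apply/epiE; apply: env_scaleAr.
Qed.
HB.instance Definition _ := GRing.Lalgebra_isAlgebra.Build C envelope escaleAr.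

Definition env_H (h : H) : envelope := epi (EH h).
Definition env_G (x : G) : envelope := epi (EG x).

Inductive env_deg : nat -> envelope -> Prop :=
  | env_deg_H h : env_deg 0 (env_H h)
  | env_deg_G k x w : env_deg k w -> env_deg k.+1 (env_G x * w)
  | env_deg_add k w w' : env_deg k w -> env_deg k w' -> env_deg k (w + w').

(* env_inv is the grading involution w |-> (-1)^|w| w *)
Fixpoint egr (t : eterm) : eterm :=
  match t with
  | EH h => EH h
  | EG x => EG (- x)
  | EAdd s t => EAdd (egr s) (egr t)
  | EMul s t => EMul (egr s) (egr t)
  | EScale a t => EScale a (egr t)
  end.
Definition env_inv (w : envelope) : envelope := epi (egr (repr w)).

Record env_differential (d : envelope -> envelope) : Prop := {
  env_d_lin : linear d;
  env_d_H : forall h, d (env_H h) = env_G (bd G h);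
  env_d_leibniz : forall k x y, env_deg k x ->
    d (x * y) = d x * y + (-1) ^+ k *: (x * d y);
  env_dd : forall x, d (d x) = 0 }.

(* the extension of the coproduct to a morphism of differential graded algebras *)
Record env_coproduct (d : envelope -> envelope)
  (D : envelope -> tens envelope envelope) : Prop := {
  env_D_lin : linear D;
  env_D_H : forall h, D (env_H h) = tmap env_H env_H (hcoprod h);
  env_D_mul : forall x y, D (x * y) =
    gt_mul 2^-1 *%R env_inv *%R env_inv (D x) (D y);
  env_D_d : forall x, D (d x) = gt_diff env_inv d d (D x) }.

End Calculus.
End StructureGroup.


Section Smooth.
Variable R : realType.
Notation C := (R[i]).
Notation pt := 'rV[R]_4.

Definition rpartial (mu : 'I_4) (f : pt -> R) : pt -> R :=
  fun x => 'D_(delta_mx 0 mu) f x.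

(* f is of class C^n *)
Fixpoint rCn (n : nat) (f : pt -> R) : Prop :=
  continuous f /\
  if n is n'.+1 then
    forall mu, (forall x, derivable f x (delta_mx 0 mu)) /\ rCn n' (rpartial mu f)
  else True.

Definition rsmooth (f : pt -> R) : Prop := forall n, rCn n f.

Definition reP (f : pt -> C^o) : pt -> R := fun x => complex.Re (f x).
Definition imP (f : pt -> C^o) : pt -> R := fun x => complex.Im (f x).

Lemma rCn_cont n f : rCn n f -> continuous f.
Proof. by case: n => [|n] []. Qed.

Lemma rCnS n f : rCn n.+1 f -> rCn n f.
Proof.
elim: n f => [|n IHn] f [cf hf]; split=> // mu.
by have [df hd] := hf mu; split=> //; exact: IHn.
Qed.

Lemma rCn_cst n (c : R) : rCn n (cst c).
Proof.
elim: n c => [|n IHn] c; split; try exact: cst_continuous; first by [].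
move=> mu; split; first by move=> x; exact: derivable_cst.
have -> : rpartial mu (cst c) = cst 0.
  by apply/funext => x; rewrite /rpartial derive_cst.
exact: IHn.
Qed.

Lemma rpartialD mu f g :
  (forall x, derivable f x (delta_mx 0 mu)) ->
  (forall x, derivable g x (delta_mx 0 mu)) ->
  rpartial mu (f \+ g) = rpartial mu f \+ rpartial mu g.
Proof. by move=> df dg; apply/funext => x; exact: deriveD. Qed.

Lemma rCnD n f g : rCn n f -> rCn n g -> rCn n (f \+ g).
Proof.
elim: n f g => [|n IHn] f g [cf hf] [cg hg]; split; try (by []);
  try by move=> x; exact: (continuousD (cf x) (cg x)).
move=> mu; have [df hdf] := hf mu; have [dg hdg] := hg mu; split.
  by move=> x; exact: derivableD.
by rewrite rpartialD//; exact: IHn.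
Qed.

Lemma rCnM n f g : rCn n f -> rCn n g -> rCn n (f \* g).
Proof.
elim: n f g => [|n IHn] f g Hf Hg; have [cf hf] := Hf; have [cg hg] := Hg;
  split; try (by []);
  try by move=> x; exact: (continuousM (cf x) (cg x)).
move=> mu; have [df hdf] := hf mu; have [dg hdg] := hg mu; split.
  by move=> x; exact: derivableM.
have -> : rpartial mu (f \* g) = (f \* rpartial mu g) \+ (g \* rpartial mu f).
  by apply/funext => x; exact: deriveM.
by apply: rCnD; apply: IHn => //; exact: rCnS.
Qed.

Lemma rCnN n f : rCn n f -> rCn n (\- f).
Proof.
move=> h; have -> : (\- f) = (cst (-1) \* f).
  by apply/funext => x /=; rewrite mulN1r.
by apply: rCnM => //; exact: rCn_cst.
Qed.

Definition csmooth : {pred pt -> C^o} :=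
  fun f => `[< rsmooth (reP f) /\ rsmooth (imP f) >].

Fact csmooth_submod : submod_closed csmooth.
Proof.
split.
  by apply/asboolP; split=> n; [rewrite (_ : reP _ = cst 0)|rewrite (_ : imP _ = cst 0)] => //; exact: rCn_cst.
move=> a f g /asboolP[rf If] /asboolP[rg Ig]; apply/asboolP; split=> n.
- have -> : reP (a *: f + g) = (cst (complex.Re a) \* reP f \+
      \- (cst (complex.Im a) \* imP f)) \+ reP g.
    by apply/funext => x /=; rewrite /reP /imP !fctE/=; case: (f x) (g x) a => [? ?] [? ?] [? ?].
  by apply: rCnD => //; apply: rCnD; [|apply: rCnN]; apply: rCnM => //; exact: rCn_cst.
- have -> : imP (a *: f + g) = (cst (complex.Re a) \* imP f \+
      (cst (complex.Im a) \* reP f)) \+ imP g.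
    by apply/funext => x /=; rewrite /reP /imP !fctE/=; case: (f x) (g x) a => [? ?] [? ?] [? ?].
  by apply: rCnD => //; apply: rCnD; apply: rCnM => //; exact: rCn_cst.
Qed.
HB.instance Definition _ :=
  GRing.isSubmodClosed.Build C (pt -> C^o) csmooth csmooth_submod.

Record smooth := Smooth { sfun :> pt -> C^o; _ : sfun \in csmooth }.
HB.instance Definition _ := [isSub for sfun].
HB.instance Definition _ := [Choice of smooth by <:].
HB.instance Definition _ := [SubChoice_isSubLmodule of smooth by <:].

Fact smooth_mul_subproof (f g : smooth) : (fun x => f x * g x : C^o) \in csmooth.
Proof.
case: f g => [f hf] [g hg] /=; move: hf hg => /asboolP[rf If] /asboolP[rg Ig].
apply/asboolP.
split=> n.
- have -> : reP (fun x => f x * g x : C^o) =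
      (reP f \* reP g) \+ \- (imP f \* imP g).
    by apply/funext => x /=; rewrite /reP /imP; case: (f x) (g x) => [? ?] [? ?].
  by apply: rCnD; [|apply: rCnN]; apply: rCnM.
- have -> : imP (fun x => f x * g x : C^o) =
      (reP f \* imP g) \+ (imP f \* reP g).
    by apply/funext => x /=; rewrite /reP /imP; case: (f x) (g x) => [? ?] [? ?].
  by apply: rCnD; apply: rCnM.
Qed.
Definition smul (f g : smooth) : smooth := Smooth (smooth_mul_subproof f g).

Fact smooth_one_subproof : (fun=> 1 : C^o) \in csmooth.
Proof.
by apply/asboolP; split=> n; [rewrite (_ : reP _ = cst 1)|rewrite (_ : imP _ = cst 0)] => //; exact: rCn_cst.
Qed.
Definition sone : smooth := Smooth smooth_one_subproof.

Fact smooth_conj_subproof (f : smooth) : (fun x => (f x)^* : C^o) \in csmooth.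
Proof.
case: f => [f hf] /=; move: hf => /asboolP[rf If]; apply/asboolP; split=> n.
- have -> : reP (fun x => (f x)^* : C^o) = reP f.
    by apply/funext => x; rewrite /reP; case: (f x).
  exact: rf.
- have -> : imP (fun x => (f x)^* : C^o) = \- imP f.
    by apply/funext => x; rewrite /imP /=; case: (f x).
  exact: rCnN.
Qed.
Definition sconj (f : smooth) : smooth := Smooth (smooth_conj_subproof f).

Fact smooth_partial_subproof mu (f : smooth) :
  (fun x => rpartial mu (reP f) x +i* rpartial mu (imP f) x : C^o)%C \in csmooth.
Proof.
case: f => [f hf] /=; move: hf => /asboolP[rf If]; apply/asboolP; split=> n.
  by have [_ /(_ mu)[]] := rf n.+1.
by have [_ /(_ mu)[]] := If n.+1.
Qed.
Definition spartial mu (f : smooth) : smooth :=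
  Smooth (smooth_partial_subproof mu f).

Definition ssupp_compact (f : smooth) : Prop :=
  compact (closure [set x : pt | f x != 0]).

Definition coords (p : R * R * R * R) : pt :=
  let: (x0, x1, x2, x3) := p in \row_(i < 4) nth 0 [:: x0; x1; x2; x3] i.

Notation lebesgue4 := (lebesgue_measure \x lebesgue_measure \x
  lebesgue_measure \x lebesgue_measure)%E.

Definition sintegral (f : smooth) : C :=
  (Rintegral lebesgue4 setT (reP f \o coords) +i*
   Rintegral lebesgue4 setT (imP f \o coords))%C.

End Smooth.


Section Moyal.
Variable R : realType.
Notation C := (R[i]).

(* The formal parameters are the six independent entries theta^{mu nu}, mu < nu;
   thexp is the type of exponents of monomials in them. *)
Definition thvar := {p : 'I_4 * 'I_4 | (p.1 < p.2)%N}.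
Definition thexp := {ffun thvar -> nat}.
Definition thdeg (n : thexp) : nat := (\sum_p n p)%N.

Definition moyalB : lmodType C := thexp -> smooth R.
Definition thseries : lmodType C := thexp -> C^o.

Definition th_shift (p : thvar) (f : moyalB) : moyalB := fun n =>
  if n p is k.+1 then f [ffun q => if q == p then k else n q] else 0.

(* multiplication by theta^{mu nu} = - theta^{nu mu} *)
Definition th_mul (mu nu : 'I_4) (f : moyalB) : moyalB :=
  if insub (mu, nu) is Some p then th_shift p f
  else if insub (nu, mu) is Some p then - th_shift p f
  else 0.

Definition bpartial mu (f : moyalB) : moyalB := fun n => spartial mu (f n).
Definition bconj (f : moyalB) : moyalB := fun n => sconj (f n).

Definition bpoint (f h : moyalB) : moyalB := fun n =>
  \sum_(k : {ffun thvar -> 'I_(thdeg n).+1} | [forall p, (k p <= n p)%N])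
    smul (f [ffun p => k p : nat]) (h [ffun p => (n p - k p)%N]).

(* bidiff N is m o (i theta^{mu nu} / 2 d_mu (x) d_nu)^N; it has order at least N
   in theta, so that the exponential series is finite in each degree. *)
Fixpoint bidiff (N : nat) (f h : moyalB) : moyalB :=
  if N is N'.+1 then
    \sum_(mu < 4) \sum_(nu < 4)
      ('i / 2) *: th_mul mu nu (bidiff N' (bpartial mu f) (bpartial nu h))
  else bpoint f h.

Definition moyal (f h : moyalB) : moyalB := fun n =>
  \sum_(N < (thdeg n).+1) (N`!%:R : C)^-1 *: bidiff N f h n.

Definition bone : moyalB := fun n => if thdeg n == 0%N then sone R else 0.

Definition bintegral (f : moyalB) : thseries := fun n => sintegral (f n).
Definition bsupp_compact (f : moyalB) : Prop := forall n, ssupp_compact (f n).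

(* a : forms stands for the sum of the a I dx^I, where the dx^mu, mu in I, are
   multiplied in increasing order *)
Definition forms : lmodType C := {set 'I_4} -> moyalB.

Definition homog (k : nat) (a : forms) : Prop :=
  forall I : {set 'I_4}, #|I| != k -> a I = 0.
Definition hcomp (k : nat) (a : forms) : forms :=
  fun I => if #|I| == k then a I else 0.
(* Signs (-1)^k depending on the degree k of a form are extended additively to
   inhomogeneous forms by means of fgrade. *)
Definition fgrade (a : forms) : forms := fun I => (-1) ^+ #|I| *: a I.

(* dx^I /\ dx^J = wsign I J dx^(I u J) for disjoint I and J *)
Definition wsign (I J : {set 'I_4}) : C :=
  (-1) ^+ #|[pred p : 'I_4 * 'I_4 | [&& p.1 \in I, p.2 \in J & (p.2 < p.1)%N]]|.

Definition wedge (a b : forms) : forms := fun K =>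
  \sum_(I : {set 'I_4} | I \subset K)
    wsign I (K :\: I)%SET *: moyal (a I) (b (K :\: I)%SET).

Definition fdiff (a : forms) : forms := fun K =>
  \sum_(mu in K) wsign [set mu]%SET (K :\ mu)%SET *: bpartial mu (a (K :\ mu)%SET).

Definition fone : forms := fun I => if I == finset.set0 then bone else 0.

Definition minkowski (mu nu : 'I_4) : C :=
  if mu == nu then (if mu == ord0 then 1 else -1) else 0.

Definition gram (I J : {set 'I_4}) : C :=
  if #|I| == #|J| then
    \det (\matrix_(a < #|I|, b < #|I|)
            minkowski (nth ord0 (enum I) a) (nth ord0 (enum J) b))
  else 0.

Definition fpair (a b : forms) : moyalB :=
  \sum_(I : {set 'I_4}) \sum_(J : {set 'I_4})
    gram I J *: moyal (a I) (bconj (b J)).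

Definition finner (a b : forms) : thseries := bintegral (fpair a b).

(* The coefficient of dvol in dx^(~: K) /\ (hodge b) is
   wsign (~: K) K *: hodge b K; it must equal <dx^(~: K), b>. *)
Definition hodge (b : forms) : forms := fun K =>
  \sum_(J : {set 'I_4}) (wsign (~: K)%SET K * gram (~: K)%SET J) *: bconj (b J).

Definition hodge_inv (b : forms) : forms := xget 0 [set a | hodge a = b].

(* (-1)^(k+1) hodge^-1 o d o hodge on forms of degree k+1, for each k *)
Definition codiff (b : forms) : forms :=
  \sum_(k < 4) (-1) ^+ k.+1 *: hodge_inv (fdiff (hodge (hcomp k.+1 b))).

Definition fsupp_compact (a : forms) : Prop := forall I, bsupp_compact (a I).

(* [a, b]^d *)
Definition gcomm (a b : forms) : forms := wedge a b - wedge (fgrade b) a.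

(* bilinearity needed for the left B-module structure of E *)
Fact spartial_lin mu : linear (@spartial R mu).
Proof.
move=> a [f hf] [g hg]; apply/val_inj/funext => x /=.
move: hf hg => /asboolP[rf If] /asboolP[rg Ig].
have [_ /(_ mu)[drf _]] := rf 1%N; have [_ /(_ mu)[dif _]] := If 1%N.
have [_ /(_ mu)[drg _]] := rg 1%N; have [_ /(_ mu)[dig _]] := Ig 1%N.
rewrite !fctE /=.
have -> : reP (a *: f + g) = ((complex.Re a *: reP f) -
      (complex.Im a *: imP f)) + reP g.
  by apply/funext => y; rewrite /reP /imP !fctE/=; case: (f y) (g y) a => [? ?] [? ?] [? ?].
have -> : imP (a *: f + g) = ((complex.Re a *: imP f) +
      (complex.Im a *: reP f)) + imP g.
  by apply/funext => y; rewrite /reP /imP !fctE/=; case: (f y) (g y) a => [? ?] [? ?] [? ?].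
rewrite /rpartial deriveD//; last by apply: derivableB; exact: derivableZ.
rewrite deriveB//; [|exact: derivableZ..].
rewrite deriveD//; last by apply: derivableD; exact: derivableZ.
rewrite deriveD//; [|exact: derivableZ..].
rewrite !deriveZ//.
by case: a.
Qed.

Fact smul_linr (f : smooth R) : linear (smul f).
Proof.
move=> a g h; apply/val_inj/funext => x /=; rewrite !fctE /=.
by rewrite mulrDr -scalerAr.
Qed.

Fact bpoint_linr (f : moyalB) : linear (bpoint f).
Proof.
move=> a g h; apply/funext => n; rewrite /bpoint !fctE scaler_sumr -big_split /=.
by apply: eq_bigr => k _; rewrite smul_linr.
Qed.

Fact th_shift_lin p : linear (th_shift p).
Proof.
move=> a g h; apply/funext => n; rewrite /th_shift !fctE.
by case: (n p) => [|k]; rewrite ?scaler0 ?addr0.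
Qed.

Fact th_mul_lin mu nu : linear (th_mul mu nu).
Proof.
move=> a g h; rewrite /th_mul; case: insub => [p|]; first exact: th_shift_lin.
case: insub => [p|]; last by rewrite scaler0 addr0.
by rewrite th_shift_lin opprD scalerN.
Qed.

Fact bpartial_lin mu : linear (bpartial mu).
Proof. by move=> a g h; apply/funext => n; rewrite /bpartial !fctE spartial_lin. Qed.

Fact bidiff_linr N (f : moyalB) : linear (bidiff N f).
Proof.
elim: N f => [|N IHN] f a g h /=; first exact: bpoint_linr.
rewrite scaler_sumr -big_split; apply: eq_bigr => mu _ /=.
rewrite scaler_sumr -big_split; apply: eq_bigr => nu _ /=.
by rewrite bpartial_lin IHN th_mul_lin scalerDr !scalerA mulrC.
Qed.

Fact moyal_linr (f : moyalB) : linear (moyal f).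
Proof.
move=> a g h; apply/funext => n; rewrite /moyal !fctE scaler_sumr -big_split.
apply: eq_bigr => N _ /=.
by rewrite bidiff_linr !fctE scalerDr !scalerA mulrC.
Qed.

End Moyal.


Section Bundle.
Variables (R : realType) (G : bcalc R).
Notation C := (R[i]).
Notation H := (laurent R).
Notation B := (moyalB R).
Notation OB := (forms R).
Notation Env := (envelope G).
Notation OP := (tens OB Env).
Notation Hor := (tens OB H).
Notation P := (tens B H).
Notation theta0 := (vtheta G).

Variable d : Env -> Env.
Variable D : Env -> tens Env Env.

Definition pmul : OP -> OP -> OP :=
  gt_mul 2^-1 (@wedge R) (@fgrade R) *%R (@env_inv R G).
Definition pdiff : OP -> OP := gt_diff (@fgrade R) (@fdiff R) d.
Definition pone : OP := fone R \ox 1.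
Definition pdeg (k : nat) (x : OP) : Prop :=
  exists2 s : seq (OB * Env), x = \sum_(p <- s) p.1 \ox p.2 &
    forall p, p \in s ->
      exists i j, [/\ (i + j)%N = k, homog i p.1 & env_deg j p.2].
Definition pcoact : OP -> tens OP Env :=
  tlift (fun a w => tlift (fun w1 w2 => (a \ox w1 : OP) \ox w2) (D w)).

Record connection (om : invG G -> OP) : Prop := {
  conn_lin : linear om;
  conn_deg : forall x, pdeg 1 (om x);
  conn_cov : forall x, pcoact (om x) =
    tmap om (@env_H R G) (ad x) + pone \ox env_G (ginv x) }.

Record gauge_potential (om : invG G -> OP) (A : invG G -> OB) : Prop := {
  pot_lin : linear A;
  pot_deg : forall x, homog 1 (A x);
  potE : forall x, om x = A x \ox 1 + fone R \ox env_G (ginv x) }.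

(* Linear maps on invG are given by their value at vtheta. *)
Definition Theta (x : invG G) : tens (invG G) (invG G) :=
  vcoord x *: ('i *: (theta0 \ox theta0)).

Definition bracketP (c e : invG G -> OP) : invG G -> OP := fun x =>
  tlift (fun u v => pmul (c u) (e v)) (Theta x).
Definition bracketB (c e : invG G -> OB) : invG G -> OB := fun x =>
  tlift (fun u v => wedge (c u) (e v)) (Theta x).

Definition curvature (om : invG G -> OP) : invG G -> OP := fun x =>
  pdiff (om x) - bracketP om om x.
Definition field_strength (A : invG G -> OB) : invG G -> OB := fun x =>
  fdiff (A x) - bracketB A A x.

(* Hor is the subspace Omega(B) (x) H of OP, via hor_incl. *)
Definition hor_incl : Hor -> OP := tmap id (@env_H R G).
Definition hor_grade : Hor -> Hor := tmap (@fgrade R) id.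
Definition hor_coact : Hor -> tens Hor H :=
  tlift (fun a h => tlift (fun h1 h2 => (a \ox h1 : Hor) \ox h2) (hcoprod h)).

Definition cov_diff (om : invG G -> OP) (psi : Hor) : OP :=
  pdiff (hor_incl psi) -
  tlift (fun psi0 g => pmul (hor_incl psi0) (om (qgerm G g)))
        (hor_coact (hor_grade psi)).

Definition mor_hor (tau : invG G -> Hor) : Prop :=
  linear tau /\ forall x, tmap tau id (ad x) = hor_coact (tau x).

Definition ad_comm (tau om : invG G -> OP) : invG G -> OP := fun x =>
  tlift (fun u g => pmul (tau u) (om (qgerm G g))) (ad x).

Definition Sop (om : invG G -> OP) (tau : invG G -> Hor) : invG G -> OP :=
  let tau0 := hor_incl \o tau in
  let tau1 := hor_incl \o hor_grade \o tau in
  fun x => bracketP om tau0 x - bracketP tau1 om x - ad_comm tau1 om x.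

Definition prin_coact : P -> tens P H :=
  tlift (fun b h => tlift (fun h1 h2 => (b \ox h1 : P) \ox h2) (hcoprod h)).

Let coact_bilin (b : B) : is_bilinear (fun h1 h2 => (b \ox h1 : P) \ox h2 : tens P H).
Proof.
apply: (@bilin_comp _ _ _ _ _ _ _ (fun h => b \ox h) id (ox_bilinear P H)) => //.
exact: (ox_bilinear B H).2.
Qed.

Let lin0 (V W : lmodType C) (f : V -> W) : linear f -> f 0 = 0.
Proof. by move=> fl; have := fl (-1) 0 0; rewrite scaler0 addr0 scaleN1r addNr. Qed.

Let linD (V W : lmodType C) (f : V -> W) : linear f -> {morph f : x y / x + y}.
Proof. by move=> fl u v; have := fl 1 u v; rewrite !scale1r. Qed.

Lemma prin_coact_bilin : is_bilinear (fun (b : B) h =>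
  tlift (fun h1 h2 => (b \ox h1 : P) \ox h2) (hcoprod h) : tens P H).
Proof.
split=> [h|b] a x y; last by rewrite /hcoprod lext_linear (tlift_lin (coact_bilin b)).
elim/tens_ind: (hcoprod h) => [|h1 h2 z IHz].
  by rewrite !tlift_tens0// scaler0 addr0.
rewrite !tlift_tensD// IHz (ox_bilinear B H).1 (ox_bilinear P H).1.
by rewrite scalerDr !addrA; congr (_ + _); rewrite -!addrA; congr (_ + _); rewrite addrC.
Qed.

Lemma prin_coact_lin : linear prin_coact.
Proof. exact: tlift_lin prin_coact_bilin. Qed.

Definition prin_act (b : B) : P -> P := tmap (@moyal R b) id.

Lemma prin_act_lin b : linear (prin_act b).
Proof. by apply: tmap_lin => //; exact: moyal_linr. Qed.

Lemma prin_coact_act b x :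
  prin_coact (prin_act b x) = tmap (prin_act b) id (prin_coact x).
Proof.
have lt : linear (tmap (prin_act b) (id : H -> H)).
  by apply: tmap_lin => //; exact: prin_act_lin.
elim/tens_ind: x => [|c h x IHx].
  by rewrite (lin0 (prin_act_lin b)) (lin0 prin_coact_lin) (lin0 lt).
rewrite (linD (prin_act_lin b)) !(linD prin_coact_lin) IHx (linD lt).
congr (_ + _).
rewrite /prin_act tmap_ox//; last exact: moyal_linr.
rewrite /prin_coact !(tlift_ox _ _ prin_coact_bilin).
elim/tens_ind: (hcoprod h) => [|h1 h2 z IHz].
  by rewrite !tlift_tens0// (lin0 lt).
rewrite !tlift_tensD// IHz (linD lt) tmap_ox//; last exact: prin_act_lin.
by rewrite /prin_act tmap_ox//; exact: moyal_linr.
Qed.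

(* E = Mor(ad, Delta_P) *)
Definition mor_prin : {pred invG G -> P} := fun T =>
  `[< linear T /\ forall x, tmap T id (ad x) = prin_coact (T x) >].

Fact mor_prin_submod : submod_closed mor_prin.
Proof.
have o0 y : 0 \ox y = 0 :> tens P H by exact: (lin0 ((ox_bilinear P H).1 y)).
have l0 : linear (0 : invG G -> P) by move=> a x y; rewrite scaler0 addr0.
split.
  apply/asboolP; split=> // x.
  by rewrite /ad tmap_ox//; exact: etrans (o0 _) (esym (lin0 prin_coact_lin)).
move=> a S T /asboolP[Sl Sc] /asboolP[Tl Tc]; apply/asboolP.
have STl : linear (a *: S + T).
  move=> b x y; rewrite !fctE Sl Tl !scalerDr !scalerA mulrC -!addrA.
  by congr (_ + _); rewrite addrCA.
split=> // x; rewrite /ad tmap_ox// [in RHS]fctE prin_coact_lin -Sc -Tc /ad.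
by rewrite !tmap_ox// fctE (ox_bilinear P H).1.
Qed.
HB.instance Definition _ :=
  GRing.isSubmodClosed.Build C (invG G -> P) mor_prin mor_prin_submod.

Record assoc := Assoc { afun :> invG G -> P; _ : afun \in mor_prin }.
HB.instance Definition _ := [isSub for afun].
HB.instance Definition _ := [Choice of assoc by <:].
HB.instance Definition _ := [SubChoice_isSubLmodule of assoc by <:].

Fact assoc_act_subproof b (T : assoc) : (fun x => prin_act b (T x)) \in mor_prin.
Proof.
case: T => T /= /asboolP[Tl Tc]; apply/asboolP.
have bTl : linear (fun x => prin_act b (T x)).
  by move=> a x y; rewrite Tl prin_act_lin.
split=> // x; rewrite prin_coact_act -Tc /ad !tmap_ox//.
exact: prin_act_lin.
Qed.
Definition assoc_act b (T : assoc) : assoc := Assoc (assoc_act_subproof b T).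

Definition form_act (a : OB) (b : B) : OB := fun I => moyal (a I) b.

(* Omega(B) (x)_B E *)
Definition qvforms : lmodType C := btens form_act assoc_act.
Definition vtens (a : OB) (T : assoc) : qvforms := tpure form_act assoc_act a T.

Definition T_one : assoc := xget 0 [set T : assoc | T theta0 = bone R \ox 1].

(* tau |-> a (x)_B T_one if tau vtheta = a (x) 1 *)
Definition Upsilon (tau : invG G -> OP) : qvforms :=
  vtens (xget 0 [set a | tau theta0 = a \ox 1]) T_one.
Definition Upsilon_inv (y : qvforms) : invG G -> Hor :=
  xget 0 [set tau | mor_hor tau /\ Upsilon (hor_incl \o tau) = y].

(* qvforms is free over Omega(B) on T_one; vcomp is the component. *)
Definition vcomp (y : qvforms) : OB := xget 0 [set a | y = vtens a T_one].
Definition vinner (y y' : qvforms) : thseries R := finner (vcomp y) (vcomp y').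
Definition vsupp_compact (y : qvforms) : Prop := fsupp_compact (vcomp y).

Definition nabla_diff (om : invG G -> OP) (y : qvforms) : qvforms :=
  Upsilon (fun x => cov_diff om (Upsilon_inv y x)).
Definition S_diff (om : invG G -> OP) (y : qvforms) : qvforms :=
  Upsilon (Sop om (Upsilon_inv y)).

Definition dS (A : invG G -> OB) (T : invG G -> OB) : invG G -> OB := fun x =>
  vcoord x *: ('i *: gcomm (A theta0) (T theta0)).
Definition on_value (L : OB -> OB) (T : invG G -> OB) : invG G -> OB := fun x =>
  vcoord x *: L (T theta0).
Definition linner (T T' : invG G -> OB) : thseries R :=
  finner (T theta0) (T' theta0).
Definition lsupp_compact (T : invG G -> OB) : Prop := fsupp_compact (T theta0).

End Bundle.

Definition formal_adjoint (R : realType) (X : Type) (dom : X -> Prop)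
  (inner : X -> X -> thseries R) (cpt : X -> Prop) (L L' : X -> X) : Prop :=
  (forall y, dom y -> dom (L' y)) /\
  forall x y, dom x -> dom y -> cpt x \/ cpt y -> inner (L x) y = inner x (L' y).

Definition vadjoint (R : realType) (G : bcalc R) :
    (qvforms G -> qvforms G) -> (qvforms G -> qvforms G) -> Prop :=
  formal_adjoint (fun=> True) (@vinner R G) (@vsupp_compact R G).

Definition ladjoint (R : realType) (G : bcalc R) :
    ((invG G -> forms R) -> invG G -> forms R) ->
    ((invG G -> forms R) -> invG G -> forms R) -> Prop :=
  formal_adjoint (fun T : invG G -> forms R => linear T)
    (@linner R G) (@lsupp_compact R G).

(* Main.v *)
From HB Require Import structures.
Require Import Defs.
From mathcomp Require Import all_boot all_order all_algebra.
From mathcomp Require Import finmap generic_quotient complex.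
From mathcomp Require Import all_classical all_reals all_analysis.
From mathcomp Require Import measurable_realfun.
From mathcomp Require Import ring lra.

(** The proof rests on three facts about the Moyal product: it is associative
    ([moyalA]), it has a unit, and the integral is a nondegenerate trace for it
    ([bintegral_moyalC], [bintegral_nondeg]).

    Associativity: the terms of order [N] in theta of the two bracketings of a triple
    product satisfy one and the same recursion [tridiff], which is the
    coefficientwise form of the differential equation obtained by scaling theta. The
    trace property: since theta is antisymmetric and partial derivatives commute
    ([rpartialC]), all terms of positive order are total derivatives, whose integrals
    vanish ([integral_rpartial]); hence the integral of a Moyal product is that of
    the commutative pointwise product. Nondegeneracy comes from smooth bump functions
    ([sintegral_nondeg]).

    By the defining property of the Hodge operator ([fpairE]), the pairing of two
    forms is the integral [wint] of the top component of a wedge product. Stokes and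
    the graded Leibniz rule then show that [codiff] is adjoint to [fdiff]
    ([wint_fdiff], [finner_fdiff]). Graded cyclicity of the integral shows in the
    same way that the commutator with a one-form [A] is moved to the other argument
    ([wint_gcomm]), so that its adjoint is the conjugate of a commutator by the Hodge
    operator ([finner_gcomm]); the factor [i] changes sign on the way because the
    Hodge operator is antilinear. As compactly supported forms separate forms
    ([finner_nondeg]), formal adjoints are unique, and any operator with the adjoint
    property agrees with these formulas.

    It remains to translate the bundle operators. The space of invariant forms is
    spanned by [vtheta] ([vcoordP]), covariance forces an equivariant map to have its
    value at [vtheta] in the component of [z^0] ([coinvariantP]), and so the bundle
    of forms is free on [T_one]: it is generated by it ([qvforms_free]), and the
    component is unique because the Moyal product is associative and unital
    ([vtens_inj]). On components, the covariant derivative becomes [fdiff], since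
    [pi(1) = 0] ([nabla_diffE]), and the operator S becomes [i] times the graded
    commutator with [A vtheta], since the vertical part of the connection contributes
    two terms that cancel ([S_diffE]). Finally the structure equation
    [d vtheta = i vtheta vtheta] ([env_d_vtheta]) identifies the curvature with the
    field strength ([curvature_vtheta]). *)

Set Implicit Arguments.
Unset Strict Implicit.
Unset Printing Implicit Defensive.

Import Order.TTheory GRing.Theory Num.Theory numFieldNormedType.Exports.
Local Open Scope classical_set_scope.
Local Open Scope ring_scope.

(** * Symmetry of mixed partial derivatives *)

Section RealPartials.
Variable R : realType.
Notation pt := 'rV[R]_4.
Local Notation e mu := (delta_mx 0 mu : 'rV[R]_4).

Lemma line_continuous (v x : pt) : continuous (fun t : R => t *: v + x).
Proof.
by move=> t; apply: cvgD; [exact: scalel_continuous|exact: cvg_cst].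
Qed.

Lemma line_is_derive (f : pt -> R) (v x : pt) (t : R) :
  derivable f (t *: v + x) v ->
  is_derive t 1 (fun s : R => f (s *: v + x)) ('D_v f (t *: v + x)).
Proof.
move=> df.
have E : (fun h : R => h^-1 *: (((fun s : R => f (s *: v + x)) \o shift t) (h *: 1) -
            f (t *: v + x))) =
         (fun h : R => h^-1 *: ((f \o shift (t *: v + x)) (h *: v) - f (t *: v + x))).
  by apply/funext => h /=; rewrite [h *: 1]mulr1 scalerDl addrA.
apply: DeriveDef; first by rewrite /derivable E.
by rewrite /derive E.
Qed.

(** The mean value theorem in the direction [u], for the difference of [f] along
    [h *: v], followed by the mean value theorem in the direction [v]. *)
Lemma mean_square (f : pt -> R) (u v x : pt) (h : R) : 0 < h ->
  (forall y, derivable f y u) -> (forall y, derivable ('D_u f) y v) ->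
  exists s t : R, [/\ 0 < s < h, 0 < t < h &
    f (h *: u + (h *: v + x)) - f (h *: u + x) - (f (h *: v + x) - f x)
      = h * h * 'D_v ('D_u f) (s *: u + t *: v + x)].
Proof.
move=> h0 df ddf.
pose g (s : R) := f (s *: u + (h *: v + x)) - f (s *: u + x).
have dg (s : R) : is_derive s 1 g ('D_u f (s *: u + (h *: v + x)) - 'D_u f (s *: u + x)).
  by apply: is_deriveB; apply: line_is_derive.
have cont (k dk : R -> R) : (forall s : R, is_derive s 1 k (dk s)) -> {within `[0, h], continuous k}.
  move=> dk'; apply: continuous_subspaceT => s.
  by apply: differentiable_continuous; apply/derivable1_diffP; have [] := dk' s.
have [s s0h gs] := @MVT _ g _ _ _ h0 (fun s _ => dg s) (cont _ _ dg).
pose k (t : R) := 'D_u f (t *: v + (s *: u + x)).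
have dk (t : R) : is_derive t 1 k ('D_v ('D_u f) (t *: v + (s *: u + x))).
  by apply: line_is_derive.
have [t t0h kt] := @MVT _ k _ _ _ h0 (fun t _ => dk t) (cont _ _ dk).
exists s, t; split; [by move: s0h; rewrite in_itv|by move: t0h; rewrite in_itv|].
have -> : f (h *: u + (h *: v + x)) - f (h *: u + x) - (f (h *: v + x) - f x) = g h - g 0.
  by rewrite /g !scale0r !add0r.
rewrite gs subr0.
have -> : 'D_u f (s *: u + (h *: v + x)) - 'D_u f (s *: u + x) = k h - k 0.
  by rewrite /k scale0r add0r addrCA.
rewrite [s *: u + t *: v]addrC -[t *: v + s *: u + x]addrA kt subr0.
by rewrite -mulrA mulrC.
Qed.

Lemma plane_close (g : pt -> R) (u v x : pt) (eps : R) : 0 < eps ->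
  {for x, continuous g} ->
  exists2 d : R, 0 < d & forall s t : R, 0 < s < d -> 0 < t < d ->
    `|g x - g (s *: u + t *: v + x)| < eps.
Proof.
move=> e0 cg.
have : {for (0, 0) : R * R, continuous (fun p : R * R => g (p.1 *: u + p.2 *: v + x))}.
  apply: (@continuous_comp _ _ _ (fun p : R * R => p.1 *: u + p.2 *: v + x) g).
    apply: continuousD; last exact: cvg_cst.
    apply: continuousD.
      by apply: (@continuous_comp _ _ _ fst (fun t : R => t *: u)); [exact: cvg_fst|exact: scalel_continuous].
    by apply: (@continuous_comp _ _ _ snd (fun t : R => t *: v)); [exact: cvg_snd|exact: scalel_continuous].
  by rewrite /= !scale0r !add0r.
move=> /cvgrPdist_lt /(_ _ e0); rewrite /= !scale0r !add0r => -[[A B]] /= [].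
move=> /nbhs_ballP[a a0 aA] /nbhs_ballP[b b0 bB] AB.
exists (Num.min a b); first by rewrite lt_min a0 b0.
move=> s t /andP[s0]; rewrite lt_min => /andP[sa _] /andP[t0]; rewrite lt_min => /andP[_ tb].
by apply: (AB (s, t)); split; [apply: aA|apply: bB];
   rewrite /ball/= sub0r normrN gtr0_norm.
Qed.

(** All the points at which the values agree tend to [x] as [h] tends to 0. *)
Lemma plane_values_eq (g1 g2 : pt -> R) (u v x : pt) :
  {for x, continuous g1} -> {for x, continuous g2} ->
  (forall h : R, 0 < h -> exists s t s' t' : R,
    [/\ 0 < s < h, 0 < t < h, 0 < s' < h, 0 < t' < h &
        g1 (s *: u + t *: v + x) = g2 (t' *: v + s' *: u + x)]) ->
  g1 x = g2 x.
Proof.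
move=> c1 c2 H; apply/eqP; rewrite -subr_eq0 -normr_le0 leNgt; apply/negP.
set e0 := `|_| => e0_gt0; have e2 : 0 < e0 / 2 by rewrite divr_gt0.
have [a a0 ca] := plane_close u v e2 c1.
have [b b0 cb] := plane_close v u e2 c2.
have h0 : 0 < Num.min a b by rewrite lt_min a0 b0.
have [s [t [s' [t' [/andP[s0 sh] /andP[t0 th] /andP[s'0 s'h] /andP[t'0 t'h] E]]]]] := H _ h0.
move: sh th s'h t'h; rewrite !lt_min => /andP[sa _] /andP[ta _] /andP[_ sb] /andP[_ tb].
have A1 : `|g1 x - g1 (s *: u + t *: v + x)| < e0 / 2 by apply: ca; apply/andP.
have A2 : `|g2 x - g2 (t' *: v + s' *: u + x)| < e0 / 2 by apply: cb; apply/andP.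
move: A1 A2; rewrite E => A1 A2.
have : e0 < e0 / 2 + e0 / 2.
  apply: le_lt_trans (ltrD A1 A2).
  rewrite [X in _ <= _ + X]distrC; apply: le_trans (ler_normD _ _).
  by rewrite addrA subrK.
by rewrite -splitr ltxx.
Qed.

(** Schwarz: both mixed derivatives are limits of the same second difference
    quotients over small squares, by two applications of the mean value theorem. *)
Lemma derive_swap (f : pt -> R) (u v x : pt) :
  (forall y, derivable f y u) -> (forall y, derivable f y v) ->
  (forall y, derivable ('D_u f) y v) -> (forall y, derivable ('D_v f) y u) ->
  continuous ('D_v ('D_u f)) -> continuous ('D_u ('D_v f)) ->
  'D_v ('D_u f) x = 'D_u ('D_v f) x.
Proof.
move=> fu fv fuv fvu cuv cvu.
apply: (plane_values_eq (u := u) (v := v) (cuv x) (cvu x)) => h h0.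
have [s [t [sh th E1]]] := mean_square x h0 fu fuv.
have [t' [s' [th' sh' E2]]] := mean_square x h0 fv fvu.
exists s, t, s', t'; split; [exact: sh|exact: th|exact: sh'|exact: th'|].
have hh : h * h != 0 by rewrite mulf_neq0 ?gt_eqF.
apply: (mulfI hh).
apply: etrans (esym E1) (etrans _ E2).
rewrite [h *: u + (h *: v + x)]addrCA.
move: (f _) (f _) (f _) (f _) => p q r s1.
by rewrite -!addrA; congr (_ + _); rewrite !opprD !opprK addrCA.
Qed.

Lemma rpartialC mu nu (f : pt -> R) : rCn 2 f ->
  rpartial mu (rpartial nu f) = rpartial nu (rpartial mu f).
Proof.
case=> _ hf; apply/funext => x.
have [fm [_ hm]] := hf mu; have [fn [_ hn]] := hf nu.
have [fmn [cmn _]] := hm nu; have [fnm [cnm _]] := hn mu.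
exact: (derive_swap x fn fm fnm fmn cnm cmn).
Qed.

End RealPartials.

(** * Measurability and vanishing of iterated integrals *)

Section SeparatelyContinuous.
Variable R : realType.
Notation mR := (measurableTypeR R).
Notation lam := (@lebesgue_measure R).

(* the largest multiple of 1 / (n + 1) below y *)
Let grid (n : nat) (y : R) : R := (Num.floor (n.+1%:R * y))%:~R / n.+1%:R.

Let grid_cvg (y : R) : grid ^~ y @ \oo --> y.
Proof.
apply/cvgrPdist_le => e e0.
near=> n.
have n0 : (0 : R) < n.+1%:R by [].
rewrite /grid -(@ler_pM2l _ n.+1%:R)// -{1}(gtr0_norm n0) -normrM mulrBr.
rewrite [_ * (_ / _)]mulrCA divff ?gt_eqF// mulr1.
have /andP[fl fu] := floor_itv (n.+1%:R * y).
rewrite ger0_norm ?subr_ge0// lerBlDl (le_trans (ltW fu))// intrD lerD2l.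
near: n; exists (Num.truncn e^-1) => // n /= hn.
rewrite mulrC -ler_pdivrMl// mulr1; apply: le_trans (ltW (truncnS_gt e^-1)) _.
by rewrite ler_nat.
Unshelve. all: by end_near.
Qed.

(** Caratheodory: a function continuous in its last variable is the limit of its restrictions
    to finer and finer grids in that variable, which are measurable because a
    grid is countable. *)
Lemma measurable_fun_sep d (T : measurableType d) (f : T * mR -> R) :
  (forall y : R, measurable_fun setT (fun x => f (x, y))) ->
  (forall x, continuous (fun y : R => f (x, y))) ->
  measurable_fun setT f.
Proof.
move=> mf cf.
apply: (@measurable_fun_cvg _ _ _ _ (fun n p => f (p.1, grid n p.2))); last first.
  move=> [x y] _ /=; apply: (cvg_comp _ (fun y : R => f (x, y)) (@grid_cvg y)).
  exact: cf.
move=> n _ Y mY; rewrite setTI.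
rewrite (_ : _ @^-1` _ = \bigcup_(k : int)
   ([set x | f (x, k%:~R / n.+1%:R) \in Y] `*`
    [set y : R | Num.floor (n.+1%:R * y) = k])); last first.
  apply/seteqP; split => [[x y] /= fY|[x y] /= [k _ [/= + yk]]].
    by exists (Num.floor (n.+1%:R * y)) => //=; split=> //=; rewrite inE.
  by rewrite inE /grid yk.
apply: countable_bigcupT_measurable => // k; apply: measurableX.
  have := mf (k%:~R / n.+1%:R) measurableT _ mY; rewrite setTI.
  by congr (measurable _); apply/seteqP; split=> x /=; rewrite inE.
rewrite (_ : mkset _ = `[k%:~R / n.+1%:R, (k + 1)%:~R / n.+1%:R[%classic); first exact: measurable_itv.
have n0 : (0 : R) < n.+1%:R by [].
apply/seteqP; split => y /=; rewrite in_itv /= ler_pdivrMr// ltr_pdivlMr// [y * _]mulrC.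
  by move=> <-; exact: floor_itv.
exact: floor_def.
Qed.

Lemma bounded_supp_integrable d (T : measurableType d)
  (m : {measure set T -> \bar R}) (f : T -> R) (A : set T) (K : R) :
  measurable A -> (m A < +oo)%E -> measurable_fun setT f ->
  (forall x, `|f x| <= K) -> (forall x, ~ A x -> f x = 0) ->
  m.-integrable setT (EFin \o f).
Proof.
move=> mA Afin mf fK f0.
rewrite (_ : EFin \o f = (EFin \o f) \_ A); last first.
  apply/funext => x; rewrite patchE; case: ifPn => //.
  by rewrite notin_setE => /f0 /= ->.
apply: (iffLR (integrable_mkcond _ mA)); apply: measurable_bounded_integrable => //.
  exact: measurable_funS mf.
exists K; split; first exact: num_real.
by move=> x Kx y _ /=; apply: le_trans (fK y) (ltW Kx).
Qed.

Lemma fubini_zero_r d1 d2 (T1 : measurableType d1) (T2 : measurableType d2)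
  (m1 : {sigma_finite_measure set T1 -> \bar R})
  (m2 : {sigma_finite_measure set T2 -> \bar R}) (f : T1 * T2 -> R) :
  (m1 \x m2)%E.-integrable setT (EFin \o f) ->
  (forall x, (\int[m2]_y (f (x, y))%:E = 0)%E) -> (\int[m1 \x m2]_z (f z)%:E = 0)%E.
Proof.
move=> fi f0; rewrite -(integral12_prod_meas1 fi) /fubini_F.
by apply: integral0_eq => x _; exact: f0.
Qed.

Lemma fubini_zero_l d1 d2 (T1 : measurableType d1) (T2 : measurableType d2)
  (m1 : {sigma_finite_measure set T1 -> \bar R})
  (m2 : {sigma_finite_measure set T2 -> \bar R}) (f : T1 * T2 -> R) :
  (m1 \x m2)%E.-integrable setT (EFin \o f) ->
  (forall y, (\int[m1]_x (f (x, y))%:E = 0)%E) -> (\int[m1 \x m2]_z (f z)%:E = 0)%E.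
Proof.
move=> fi f0; rewrite -(integral21_prod_meas1 fi) /fubini_G.
by apply: integral0_eq => x _; exact: f0.
Qed.

(** The fundamental theorem of calculus on an interval containing the support. *)
Lemma integral_derive_zero (g dg : R -> R) (M : R) :
  (forall t : R, is_derive t 1 g (dg t)) -> continuous dg ->
  (forall t, M < `|t| -> g t = 0) -> (\int[lam]_t (dg t)%:E = 0)%E.
Proof.
move=> gd cdg g0.
pose N := `|M| + 1; have N0 : 0 < N by rewrite ltr_wpDl.
have MN : M < N by rewrite (le_lt_trans (ler_norm M))// ltrDl.
have dg0 t : N < `|t| -> dg t = 0.
  move=> Nt; have [_ <-] := gd t.
  have -> : 'D_1 g t = 'D_1 (cst 0) t; last by rewrite derive_cst.
  apply: near_eq_derive; rewrite ?oner_eq0//.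
  have ct : (fun u : R => `|u|) @ t --> `|t| by exact: norm_continuous.
  have : \forall u \near t, N < `|u| by exact: (cvgr_gt _ ct).
  by apply: filterS => u Nu; rewrite g0// (lt_trans MN).
have -> : (\int[lam]_t (dg t)%:E = \int[lam]_(t in `[(- N)%R, N]) (dg t)%:E)%E.
  rewrite [RHS]integral_mkcond; apply: eq_integral => t _.
  rewrite patchE; case: ifPn => //; rewrite notin_setE /= in_itv /= -ler_norml.
  by move/negP; rewrite -ltNge => /dg0 ->.
have cg : continuous g.
  by move=> t; apply: differentiable_continuous; apply/derivable1_diffP; have [] := gd t.
rewrite (@continuous_FTC2 _ dg g).
- by rewrite !g0 ?subee// ?normrN ?(gtr0_norm N0).
- by rewrite gtrN.
- exact: continuous_subspaceT.
- split=> [t _||]; first by have [] := gd t.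
    exact/cvg_at_right_filter/cg.
  exact/cvg_at_left_filter/cg.
- by move=> t _; rewrite derive1E; have [] := gd t.
Qed.

End SeparatelyContinuous.

Section ProductSigmaFinite.
Variables (R : realType) (d1 d2 : measure_display).
Variables (T1 : measurableType d1) (T2 : measurableType d2).
Variables (m1 : {sigma_finite_measure set T1 -> \bar R})
  (m2 : {sigma_finite_measure set T2 -> \bar R}).

Fact product_sigma_finite : sigma_finite setT (m1 \x m2)%E.
Proof.
have /sigma_finiteP[F [TF ndF Foo]] := sigma_finiteT m1.
have /sigma_finiteP[G [TG ndG Goo]] := sigma_finiteT m2.
exists (fun n => F n `*` G n).
  rewrite -setXTT TF TG predeqE => -[x y]; split.
    move=> [/= [n _ Fnx] [k _ Gky]]; exists (maxn n k) => //; split.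
      by move: x Fnx; exact/subsetPset/ndF/leq_maxl.
    by move: y Gky; exact/subsetPset/ndG/leq_maxr.
  by move=> [n _ []/= ? ?]; split; exists n.
move=> k; have [? ?] := Foo k; have [? ?] := Goo k.
split; first exact: measurableX.
by rewrite product_measure1E// lte_mul_pinfty// ge0_fin_numE.
Qed.

(** The product measure as a bundled sigma-finite measure, so that products of
    three and four factors can be fed to Fubini again. *)
Definition sigma_finite_product : {sigma_finite_measure set (T1 * T2)%type -> \bar R} :=
  HB.pack_for {sigma_finite_measure set (T1 * T2)%type -> \bar R} (m1 \x m2)%E
    (Measure_isSigmaFinite.Build _ _ _ (m1 \x m2)%E product_sigma_finite).
End ProductSigmaFinite.

(** Fubini integrates out the first or the last factor of a binary product.
    Iterating this isolates any one of four coordinates; the lower dimensional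
    slices have to be integrable for this. *)
Section IteratedZero.
Variable R : realType.
Variables (d1 d2 d3 d4 : measure_display).
Variables (T1 : measurableType d1) (T2 : measurableType d2)
  (T3 : measurableType d3) (T4 : measurableType d4).
Variables (m1 : {sigma_finite_measure set T1 -> \bar R})
  (m2 : {sigma_finite_measure set T2 -> \bar R})
  (m3 : {sigma_finite_measure set T3 -> \bar R})
  (m4 : {sigma_finite_measure set T4 -> \bar R}).
Let m12 := sigma_finite_product m1 m2.
Let m123 := sigma_finite_product m12 m3.
Variable f : T1 -> T2 -> T3 -> T4 -> R.
Hypothesis i4 : (m1 \x m2 \x m3 \x m4)%E.-integrable setT
  (EFin \o (fun p => f p.1.1.1 p.1.1.2 p.1.2 p.2)).
Hypothesis i3 : forall x3, (m1 \x m2 \x m3)%E.-integrable setT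
  (EFin \o (fun p => f p.1.1 p.1.2 p.2 x3)).
Hypothesis i2 : forall x2 x3, (m1 \x m2)%E.-integrable setT
  (EFin \o (fun p => f p.1 p.2 x2 x3)).

Let total := (\int[m1 \x m2 \x m3 \x m4]_p (f p.1.1.1 p.1.1.2 p.1.2 p.2)%:E)%E.

Let outer4 : (forall x3, \int[m1 \x m2 \x m3]_q (f q.1.1 q.1.2 q.2 x3)%:E = 0)%E ->
  total = 0%E.
Proof. exact: (@fubini_zero_l _ _ _ _ _ m123 m4 _ i4). Qed.
Let outer34 : (forall x2 x3, \int[m1 \x m2]_q (f q.1 q.2 x2 x3)%:E = 0)%E -> total = 0%E.
Proof.
by move=> h; apply: outer4 => x3; apply: (@fubini_zero_l _ _ _ _ _ m12 m3 _ (i3 x3)) => x2; exact: h.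
Qed.

Lemma iterated_zero1 :
  (forall x1 x2 x3, \int[m1]_x (f x x1 x2 x3)%:E = 0)%E -> total = 0%E.
Proof. by move=> h; apply: outer34 => x2 x3; apply: (fubini_zero_l (i2 x2 x3)) => x1; exact: h. Qed.

Lemma iterated_zero2 :
  (forall x0 x2 x3, \int[m2]_x (f x0 x x2 x3)%:E = 0)%E -> total = 0%E.
Proof. by move=> h; apply: outer34 => x2 x3; apply: (fubini_zero_r (i2 x2 x3)) => x0; exact: h. Qed.

Lemma iterated_zero3 :
  (forall x0 x1 x3, \int[m3]_x (f x0 x1 x x3)%:E = 0)%E -> total = 0%E.
Proof.
move=> h; apply: outer4 => x3.
by apply: (@fubini_zero_r _ _ _ _ _ m12 m3 _ (i3 x3)) => -[x0 x1]; exact: h.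
Qed.

Lemma iterated_zero4 :
  (forall x0 x1 x2, \int[m4]_x (f x0 x1 x2 x)%:E = 0)%E -> total = 0%E.
Proof.
by move=> h; apply: (@fubini_zero_r _ _ _ _ _ m123 m4 _ i4) => -[[x0 x1] x2]; exact: h.
Qed.

End IteratedZero.

(** * Integration of functions with bounded support *)

Section BoxSupport.
Variable R : realType.
Notation pt := 'rV[R]_4.
Notation mR := (measurableTypeR R).
Notation lam := (@lebesgue_measure R).
Notation lam4 := (lam \x lam \x lam \x lam)%E.
Local Notation e mu := (delta_mx 0 mu : 'rV[R]_4).

(** Support in the box [-M, M]^4; over all M this is the same as compact support,
    but behaves better under the operations below. *)
Definition boxed (V : zmodType) (M : R) (f : pt -> V) : Prop :=
  forall (x : pt) (i : 'I_4), M < `|x 0 i| -> f x = 0.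

Let box_compact (M : R) : compact [set x : pt | forall i, `[- M, M]%classic (x 0 i)].
Proof. by apply: (@rV_compact _ _ (fun=> `[- M, M]%classic)) => i; exact: segment_compact. Qed.

Lemma boxed_compact (V : zmodType) (M : R) (f : pt -> V) :
  boxed M f -> compact (closure [set x | f x != 0]).
Proof.
move=> fM; apply: (subclosed_compact _ (@box_compact M)); first exact: closed_closure.
have cl : closed [set x : pt | forall i, `[- M, M]%classic (x 0 i)].
  by apply: compact_closed (@box_compact M); exact: norm_hausdorff.
rewrite [X in _ `<=` X](closure_id _).1//; apply: closureS => x /= fx i.
rewrite in_itv /= -ler_norml leNgt; apply/negP => /fM fx0.
by rewrite fx0 eqxx in fx.
Qed.

Lemma compact_boxed (V : zmodType) (f : pt -> V) :
  compact (closure [set x | f x != 0]) -> exists M, boxed M f.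
Proof.
move=> cf.
have bd i : exists M : R, forall x, f x != 0 -> `|x 0 i| <= M.
  have : compact ((fun x : pt => x 0 i) @` closure [set x | f x != 0]).
    apply: continuous_compact => //; apply: continuous_subspaceT.
    by move=> x; exact: coord_continuous.
  move=> /compact_bounded[N [_ hN]]; exists (N + 1) => x fx.
  apply: (hN (N + 1)); first by rewrite ltrDl.
  by exists x => //; apply: subset_closure.
have [M hM] := choice bd.
exists (\sum_i `|M i|) => x i Mx; apply/eqP/negPn/negP => /(hM i) xM.
move: Mx; rewrite ltNge => /negP; apply; apply: le_trans xM _.
apply: le_trans (ler_norm _) _; rewrite (bigD1 i)//= lerDl.
by apply: sumr_ge0.
Qed.

(** The values of [f] off the box are 0, and those on the box form a compact set. *)
Lemma boxed_bounded (M : R) (f : pt -> R) : continuous f -> boxed M f ->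
  exists K, forall x, `|f x| <= K.
Proof.
move=> cf fM; have : compact (f @` [set x : pt | forall i, `[- M, M]%classic (x 0 i)]).
  by apply: continuous_compact (@box_compact M); exact: continuous_subspaceT.
move=> /compact_bounded[N [_ hN]]; exists (`|N| + 1) => x.
have [xM|/existsNP[i /negP]] := pselect (forall i, `[- M, M]%classic (x 0 i)).
  apply: (hN (`|N| + 1)); first by rewrite (le_lt_trans (ler_norm N))// ltrDl.
  by exists x.
rewrite in_itv /= -ler_norml -ltNge => /fM ->.
by rewrite normr0 addr_ge0.
Qed.

Lemma coordsE (p : R * R * R * R) : coords p =
  p.1.1.1 *: e 0 + (p.1.1.2 *: e 1 + (p.1.2 *: e 2%:R + p.2 *: e 3%:R)).
Proof.
case: p => [[[x0 x1] x2] x3] /=; apply/rowP => i; rewrite !mxE.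
by case: i => [[|[|[|[|//]]]] ?];
   rewrite /= ?(mulr0, mulr1, addr0, add0r).
Qed.

Let sep (f : pt -> R) (v x : pt) : continuous f ->
  continuous (fun t : R => f (t *: v + x)).
Proof.
by move=> cf t; apply: (continuous_comp (@line_continuous _ v x t)); exact: cf.
Qed.

(* f as a function of four real variables, which can be sliced one at a time *)
Let G (f : pt -> R) (x0 x1 x2 x3 : R) : R :=
  f (x0 *: e 0 + (x1 *: e 1 + (x2 *: e 2%:R + x3 *: e 3%:R))).

Let coordsG (f : pt -> R) p : f (coords p) = G f p.1.1.1 p.1.1.2 p.1.2 p.2.
Proof. by rewrite coordsE. Qed.

Section Slices.
Variables (f : pt -> R) (M : R).
Hypotheses (cf : continuous f) (fM : boxed M f).
Local Notation I := `[- M, M]%classic.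

Let c0 x1 x2 x3 : continuous (fun t : R => G f t x1 x2 x3).
Proof. exact: sep. Qed.
Let c1 x0 x2 x3 : continuous (fun t : R => G f x0 t x2 x3).
Proof.
rewrite /G; under eq_fun do rewrite addrCA; exact: sep.
Qed.
Let c2 x0 x1 x3 : continuous (fun t : R => G f x0 x1 t x3).
Proof.
rewrite /G; under eq_fun do rewrite addrA addrCA; exact: sep.
Qed.
Let c3 x0 x1 x2 : continuous (fun t : R => G f x0 x1 x2 t).
Proof.
rewrite /G; under eq_fun do rewrite !addrA addrC; exact: sep.
Qed.

(* Joint measurability is reached by adding one coordinate at a time. *)
Let m1 x1 x2 x3 : measurable_fun setT (fun t : mR => G f t x1 x2 x3).
Proof. by apply: continuous_measurable_fun; exact: c0. Qed.
Let m2 x2 x3 : measurable_fun setT (fun p : mR * mR => G f p.1 p.2 x2 x3).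
Proof. by apply: measurable_fun_sep => [y|x] /=; [exact: m1|exact: c1]. Qed.
Let m3 x3 : measurable_fun setT (fun p : mR * mR * mR => G f p.1.1 p.1.2 p.2 x3).
Proof. by apply: measurable_fun_sep => [y|x] /=; [exact: m2|exact: c2]. Qed.
Let m4 : measurable_fun setT
  (fun p : mR * mR * mR * mR => G f p.1.1.1 p.1.1.2 p.1.2 p.2).
Proof. by apply: measurable_fun_sep => [y|x] /=; [exact: m3|exact: c3]. Qed.

Let G0 x0 x1 x2 x3 : ~ (I `*` I `*` I `*` I) (x0, x1, x2, x3) -> G f x0 x1 x2 x3 = 0.
Proof.
move=> nI; have key i : M < `|nth 0 [:: x0; x1; x2; x3] i| -> (i < 4)%N -> G f x0 x1 x2 x3 = 0.
  move=> Mi i4; rewrite -[LHS](coordsG f (x0, x1, x2, x3)).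
  by apply: (@fM _ (Ordinal i4)); rewrite mxE.
have [/(key 0%N)->//|h0] := ltP M `|x0|.
have [/(key 1%N)->//|h1] := ltP M `|x1|.
have [/(key 2%N)->//|h2] := ltP M `|x2|.
have [/(key 3%N)->//|h3] := ltP M `|x3|.
by case: nI; rewrite /= !in_itv /= -!ler_norml.
Qed.

Let lamI : (lam I < +oo)%E.
Proof. by rewrite lebesgue_measure_itv /=; case: ifP => _; rewrite ltry. Qed.
Let mI : measurable (I : set mR). Proof. exact: measurable_itv. Qed.
Let mI2 : measurable (I `*` I : set (mR * mR)). Proof. exact: measurableX. Qed.
Let mI3 : measurable (I `*` I `*` I : set (mR * mR * mR)). Proof. exact: measurableX. Qed.
Let mI4 : measurable (I `*` I `*` I `*` I : set (mR * mR * mR * mR)).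
Proof. exact: measurableX. Qed.
Let lamI2 : ((lam \x lam) (I `*` I) < +oo)%E.
Proof. by rewrite product_measure1E// lte_mul_pinfty// ge0_fin_numE. Qed.
Let lamI3 : ((lam \x lam \x lam) (I `*` I `*` I) < +oo)%E.
Proof. by rewrite product_measure1E// lte_mul_pinfty// ge0_fin_numE. Qed.
Let lamI4 : (lam4 (I `*` I `*` I `*` I) < +oo)%E.
Proof. by rewrite product_measure1E// lte_mul_pinfty// ge0_fin_numE. Qed.

Let i2 x2 x3 : (lam \x lam)%E.-integrable setT (EFin \o (fun p : mR * mR => G f p.1 p.2 x2 x3)).
Proof.
have [K fK] := boxed_bounded cf fM.
apply: (bounded_supp_integrable mI2 lamI2 (m2 _ _) (K := K)) => [x|[x y] nI]; first exact: fK.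
by apply: G0 => -[[/=]].
Qed.

Let i3 x3 : (lam \x lam \x lam)%E.-integrable setT
  (EFin \o (fun p : mR * mR * mR => G f p.1.1 p.1.2 p.2 x3)).
Proof.
have [K fK] := boxed_bounded cf fM.
apply: (bounded_supp_integrable mI3 lamI3 (m3 _) (K := K)) => [x|[[x y] z] nI]; first exact: fK.
by apply: G0 => -[/=].
Qed.

Let i4 : lam4.-integrable setT
  (EFin \o (fun p : mR * mR * mR * mR => G f p.1.1.1 p.1.1.2 p.1.2 p.2)).
Proof.
have [K fK] := boxed_bounded cf fM.
apply: (bounded_supp_integrable mI4 lamI4 m4 (K := K)) => [x|[[[x y] z] t] nI]; first exact: fK.
exact: G0.
Qed.

Lemma boxed_integrable : lam4.-integrable setT (EFin \o (f \o @coords R)).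
Proof.
rewrite (_ : f \o @coords R = fun p => G f p.1.1.1 p.1.1.2 p.1.2 p.2)//.
by apply/funext => p; exact: coordsG.
Qed.

(** Fubini lets the integral along any one coordinate axis be taken first. *)
Lemma axis_integral_zero (mu : 'I_4) :
  (forall x : pt, (\int[lam]_t (f (t *: e mu + x))%:E = 0)%E) ->
  (\int[lam4]_p (f (coords p))%:E = 0)%E.
Proof.
move=> f0.
have -> : (\int[lam4]_p (f (coords p))%:E =
           \int[lam4]_p (G f p.1.1.1 p.1.1.2 p.1.2 p.2)%:E)%E.
  by apply: eq_integral => p _; rewrite coordsG.
have : [\/ mu = 0, mu = 1, mu = 2%:R | mu = 3%:R].
  by case: mu {f0} => [[|[|[|[|//]]]] ?]; [constructor 1|constructor 2|constructor 3|constructor 4];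
     apply/val_inj.
case=> E; rewrite E in f0.
- by apply: (iterated_zero1 i4 i3 i2) => x1 x2 x3; exact: f0.
- apply: (iterated_zero2 i4 i3 i2) => x0 x2 x3.
  rewrite -[RHS](f0 (x0 *: e 0 + (x2 *: e 2%:R + x3 *: e 3%:R))).
  by apply: eq_integral => t _; rewrite /G addrCA.
- apply: (iterated_zero3 i4 i3) => x0 x1 x3.
  rewrite -[RHS](f0 (x0 *: e 0 + (x1 *: e 1 + x3 *: e 3%:R))).
  apply: eq_integral => t _; rewrite /G; congr (f _)%:E.
  by rewrite [RHS]addrCA; congr (_ + _); rewrite addrCA.
- apply: (iterated_zero4 i4) => x0 x1 x2.
  rewrite -[RHS](f0 (x0 *: e 0 + (x1 *: e 1 + x2 *: e 2%:R))).
  apply: eq_integral => t _; rewrite /G; congr (f _)%:E.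
  by rewrite [RHS]addrC -!addrA.
Qed.

End Slices.

(** Off the box, [f] vanishes in a neighbourhood of each point. *)
Lemma boxed_rpartial mu (f : pt -> R) M : boxed M f -> boxed M (rpartial mu f).
Proof.
move=> fM x i xi; rewrite /rpartial.
have -> : 'D_(e mu) f x = 'D_(e mu) (cst 0) x; last by rewrite derive_cst.
apply: near_eq_derive.
have ct : (fun y : pt => `|y 0 i|) @ x --> `|x 0 i|.
  have cc : continuous (fun y : pt => y 0 i) by move=> y; exact: coord_continuous.
  exact: (cvg_norm (cc x)).
have : \forall y \near x, M < `|(y : pt) 0 i| by exact: (cvgr_gt _ ct).
by apply: filterS => y yi; rewrite (fM y i).
Qed.

(** Integrating along the axis [mu] first, this is the integral of the derivative
    of a function of one variable that vanishes far out. *)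
Lemma integral_rpartial mu (f : pt -> R) M : rCn 1 f -> boxed M f ->
  (\int[lam4]_p (rpartial mu f (coords p))%:E = 0)%E.
Proof.
move=> [cf /(_ mu)[df [cdf _]]] fM.
apply: (axis_integral_zero cdf (boxed_rpartial mu fM) (mu := mu)) => x.
apply: (integral_derive_zero (g := fun t => f (t *: e mu + x)) (M := `|M| + `|x 0 mu|)).
- by move=> t; exact: line_is_derive.
- exact: sep.
- move=> t Mt; apply: (fM _ mu); rewrite !mxE !eqxx mulr1.
  rewrite (le_lt_trans (ler_norm M))// -(ltrD2r `|x 0 mu|) (lt_le_trans Mt)//.
  rewrite -[X in _ <= _ + X]normrN; apply: le_trans (ler_normD _ _).
  by rewrite addrK.
Qed.

(** By continuity [f] exceeds [f x / 2] on a box around [x], whose volume is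
    positive. *)
Lemma integral_gt0 (f : pt -> R) M x : continuous f -> boxed M f ->
  (forall y, 0 <= f y) -> 0 < f x -> (0 < \int[lam4]_p (f (coords p))%:E)%E.
Proof.
move=> cf fM f0 fx.
have fx2 : 0 < f x / 2 by rewrite divr_gt0.
have : \forall y \near x, f x / 2 < f y.
  by apply: (cvgr_gt _ (cf x)); rewrite ltr_pdivrMr// mulr_natr mulr2n ltrDl.
case/nbhs_ballP => r r0 xr.
pose J i : set mR := `]x 0 i - r, x 0 i + r[%classic.
pose Q2 : set (mR * mR) := J 0 `*` J 1.
pose Q3 : set (mR * mR * mR) := Q2 `*` J 2%:R.
pose Q : set (mR * mR * mR * mR) := Q3 `*` J 3%:R.
have mJ i : measurable (J i) by exact: measurable_itv.
have lJ i : (0 < lam (J i))%E.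
  rewrite /J lebesgue_measure_itv /= lte_fin ifT; last by rewrite ltrD2l gtrN.
  by rewrite -EFinB lte_fin subr_gt0 ltrD2l gtrN.
have mQ2 : measurable Q2 by exact: measurableX.
have mQ3 : measurable Q3 by exact: measurableX.
have mQ : measurable Q by exact: measurableX.
have l2 : (0 < (lam \x lam) Q2)%E by rewrite /Q2 product_measure1E//; apply: mule_gt0; exact: lJ.
have l3 : (0 < (lam \x lam \x lam) Q3)%E.
  by rewrite /Q3 product_measure1E//; apply: mule_gt0; [exact: l2|exact: lJ].
have lQ : (0 < lam4 Q)%E by rewrite /Q product_measure1E//; apply: mule_gt0; [exact: l3|exact: lJ].
have fQ p : Q p -> f x / 2 < f (coords p).
  case: p => [[[x0 x1] x2] x3] [[[/= h0 h1] h2] h3]; apply: xr; split=> // i j.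
  rewrite !ord1 mxE /ball /= distrC ltr_distl.
  have : J j [:: x0; x1; x2; x3]`_j; last by rewrite /J /= in_itv.
  by case: j => [[|[|[|[|//]]]] jP] /=; [move: h0|move: h1|move: h2|move: h3];
     congr (J _ _); apply/val_inj.
apply: (@lt_le_trans _ _ (\int[lam4]_(p in Q) (f x / 2)%:E)%E).
  by rewrite integral_cst// mule_gt0.
have mf : measurable_fun setT (fun p => (f (coords p))%:E).
  exact: measurable_int (boxed_integrable cf fM).
apply: (@le_trans _ _ (\int[lam4]_(p in Q) (f (coords p))%:E)%E).
  apply: ge0_le_integral => //.
  - by move=> p _; rewrite lee_fin ltW.
  - exact: measurable_funS mf.
  - by move=> p /fQ/ltW; rewrite lee_fin.
by apply: ge0_subset_integral => // p _; rewrite lee_fin.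
Qed.

End BoxSupport.

(** * Smooth bump functions *)

Section Bump.
Variable R : realType.
Notation pt := 'rV[R]_4.

(** The functions t^-k exp(-1/t), extended by 0 to t <= 0: up to linear
    combinations this family is stable under derivation, so that all its members
    are smooth. *)
Definition flat (k : nat) (t : R) : R :=
  if 0 < t then t^-1 ^+ k * expR (- t^-1) else 0.

Let flat_ge0 k t : 0 <= flat k t.
Proof.
rewrite /flat; case: ifPn => // t0.
by rewrite mulr_ge0 ?expR_ge0// exprn_ge0// invr_ge0 ltW.
Qed.

Lemma flat_gt0 t : 0 < t -> 0 < flat 0 t.
Proof. by move=> t0; rewrite /flat t0 expr0 mul1r expR_gt0. Qed.

(** With u = 1/t, this is u^k exp(-u) <= (k+1)! / u. *)
Let flat_le k (t : R) : 0 < t -> flat k t <= k.+1`!%:R * t.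
Proof.
move=> t0; rewrite /flat t0.
have u0 : 0 < t^-1 by rewrite invr_gt0.
set u := t^-1 in u0 *; have -> : t = u^-1 by rewrite invrK.
rewrite expRN ler_pdivrMr ?expR_gt0//.
apply: (@le_trans _ _ (k.+1`!%:R / u * (u ^+ k.+1 / k.+1`!%:R))).
  have F0 : k.+1`!%:R != 0 :> R by rewrite pnatr_eq0 -lt0n fact_gt0.
  move: F0; move: (k.+1`!%:R : R) => F F0; have un := gt_eqF u0.
  have -> : F / u * (u ^+ k.+1 / F) = u ^+ k by rewrite exprS; field; rewrite un F0.
  exact: lexx.
rewrite ler_wpM2l ?divr_ge0 ?(ltW u0)//.
by apply: le_trans (expR_ge1Dxn k (ltW u0)); rewrite lerDr.
Qed.

(** Only [t = 0] is delicate: the difference quotients of [flat k] there are the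
    values of [flat k.+1], which tend to 0 by [flat_le]. *)
Lemma flat_is_derive k (t : R) :
  is_derive t 1 (flat k) (- k%:R * flat k.+1 t + flat k.+2 t).
Proof.
have [t0|t0|->] := ltgtP t 0.
- have -> : - k%:R * flat k.+1 t + flat k.+2 t = 0.
    by rewrite /flat !ltNge (ltW t0) /= mulr0 addr0.
  apply: (near_eq_is_derive (f := cst 0)).
  near=> s; rewrite /flat ltNge (_ : s <= 0)//.
  by apply: ltW; near: s; exact: lt_nbhsl.
- pose v (s : R) := s^-1.
  apply: (near_eq_is_derive (f := (v ^+ k) * (expR \o (- v)))).
    by have := lt_nbhsr t0; apply: filterS => s s0; rewrite /flat s0 !fctE.
  have dv : is_derive t 1 v (- t ^- 2 *: 1).
    by apply: (is_deriveV (f := id)); rewrite gt_eqF.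
  have dk := is_deriveX k dv.
  have de : is_derive t 1 (expR \o (- v)) (expR (- v t) * (- (- t ^- 2 *: 1))).
    exact: (is_derive1_comp (is_derive_expR _) (is_deriveN dv)).
  apply: is_derive_eq (is_deriveM dk de) _.
  rewrite /flat t0 /v /= -!exprVn !fctE.
  set u := t^-1; set E := expR (- u).
  rewrite /GRing.scale /= !mulr1 opprK mulNr mulrN addrC; congr (_ + _).
    case: k {dk} => [|k]; first by rewrite !mul0r oppr0 mulr0.
    by rewrite mulrN -mulrA -exprD addn2 mulrCA [E * _]mulrC.
  by rewrite mulrCA -exprD addn2 mulrC.
- have -> : - k%:R * flat k.+1 0 + flat k.+2 0 = 0.
    by rewrite /flat ltxx mulr0 addr0.
  have q0 : h^-1 *: ((flat k \o shift 0) (h *: 1) - flat k 0) @[h --> 0^'] --> (0 : R).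
    apply/cvgr0Pnorm_le => e e0.
    near=> h; rewrite /= addr0 [h *: 1]mulr1 [in X in _ - X]/flat ltxx subr0.
    have [h0|h0|->] := ltgtP h 0; last by rewrite invr0 scale0r normr0 ltW.
      by rewrite /flat ltNge (ltW h0) /= scaler0 normr0 ltW.
    have -> : h^-1 *: flat k h = flat k.+1 h.
      by rewrite /flat h0 exprS -mulrA.
    rewrite ger0_norm//; apply: le_trans (flat_le _ h0) _.
    rewrite -ler_pdivlMl ?ltr0n ?fact_gt0//.
    apply: ltW; near: h; apply: nbhs_dnbhs; apply: lt_nbhsl.
    by rewrite mulr_gt0// invr_gt0 ltr0n fact_gt0.
  apply: DeriveDef; first by apply/cvg_ex; exists 0.
  by apply/cvg_lim.
Unshelve. all: by end_near.
Qed.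

Lemma rCn_ext n (f g : pt -> R) : f =1 g -> rCn n f -> rCn n g.
Proof. by move=> /funext ->. Qed.

Let flat_coord k (i mu : 'I_4) (s c : R) (x : pt) :
  is_derive x (delta_mx 0 mu) (fun y : pt => flat k (s * y 0 i + c))
    ((mu == i)%:R * s * (- k%:R * flat k.+1 (s * x 0 i + c) + flat k.+2 (s * x 0 i + c))).
Proof.
set d := - _ * _ + _.
pose q (h : R) := s * (h * (mu == i)%:R + x 0 i) + c.
have q0 : q 0 = s * x 0 i + c by rewrite /q mul0r add0r.
have dq : is_derive (0 : R) 1 q (s * (mu == i)%:R).
  apply: is_derive_eq.
  by rewrite scaler0 add0r !addr0 [_%:A]mulr1.
have df : is_derive (0 : R) 1 (flat k \o q) (d * (s * (mu == i)%:R)).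
  by apply: is_derive1_comp; rewrite q0; exact: flat_is_derive.
have E : (fun h : R => h^-1 *: (((fun y : pt => flat k (s * y 0 i + c)) \o shift x)
            (h *: delta_mx 0 mu) - flat k (s * x 0 i + c))) =
         (fun h : R => h^-1 *: (((flat k \o q) \o shift 0) (h *: 1) - (flat k \o q) 0)).
  apply/funext => h; rewrite /= q0 /q addr0 !mxE eqxx /= [i == mu]eq_sym.
  by rewrite [h *: 1]mulr1.
have [cf ef] := df.
apply: DeriveDef; first by rewrite /derivable E.
by rewrite /derive E -/(derive _ _ _) ef mulrC [s * _]mulrC.
Qed.

(** The partial derivatives are combinations of functions of the same form with
    larger [k], so that the induction is on [n] for all [k] simultaneously. *)
Lemma flat_coord_smooth n k (i : 'I_4) (s c : R) :
  rCn n (fun x : pt => flat k (s * x 0 i + c)).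
Proof.
have cF k' : continuous (fun x : pt => flat k' (s * x 0 i + c)).
  move=> x; apply: (@continuous_comp _ _ _ (fun x : pt => s * x 0 i + c) (flat k')).
    have cc : {for x, continuous (fun y : pt => y 0 i)} by exact: coord_continuous.
    apply: (@continuousD _ _ _ (fun y : pt => s * y 0 i) (cst c)); last exact: cst_continuous.
    by apply: (@continuousM _ _ (cst s) (fun y : pt => y 0 i)); [exact: cst_continuous|exact: cc].
  apply: differentiable_continuous; apply/derivable1_diffP.
  by have [] := flat_is_derive k' (s * x 0 i + c).
elim: n k => [|n IHn] k; split=> // mu; split.
  by move=> x; have [] := flat_coord k i mu s c x.
apply: (@rCn_ext _ (cst ((mu == i)%:R * s) \* ((cst (- k%:R) \*
     (fun x : pt => flat k.+1 (s * x 0 i + c))) \+ (fun x : pt => flat k.+2 (s * x 0 i + c))))).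
  by move=> x /=; have [_ <-] := flat_coord k i mu s c x.
apply: rCnM; first exact: rCn_cst.
by apply: rCnD => //; apply: rCnM => //; exact: rCn_cst.
Qed.

(** Each factor is positive exactly for [c 0 i - 1 < x 0 i < c 0 i + 1]; the
    explicit coefficients 1 and -1 match [flat_coord_smooth]. *)
Definition cube_bump (c : pt) (x : pt) : R :=
  \prod_(i < 4) (flat 0 (1 * x 0 i + (1 - c 0 i)) * flat 0 (- 1 * x 0 i + (1 + c 0 i))).

Lemma bump_smooth c : rsmooth (cube_bump c).
Proof.
move=> n; rewrite /cube_bump; elim: (index_enum _) => [|i s IHs].
  by apply: (@rCn_ext _ (cst 1)); [move=> x; rewrite big_nil|exact: rCn_cst].
apply: (@rCn_ext _ ((fun x : pt => flat 0 (1 * x 0 i + (1 - c 0 i))) \*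
   (fun x : pt => flat 0 (- 1 * x 0 i + (1 + c 0 i))) \* (fun x : pt =>
   \prod_(j <- s) (flat 0 (1 * x 0 j + (1 - c 0 j)) * flat 0 (- 1 * x 0 j + (1 + c 0 j)))))).
  by move=> x; rewrite big_cons.
by apply: rCnM => //; apply: rCnM; exact: flat_coord_smooth.
Qed.

Lemma bump_ge0 c x : 0 <= cube_bump c x.
Proof. by apply: prodr_ge0 => i _; rewrite mulr_ge0// flat_ge0. Qed.

Lemma bump_gt0 c : 0 < cube_bump c c.
Proof.
apply: prodr_gt0 => i _; rewrite mulN1r mul1r addrCA subrr addr0 addrCA addNr addr0.
by rewrite mulr_gt0// flat_gt0.
Qed.

Lemma bump_boxed c : exists M, boxed M (cube_bump c).
Proof.
exists (1 + \sum_i `|c 0 i|) => x i xi; rewrite /cube_bump (bigD1 i)//=.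
have ci : 1 + `|c 0 i| < `|x 0 i|.
  apply: le_lt_trans xi; rewrite lerD2l (bigD1 i)//= lerDl.
  exact: sumr_ge0.
have [h|h] := lerP 0 (x 0 i).
  rewrite (ger0_norm h) in ci.
  rewrite [X in _ * X * _](_ : _ = 0) ?mulr0 ?mul0r// /flat ltNge.
  rewrite mulN1r addrC subr_le0 (le_trans _ (ltW ci))// lerD2l ler_norm//.
rewrite (ltr0_norm h) in ci.
rewrite [X in X * _ * _](_ : _ = 0) ?mul0r// /flat ltNge mul1r.
have hc : - c 0 i <= `|c 0 i| by rewrite -normrN ler_norm.
have -> // : x 0 i + (1 - c 0 i) <= 0.
move: ci hc; move: (x 0 i) (c 0 i) `|c 0 i| => u v w; lra.
Qed.

End Bump.

(** * Linear maps *)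

Section LinearMaps.
Variables (K : nzRingType) (V W : lmodType K) (f : V -> W).
Hypothesis fl : linear f.

Lemma lin_zero : f 0 = 0.
Proof. by have := fl (-1) 0 0; rewrite scaler0 addr0 scaleN1r addNr. Qed.

Lemma lin_add : {morph f : x y / x + y}.
Proof. by move=> x y; have := fl 1 x y; rewrite !scale1r. Qed.

Lemma lin_scale a x : f (a *: x) = a *: f x.
Proof. by have := fl a x 0; rewrite !addr0 lin_zero addr0. Qed.

Lemma lin_opp : {morph f : x / - x}.
Proof. by move=> x; rewrite -!scaleN1r lin_scale. Qed.

Lemma lin_sub : {morph f : x y / x - y}.
Proof. by move=> x y; rewrite lin_add lin_opp. Qed.

Lemma lin_sum I (r : seq I) P (F : I -> V) :
  f (\sum_(i <- r | P i) F i) = \sum_(i <- r | P i) f (F i).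
Proof. exact: (big_morph f lin_add lin_zero). Qed.

End LinearMaps.

(** * The algebra of smooth functions *)

Section SmoothFunctions.
Variable R : realType.
Notation C := (R[i]).
Notation pt := 'rV[R]_4.
Notation S := (smooth R).
Notation sintegral := (@Defs.sintegral R).
Notation lam := (@lebesgue_measure R).
Notation lam4 := (lam \x lam \x lam \x lam)%E.

Lemma smooth_ext (f g : S) : (forall x, f x = g x) -> f = g.
Proof. by move=> fg; apply/val_inj/funext. Qed.

Lemma smooth_rsmooth (f : S) : rsmooth (reP f) /\ rsmooth (imP f).
Proof. by case: f => f /= /asboolP. Qed.

Lemma smulC (f g : S) : smul f g = smul g f.
Proof. by apply: smooth_ext => x /=; rewrite mulrC. Qed.

Lemma smulA (f g h : S) : smul f (smul g h) = smul (smul f g) h.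
Proof. by apply: smooth_ext => x /=; rewrite mulrA. Qed.

Lemma smul1 (f : S) : smul (sone R) f = f.
Proof. by apply: smooth_ext => x /=; rewrite mul1r. Qed.

Lemma smul_linl (f : S) : linear (fun g => smul g f).
Proof. by move=> a g h; rewrite ![smul _ f]smulC smul_linr. Qed.

Lemma smul0 (f : S) : smul f 0 = 0.
Proof. exact: lin_zero (smul_linr f). Qed.

Lemma smul0l (f : S) : smul 0 f = 0.
Proof. by rewrite smulC smul0. Qed.

Lemma smul_sumr I (r : seq I) P (f : S) (F : I -> S) :
  smul f (\sum_(i <- r | P i) F i) = \sum_(i <- r | P i) smul f (F i).
Proof. exact: (lin_sum (smul_linr f)). Qed.

Lemma smul_suml I (r : seq I) P (f : S) (F : I -> S) :
  smul (\sum_(i <- r | P i) F i) f = \sum_(i <- r | P i) smul (F i) f.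
Proof. exact: (lin_sum (smul_linl f)). Qed.

Lemma sconjP a (f g : S) : sconj (a *: f + g) = a^* *: sconj f + sconj g.
Proof. by apply: smooth_ext => x /=; rewrite !fctE rmorphD rmorphM. Qed.

Lemma sconjK : involutive (@sconj R).
Proof. by move=> f; apply: smooth_ext => x /=; rewrite conjCK. Qed.

Lemma smooth_reim_ext (f g : S) : reP f = reP g -> imP f = imP g -> f = g.
Proof.
move=> rfg ifg; apply: smooth_ext => x.
have := congr1 (@^~ x) ifg; have := congr1 (@^~ x) rfg.
by rewrite /reP /imP; case: (f x) (g x) => [? ?] [? ?] /= -> ->.
Qed.

Lemma spartialC mu nu (f : S) : spartial mu (spartial nu f) = spartial nu (spartial mu f).
Proof.
have [rf If] := smooth_rsmooth f.
have rE m n : reP (spartial m (spartial n f)) = rpartial m (rpartial n (reP f)) by [].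
have iE m n : imP (spartial m (spartial n f)) = rpartial m (rpartial n (imP f)) by [].
have er := rpartialC mu nu (rf 2%N); have ei := rpartialC mu nu (If 2%N).
move: (rE mu nu) (rE nu mu) (iE mu nu) (iE nu mu); rewrite er ei => r1 r2 i1 i2.
apply: smooth_reim_ext.
  transitivity (rpartial nu (rpartial mu (reP f))); first exact r1.
  symmetry; exact r2.
transitivity (rpartial nu (rpartial mu (imP f))); first exact i1.
symmetry; exact i2.
Qed.

Lemma spartial1 mu : spartial mu (sone R) = 0.
Proof.
apply: smooth_ext => x /=.
rewrite (_ : reP _ = cst 1)// (_ : imP _ = cst 0)//.
by rewrite /rpartial !derive_cst.
Qed.

Lemma spartialM mu (f g : S) :
  spartial mu (smul f g) = smul (spartial mu f) g + smul f (spartial mu g).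
Proof.
have [rf If] := smooth_rsmooth f; have [rg Ig] := smooth_rsmooth g.
have [_ /(_ mu)[drf _]] := rf 1%N; have [_ /(_ mu)[dif _]] := If 1%N.
have [_ /(_ mu)[drg _]] := rg 1%N; have [_ /(_ mu)[dig _]] := Ig 1%N.
have dM (u v : pt -> R) : (forall x, derivable u x (delta_mx 0 mu)) ->
    (forall x, derivable v x (delta_mx 0 mu)) ->
    forall x, rpartial mu (u \* v) x = u x * rpartial mu v x + v x * rpartial mu u x.
  by move=> du dv x; exact: deriveM.
have dmul (u v : pt -> R) : (forall x, derivable u x (delta_mx 0 mu)) ->
    (forall x, derivable v x (delta_mx 0 mu)) ->
    forall x, derivable (u \* v) x (delta_mx 0 mu).
  by move=> du dv x; exact: derivableM.
apply: smooth_ext => x /=.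
have -> : reP (smul f g) = (reP f \* reP g) \+ (\- (imP f \* imP g)).
  by apply/funext => y /=; rewrite /reP /imP /=; case: (f y) (g y) => [? ?] [? ?].
have -> : imP (smul f g) = (reP f \* imP g) \+ (imP f \* reP g).
  by apply/funext => y /=; rewrite /reP /imP /=; case: (f y) (g y) => [? ?] [? ?].
rewrite rpartialD; [|by apply: dmul|by move=> y; apply: derivableN; exact: dmul].
rewrite rpartialD; [|by apply: dmul|by apply: dmul].
have -> : rpartial mu (\- (imP f \* imP g)) = \- rpartial mu (imP f \* imP g).
  by apply/funext => y; apply: deriveN; exact: dmul.
rewrite /= !dM// !fctE /=.
rewrite /reP /imP; case: (f x) => a b; case: (g x) => a' b' /=.
move: (rpartial _ _ _) (rpartial _ _ _) (rpartial _ _ _) (rpartial _ _ _) => p q r s.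
by congr (_ +i* _)%C; ring.
Qed.

Lemma smooth_reP_cont (f : S) : continuous (reP f).
Proof. exact: rCn_cont ((smooth_rsmooth f).1 0%N). Qed.

Lemma smooth_imP_cont (f : S) : continuous (imP f).
Proof. exact: rCn_cont ((smooth_rsmooth f).2 0%N). Qed.

(** Boxes are preferred to closures of supports, because bounds for sums, products
    and derivatives can be read off from the values. *)
Lemma ssuppP (f : S) : ssupp_compact f <-> exists M, boxed M f.
Proof.
by split=> [/compact_boxed //|[M fM]]; exact: boxed_compact fM.
Qed.

Lemma boxedW (V : zmodType) (M N : R) (f : pt -> V) : M <= N -> boxed M f -> boxed N f.
Proof. by move=> MN fM x i xi; apply: (fM x i); exact: le_lt_trans xi. Qed.

Lemma ssuppP_lin a (f g : S) : ssupp_compact f -> ssupp_compact g ->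
  ssupp_compact (a *: f + g).
Proof.
move=> /ssuppP[M fM] /ssuppP[N gN]; apply/ssuppP; exists (Num.max M N) => x i.
by rewrite gt_max => /andP[xM xN]; rewrite /= !fctE (fM x i)// (gN x i)// scaler0 addr0.
Qed.

Lemma ssupp0 : ssupp_compact (0 : S).
Proof. by apply/ssuppP; exists 0. Qed.

Lemma ssuppZ a (f : S) : ssupp_compact f -> ssupp_compact (a *: f).
Proof. by move=> cf; rewrite -[_ *: _]addr0; apply: ssuppP_lin => //; exact: ssupp0. Qed.

Lemma ssuppD (f g : S) : ssupp_compact f -> ssupp_compact g -> ssupp_compact (f + g).
Proof. by move=> cf cg; rewrite -[f]scale1r; exact: ssuppP_lin. Qed.

Lemma ssupp_mull (f g : S) : ssupp_compact f -> ssupp_compact (smul f g).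
Proof.
by move=> /ssuppP[M fM]; apply/ssuppP; exists M => x i xi; rewrite /= (fM x i)// mul0r.
Qed.

Lemma ssupp_mulr (f g : S) : ssupp_compact g -> ssupp_compact (smul f g).
Proof. by rewrite smulC; exact: ssupp_mull. Qed.

Lemma ssupp_conj (f : S) : ssupp_compact f -> ssupp_compact (sconj f).
Proof.
by move=> /ssuppP[M fM]; apply/ssuppP; exists M => x i xi; rewrite /= (fM x i)// rmorph0.
Qed.

Lemma boxed_re_im (M : R) (f : S) : boxed M f -> boxed M (reP f) /\ boxed M (imP f).
Proof. by move=> fM; split=> x i xi; rewrite /reP /imP (fM x i). Qed.

Lemma ssupp_partial mu (f : S) : ssupp_compact f -> ssupp_compact (spartial mu f).
Proof.
move=> /ssuppP[M fM]; apply/ssuppP; exists M => x i xi /=.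
have [rM iM] := boxed_re_im fM.
by rewrite (boxed_rpartial mu rM xi) (boxed_rpartial mu iM xi).
Qed.

Let rint (f : pt -> R) : R := Rintegral lam4 setT (f \o @coords R).

Let rintP (a b : R) (f g h : pt -> R) M : continuous f -> continuous g -> continuous h ->
  boxed M f -> boxed M g -> boxed M h ->
  rint (fun x => a * f x + b * g x + h x) = a * rint f + b * rint g + rint h.
Proof.
move=> cf cg ch fM gM hM.
have intf := boxed_integrable cf fM; have intg := boxed_integrable cg gM.
have inth := boxed_integrable ch hM.
have intaf : lam4.-integrable setT (EFin \o (fun p => a * f (coords p))).
  exact: (integrableZl measurableT a intf).
have intbg : lam4.-integrable setT (EFin \o (fun p => b * g (coords p))).
  exact: (integrableZl measurableT b intg).
rewrite /rint (RintegralD measurableT (integrableD measurableT intaf intbg) inth).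
by rewrite (RintegralD measurableT intaf intbg) !RintegralZl.
Qed.

Let sintegralE (f : S) : sintegral f = (rint (reP f) +i* rint (imP f))%C.
Proof. by []. Qed.

Lemma sintegralP a (f g : S) : ssupp_compact f -> ssupp_compact g ->
  sintegral (a *: f + g) = a * sintegral f + sintegral g.
Proof.
move=> /ssuppP[M' fM'] /ssuppP[N gN].
pose M := Num.max M' N.
have M'M : M' <= M by rewrite le_max lexx.
have NM : N <= M by rewrite le_max lexx orbT.
have [rfM ifM] := boxed_re_im (boxedW M'M fM').
have [rgM igM] := boxed_re_im (boxedW NM gN).
have rc := smooth_reP_cont; have ic := smooth_imP_cont.
case: a => u v.
have rE : reP ((u +i* v)%C *: f + g) = fun x => u * reP f x + (- v) * imP f x + reP g x.
  by apply/funext => x; rewrite /reP /imP /= !fctE; case: (f x) (g x) => [? ?] [? ?] /=; rewrite mulNr.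
have iE : imP ((u +i* v)%C *: f + g) = fun x => u * imP f x + v * reP f x + imP g x.
  by apply/funext => x; rewrite /reP /imP /= !fctE; case: (f x) (g x) => [? ?] [? ?] /=.
rewrite !sintegralE rE iE !(@rintP _ _ _ _ _ M)//.
by congr (_ +i* _)%C; rewrite /= mulNr.
Qed.

Lemma sintegral0 : sintegral (0 : S) = 0.
Proof.
have := sintegralP (-1) ssupp0 ssupp0.
by rewrite scaler0 addr0 mulN1r addNr.
Qed.

Lemma sintegral_partial mu (f : S) : ssupp_compact f -> sintegral (spartial mu f) = 0.
Proof.
move=> /ssuppP[M fM]; have [rfM ifM] := boxed_re_im fM.
have [rf If] := smooth_rsmooth f.
rewrite sintegralE /rint /Rintegral.
by congr (_ +i* _)%C; [rewrite (integral_rpartial mu (rf 1%N) rfM)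
  |rewrite (integral_rpartial mu (If 1%N) ifM)].
Qed.

Lemma bump_csmooth (c : pt) : (fun x : pt => (cube_bump c x)%:C : C^o)%C \in @csmooth R.
Proof.
apply/asboolP; split=> n.
  by apply: rCn_ext (bump_smooth c n) => x.
by apply: rCn_ext (rCn_cst n 0) => x.
Qed.

(** Testing against a bump function times the conjugate of g turns the integral
    into that of a nonnegative function. *)
Lemma sintegral_nondeg (g : S) :
  (forall f, ssupp_compact f -> sintegral (smul f g) = 0) -> g = 0.
Proof.
move=> g0; apply: smooth_ext => c; apply/eqP/negPn/negP => gc.
pose b := Smooth (bump_csmooth c).
have [M bM] := bump_boxed c.
have cb : ssupp_compact b.
  by apply/ssuppP; exists M => x i xi; rewrite /= (bM x i).
pose F := reP (smul (smul b (sconj g)) g).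
have E0 : rint F = 0 := congr1 (@complex.Re R) (g0 _ (ssupp_mull cb)).
have FE x : F x = cube_bump c x * (reP g x ^+ 2 + imP g x ^+ 2).
  rewrite /F /reP /imP /=; case: (g x) => u v /=.
  by move: (cube_bump c x) => w; ring.
have FM : boxed M F by move=> x i xi; rewrite FE (bM x i)// mul0r.
have cF : continuous F by exact: smooth_reP_cont.
have F0 x : 0 <= F x by rewrite FE mulr_ge0 ?bump_ge0 ?addr_ge0 ?sqr_ge0.
have Fc : 0 < F c.
  rewrite FE mulr_gt0 ?bump_gt0// lt_neqAle addr_ge0 ?sqr_ge0// andbT eq_sym.
  rewrite paddr_eq0 ?sqr_ge0// !sqrf_eq0; apply: contra gc => /andP[/eqP r0 /eqP i0].
  by move: r0 i0; rewrite /reP /imP; case: (g c) => [? ?] /= -> ->.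
have := integral_gt0 cF FM F0 Fc.
have fi := integrable_fin_num measurableT (boxed_integrable cF FM).
by rewrite -(fineK fi) lte_fin -[fine _]/(rint F) E0 ltxx.
Qed.

End SmoothFunctions.

(** * Pointwise product of formal power series *)

Section PointwiseSeries.
Variable R : realType.
Notation C := (R[i]).
Notation B := (moyalB R).

Definition texp_add (k l : thexp) : thexp := [ffun p => (k p + l p)%N].

(* exponents bounded by M form a finite type; up and down embed them in thexp *)
Let texp M : predArgType := {ffun thvar -> 'I_M.+1}.
Let up M (k : texp M) : thexp := [ffun p => k p : nat].

Let up_inj M : injective (@up M).
Proof.
by move=> k l /ffunP kl; apply/ffunP => p; have := kl p; rewrite !ffunE => /val_inj.
Qed.

Lemma texp_addA : associative texp_add.
Proof. by move=> k l m; apply/ffunP => p; rewrite !ffunE addnA. Qed.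

Lemma texp_addC : commutative texp_add.
Proof. by move=> k l; apply/ffunP => p; rewrite !ffunE addnC. Qed.

Lemma thdegD k l : thdeg (texp_add k l) = (thdeg k + thdeg l)%N.
Proof. by rewrite /thdeg -big_split; apply: eq_bigr => p _; rewrite ffunE. Qed.

Lemma texp_le_deg (n : thexp) p : (n p <= thdeg n)%N.
Proof. by rewrite /thdeg (bigD1 p)//= leq_addr. Qed.

Let down M (n : thexp) : texp M := [ffun p => inord (n p)].

Let downK M (n : thexp) : (thdeg n <= M)%N -> up (down M n) = n.
Proof.
move=> nM; apply/ffunP => p; rewrite !ffunE inordK// ltnS.
exact: leq_trans (texp_le_deg n p) nM.
Qed.

(** The bound M is arbitrary, so that products of several factors can be
    summed over one and the same finite range. *)
Let bpointE M (f h : B) n : (thdeg n <= M)%N ->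
  bpoint f h n = \sum_(k : texp M) \sum_(l : texp M | texp_add (up k) (up l) == n)
     smul (f (up k)) (h (up l)).
Proof.
move=> nM; rewrite /bpoint.
transitivity (\sum_(k : texp M | [forall p, (k p <= n p)%N])
    smul (f (up k)) (h [ffun p => (n p - k p)%N])).
  rewrite (reindex_onto (fun k : texp (thdeg n) => [ffun p => inord (k p)] : texp M)
     (fun k => [ffun p => inord (k p)])) /=; last first.
    move=> k /forallP kn; apply/ffunP => p; rewrite !ffunE; apply/val_inj.
    have kp : (k p < (thdeg n).+1)%N by rewrite ltnS (leq_trans (kn p) (texp_le_deg n p)).
    by rewrite /= inordK ?inordK.
  have iM (k : texp (thdeg n)) p : (inord (k p) : 'I_M.+1) = k p :> nat.
    by rewrite inordK// ltnS (leq_trans _ nM)// -ltnS.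
  apply: eq_big => [k|k _].
    have -> : [ffun p => inord ([ffun p0 => inord (k p0)] p : 'I_M.+1)] == k.
      by apply/eqP/ffunP => p; rewrite !ffunE; apply/val_inj; rewrite /= iM inord_val.
    by rewrite andbT; apply: eq_forallb => p; rewrite ffunE iM.
  congr (smul (f _) (h _)); apply/ffunP => p; rewrite !ffunE ?iM//.
rewrite big_mkcond; apply: eq_bigr => k _.
case: ifPn => [/forallP kn|].
  rewrite (big_pred1 (down M [ffun p => (n p - k p)%N])); last first.
    move=> l; apply/eqP/eqP => [<-|->].
      by apply/ffunP => p; rewrite !ffunE addKn inord_val.
    apply/ffunP => p; rewrite !ffunE inordK ?subnKC//.
    by rewrite ltnS (leq_trans (leq_subr _ _))// (leq_trans (texp_le_deg n p)).
  congr (smul _ (h _)); apply/ffunP => p; rewrite !ffunE inordK//.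
  by rewrite ltnS (leq_trans (leq_subr _ _))// (leq_trans (texp_le_deg n p)).
rewrite negb_forall => /existsP[p /negP kp]; rewrite big_pred0// => l.
by apply/eqP => kl; case: kp; rewrite -kl !ffunE leq_addr.
Qed.

Lemma bpointC (f h : B) : bpoint f h = bpoint h f.
Proof.
apply/funext => n; rewrite !(@bpointE (thdeg n))//.
rewrite (exchange_big_dep xpredT) //=; apply: eq_bigr => k _; apply: eq_big => [l|l _].
  by rewrite texp_addC.
by rewrite smulC.
Qed.

(** Both bracketings are the sum [T] over all triples of exponents that add up to
    [n]. *)
Lemma bpointA (f g h : B) : bpoint f (bpoint g h) = bpoint (bpoint f g) h.
Proof.
apply/funext => n; pose M := thdeg n.
pose T := \sum_(i : texp M) \sum_(j : texp M)
   \sum_(l : texp M | texp_add (up i) (texp_add (up j) (up l)) == n)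
     smul (f (up i)) (smul (g (up j)) (h (up l))).
have leM k l : texp_add k l = n -> (thdeg k <= M)%N.
  by rewrite /M => <-; rewrite thdegD leq_addr.
have reM k l : texp_add k l = n -> (thdeg l <= M)%N.
  by rewrite texp_addC; exact: leM.
transitivity T.
  rewrite (@bpointE M)//; apply: eq_bigr => i _.
  transitivity (\sum_(k : texp M | texp_add (up i) (up k) == n)
     \sum_(j : texp M) \sum_(l : texp M | texp_add (up j) (up l) == up k)
        smul (f (up i)) (smul (g (up j)) (h (up l)))).
    apply: eq_bigr => k /eqP ik; rewrite (@bpointE M) ?(reM _ _ ik)//.
    by rewrite smul_sumr; apply: eq_bigr => j _; rewrite smul_sumr.
  rewrite (exchange_big_dep xpredT) //=; apply: eq_bigr => j _.
  rewrite (exchange_big_dep (fun l => texp_add (up i) (texp_add (up j) (up l)) == n)) /=; last first.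
    by move=> k l; rewrite andbT => /eqP <- /eqP <-.
  apply: eq_bigr => l /eqP ijl; rewrite (big_pred1 (down M (texp_add (up j) (up l))))//.
  have jlM := reM _ _ ijl.
  move=> k; apply/andP/eqP => [[_ /eqP jl]|->]; last by rewrite downK// ijl !eqxx.
  by apply: up_inj; rewrite downK.
symmetry; rewrite (@bpointE M)//.
transitivity (\sum_(k : texp M) \sum_(l : texp M | texp_add (up k) (up l) == n)
     \sum_(i : texp M) \sum_(j : texp M | texp_add (up i) (up j) == up k)
        smul (f (up i)) (smul (g (up j)) (h (up l)))).
  apply: eq_bigr => k _; apply: eq_bigr => l /eqP kl; rewrite (@bpointE M) ?(leM _ _ kl)//.
  rewrite smul_suml; apply: eq_bigr => i _; rewrite smul_suml.
  by apply: eq_bigr => j _; rewrite smulA.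
transitivity (\sum_(k : texp M) \sum_(i : texp M) \sum_(l : texp M | texp_add (up k) (up l) == n)
      \sum_(j : texp M | texp_add (up i) (up j) == up k)
        smul (f (up i)) (smul (g (up j)) (h (up l)))).
  by apply: eq_bigr => k _; rewrite exchange_big.
rewrite exchange_big /=; apply: eq_bigr => i _.
transitivity (\sum_(k : texp M) \sum_(j : texp M | texp_add (up i) (up j) == up k)
   \sum_(l : texp M | texp_add (up k) (up l) == n)
        smul (f (up i)) (smul (g (up j)) (h (up l)))).
  by apply: eq_bigr => k _; rewrite exchange_big.
rewrite (exchange_big_dep xpredT) //=; apply: eq_bigr => j _.
rewrite (exchange_big_dep (fun l => texp_add (up i) (texp_add (up j) (up l)) == n)) /=; last first.
  by move=> k l /eqP ij /eqP <-; rewrite texp_addA ij.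
apply: eq_bigr => l /eqP ijl; rewrite (big_pred1 (down M (texp_add (up i) (up j))))//.
rewrite texp_addA in ijl; have ijM := leM _ _ ijl.
move=> k; apply/andP/eqP => [[/eqP ij _]|->]; last by rewrite downK// ijl !eqxx.
by apply: up_inj; rewrite downK.
Qed.

End PointwiseSeries.

(** * The bidifferential operators of the Moyal product *)

Section BidiffAlgebra.
Variable R : realType.
Notation C := (R[i]).
Notation B := (moyalB R).

Lemma bpoint_linl (f : B) : linear (fun g => bpoint g f).
Proof. by move=> a g h; rewrite ![bpoint _ f]bpointC bpoint_linr. Qed.

Lemma bpointCA (f g h : B) : bpoint f (bpoint g h) = bpoint g (bpoint f h).
Proof. by rewrite !bpointA [bpoint f g]bpointC. Qed.

Definition monomial (e : thexp) : B := fun n => if n == e then sone R else 0.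

Lemma bpoint_monomial e (f : B) n : bpoint (monomial e) f n =
  if [forall p, (e p <= n p)%N] then f [ffun p => (n p - e p)%N] else 0.
Proof.
rewrite /bpoint; case: ifPn => [/forallP en|nen].
  have [k0 k0E] : exists k0 : {ffun thvar -> 'I_(thdeg n).+1},
      forall p, k0 p = e p :> nat.
    exists [ffun p => inord (e p)] => p.
    by rewrite ffunE inordK// ltnS (leq_trans (en p))// texp_le_deg.
  rewrite (bigD1 k0) /=; last by apply/forallP => p; rewrite k0E.
  rewrite big1 ?addr0 => [|k /andP[_ kk0]].
    have -> : [ffun p => k0 p : nat] = e by apply/ffunP => p; rewrite ffunE k0E.
    rewrite /monomial eqxx smul1; congr (f _).
    by apply/ffunP => p; rewrite !ffunE k0E.
  rewrite /monomial ifN ?smul0l//; apply: contra kk0 => /eqP ke.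
  by apply/eqP/ffunP => p; apply/val_inj; rewrite /= k0E -ke ffunE.
rewrite big1// => k /forallP kn; rewrite /monomial ifN ?smul0l//.
apply: contra nen => /eqP ke; apply/forallP => p; rewrite -ke ffunE; exact: kn.
Qed.

Lemma boneE : bone R = monomial [ffun=> 0%N].
Proof.
apply/funext => n; rewrite /bone /monomial; congr (if _ then _ else _).
apply/eqP/eqP => [n0|->]; last by rewrite /thdeg big1// => p _; rewrite ffunE.
apply/ffunP => p; rewrite ffunE; have := texp_le_deg n p.
by rewrite n0 leqn0 => /eqP.
Qed.

Lemma bpoint1 (f : B) : bpoint (bone R) f = f.
Proof.
apply/funext => n; rewrite boneE bpoint_monomial ifT.
  by congr (f _); apply/ffunP => p; rewrite !ffunE subn0.
by apply/forallP => p; rewrite ffunE.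
Qed.

Lemma th_shiftE p (f : B) : th_shift p f = bpoint (monomial [ffun q => (q == p) : nat]) f.
Proof.
apply/funext => n; rewrite bpoint_monomial /th_shift; case np : (n p) => [|k].
  rewrite ifN//; apply/negP => /forallP/(_ p).
  by rewrite ffunE eqxx np.
rewrite ifT; last first.
  by apply/forallP => q; rewrite ffunE; case: eqP => [->|//]; rewrite np.
congr (f _); apply/ffunP => q; rewrite !ffunE; case: eqP => [->|_].
  by rewrite np subn1.
by rewrite subn0.
Qed.

Definition theta mu nu : B := th_mul mu nu (bone R).

(** Multiplication by theta^{mu nu} is the pointwise product with a central element,
    whence it commutes with all the [bidiff N]. *)
Lemma th_mulE mu nu (f : B) : th_mul mu nu f = bpoint (theta mu nu) f.
Proof.
have sE p (g : B) : th_shift p g = bpoint (th_shift p (bone R)) g.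
  by rewrite !th_shiftE -bpointA bpoint1.
rewrite /theta /th_mul; case: insub => [p|]; first exact: sE.
case: insub => [p|]; last by rewrite (lin_zero (bpoint_linl f)).
by rewrite sE (lin_opp (bpoint_linl f)).
Qed.

Lemma th_mul_anti mu nu (f : B) : th_mul mu nu f = - th_mul nu mu f.
Proof.
rewrite /th_mul; case: insubP => [p pP pE|mn].
  rewrite (_ : insub (nu, mu) = None) ?opprK//.
  by apply/insubN => /=; rewrite -leqNgt ltnW.
by case: insubP => [p pP pE|nm] //; rewrite oppr0.
Qed.

Lemma th_mulC mu nu mu' nu' (f : B) :
  th_mul mu nu (th_mul mu' nu' f) = th_mul mu' nu' (th_mul mu nu f).
Proof. by rewrite !th_mulE bpointCA. Qed.

Lemma bpartialC mu nu (f : B) : bpartial mu (bpartial nu f) = bpartial nu (bpartial mu f).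
Proof. by apply/funext => n; exact: spartialC. Qed.

Lemma bpartial_bpoint mu (f h : B) :
  bpartial mu (bpoint f h) = bpoint (bpartial mu f) h + bpoint f (bpartial mu h).
Proof.
apply/funext => n.
transitivity (bpoint (bpartial mu f) h n + bpoint f (bpartial mu h) n); last by [].
rewrite /bpartial /bpoint (lin_sum (@spartial_lin R mu)) -big_split.
apply: eq_bigr => k _.
exact: spartialM.
Qed.

Lemma bpartial1 mu : bpartial mu (bone R) = 0.
Proof.
apply/funext => n; rewrite /bpartial /bone; case: ifP => _; first exact: spartial1.
exact: lin_zero (@spartial_lin R mu).
Qed.

Lemma bpartial_th kappa mu nu (f : B) :
  bpartial kappa (th_mul mu nu f) = th_mul mu nu (bpartial kappa f).
Proof.
have sE p (g : B) : bpartial kappa (th_shift p g) = th_shift p (bpartial kappa g).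
  apply/funext => n; rewrite /bpartial /th_shift; case: (n p) => // .
  exact: lin_zero (@spartial_lin R kappa).
rewrite /th_mul; case: insub => [p|]; first exact: sE.
case: insub => [p|]; last exact: lin_zero (@bpartial_lin R kappa).
by rewrite (lin_opp (@bpartial_lin R kappa)) sE.
Qed.

(** The bidifferential operator inside the exponential of the Moyal product, with
    the derivatives of the two factors replaced by an arbitrary [F]. *)
Definition theta_contract (F : 'I_4 -> 'I_4 -> B) : B :=
  \sum_(mu < 4) \sum_(nu < 4) ('i / 2) *: th_mul mu nu (F mu nu).

Lemma bidiffS N (f h : B) :
  bidiff N.+1 f h = theta_contract (fun mu nu => bidiff N (bpartial mu f) (bpartial nu h)).
Proof. by []. Qed.

Lemma eq_theta_contract F G : (forall mu nu, F mu nu = G mu nu) -> theta_contract F = theta_contract G.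
Proof. by move=> FG; apply: eq_bigr => mu _; apply: eq_bigr => nu _; rewrite FG. Qed.

Lemma theta_contractD F G : theta_contract (fun mu nu => F mu nu + G mu nu) = theta_contract F + theta_contract G.
Proof.
rewrite /theta_contract -big_split; apply: eq_bigr => mu _.
rewrite -big_split; apply: eq_bigr => nu _ /=.
by rewrite (lin_add (th_mul_lin mu nu)) scalerDr.
Qed.

Lemma theta_contract_lin (L : B -> B) F : linear L ->
  (forall mu nu f, L (th_mul mu nu f) = th_mul mu nu (L f)) ->
  L (theta_contract F) = theta_contract (fun mu nu => L (F mu nu)).
Proof.
move=> Ll Lth; rewrite (lin_sum Ll); apply: eq_bigr => mu _.
by rewrite (lin_sum Ll); apply: eq_bigr => nu _; rewrite (lin_scale Ll) Lth.
Qed.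

Lemma theta_contract_sum n (w : nat -> nat) F :
  theta_contract (fun mu nu => \sum_(a < n) F a mu nu *+ w a) =
  \sum_(a < n) theta_contract (F a) *+ w a.
Proof.
rewrite /theta_contract; under [RHS]eq_bigr do rewrite -sumrMnl.
rewrite [RHS]exchange_big; apply: eq_bigr => mu _ /=.
under [RHS]eq_bigr do rewrite -sumrMnl.
rewrite [RHS]exchange_big; apply: eq_bigr => nu _ /=.
rewrite (lin_sum (th_mul_lin mu nu)) scaler_sumr; apply: eq_bigr => a _.
rewrite scalerMnr; congr (_ *: _).
by elim: (w a) => [|m IHm]; rewrite ?mulr0n ?mulrSr ?(lin_zero (th_mul_lin mu nu))
  ?(lin_add (th_mul_lin mu nu)) ?IHm.
Qed.

Lemma bidiff_linl N (h : B) : linear (fun f => bidiff N f h).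
Proof.
elim: N h => [|N IHN] h a f g; first exact: bpoint_linl.
rewrite !bidiffS /theta_contract scaler_sumr -big_split; apply: eq_bigr => mu _ /=.
rewrite scaler_sumr -big_split; apply: eq_bigr => nu _ /=.
by rewrite bpartial_lin IHN th_mul_lin scalerDr !scalerA mulrC.
Qed.

Lemma bpartial_bidiff kappa N (f h : B) :
  bpartial kappa (bidiff N f h) = bidiff N (bpartial kappa f) h + bidiff N f (bpartial kappa h).
Proof.
elim: N f h => [|N IHN] f h; first exact: bpartial_bpoint.
rewrite !bidiffS (theta_contract_lin _ (@bpartial_lin R kappa)) -?theta_contractD; last first.
  by move=> mu nu g; exact: bpartial_th.
by apply: eq_theta_contract => mu nu; rewrite IHN ![bpartial kappa (bpartial _ _)]bpartialC.
Qed.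

Lemma bidiff_thl N mu nu (f h : B) : bidiff N (th_mul mu nu f) h = th_mul mu nu (bidiff N f h).
Proof.
elim: N f h => [|N IHN] f h; first by rewrite /= !th_mulE bpointA.
rewrite !bidiffS (theta_contract_lin _ (@th_mul_lin R mu nu)) => [|k l g]; last exact: th_mulC.
by apply: eq_theta_contract => k l; rewrite bpartial_th IHN.
Qed.

Lemma bidiff_thr N mu nu (f h : B) : bidiff N f (th_mul mu nu h) = th_mul mu nu (bidiff N f h).
Proof.
elim: N f h => [|N IHN] f h; first by rewrite /= !th_mulE bpointCA.
rewrite !bidiffS (theta_contract_lin _ (@th_mul_lin R mu nu)) => [|k l g]; last exact: th_mulC.
by apply: eq_theta_contract => k l; rewrite bpartial_th IHN.
Qed.

(** Pascal's rule, as the induction step for the binomial sums of the next two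
    lemmas. *)
Lemma pascal_sum (V : zmodType) (X : nat -> nat -> V) N :
  \sum_(a < N.+2) X a (N.+1 - a)%N *+ 'C(N.+1, a) =
  \sum_(a < N.+1) (X a (N.+1 - a)%N + X a.+1 (N - a)%N) *+ 'C(N, a).
Proof.
rewrite big_ord_recl /= bin0 mulr1n.
under eq_bigr do rewrite binS mulrnDr subSS.
under [RHS]eq_bigr do rewrite mulrnDl.
rewrite !big_split addrA /=; congr (_ + _).
rewrite [RHS]big_ord_recl /= bin0 mulr1n; congr (_ + _).
by rewrite big_ord_recr /= bin_small// mulr0n addr0.
Qed.

(** The order N terms of both bracketings of a triple product satisfy the same
    recursion. It is the coefficientwise form of the differential equation in t
    of the products with theta scaled by t. *)
Fixpoint tridiff (N : nat) (f g h : B) : B :=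
  if N is N'.+1 then theta_contract (fun mu nu =>
    tridiff N' (bpartial mu f) g (bpartial nu h) +
    tridiff N' f (bpartial mu g) (bpartial nu h) +
    tridiff N' (bpartial mu f) (bpartial nu g) h)
  else bpoint (bpoint f g) h.

Let tridiffS N f g h : tridiff N.+1 f g h = theta_contract (fun mu nu =>
    tridiff N (bpartial mu f) g (bpartial nu h) +
    tridiff N f (bpartial mu g) (bpartial nu h) +
    tridiff N (bpartial mu f) (bpartial nu g) h).
Proof. by []. Qed.

(** A derivative of the inner product [bidiff a f g] falls on [f] or on [g] by the
    Leibniz rule; by [pascal_sum] this reproduces the recursion of [tridiff]. *)
Lemma tridiff_left N (f g h : B) :
  \sum_(a < N.+1) bidiff (N - a) (bidiff a f g) h *+ 'C(N, a) = tridiff N f g h.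
Proof.
elim: N f g h => [|N IHN] f g h; first by rewrite big_ord1 /= bin0 mulr1n.
rewrite (pascal_sum (fun a b => bidiff b (bidiff a f g) h)); cbv beta.
pose X a mu nu := bidiff (N - a) (bidiff a (bpartial mu f) g) (bpartial nu h) +
  bidiff (N - a) (bidiff a f (bpartial mu g)) (bpartial nu h) +
  bidiff (N - a) (bidiff a (bpartial mu f) (bpartial nu g)) h.
transitivity (theta_contract (fun mu nu => \sum_(a < N.+1) X a mu nu *+ 'C(N, a))).
  rewrite (theta_contract_sum (fun a => 'C(N, a)) (fun a : 'I_N.+1 => X a)).
  apply: eq_bigr => a _; congr (_ *+ _); rewrite /X theta_contractD; congr (_ + _).
    rewrite subSn; last by rewrite -ltnS.
    rewrite bidiffS; apply: eq_theta_contract => mu nu.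
    by rewrite bpartial_bidiff (lin_add (bidiff_linl _ _)).
  rewrite bidiffS (theta_contract_lin (L := fun u => bidiff (N - a) u h)) //.
    exact: bidiff_linl.
  by move=> mu nu u; exact: bidiff_thl.
rewrite tridiffS; apply: eq_theta_contract => mu nu; rewrite -!IHN -!big_split /=.
by apply: eq_bigr => a _; rewrite /X !mulrnDl.
Qed.

Lemma tridiff_right N (f g h : B) :
  \sum_(a < N.+1) bidiff (N - a) f (bidiff a g h) *+ 'C(N, a) = tridiff N f g h.
Proof.
elim: N f g h => [|N IHN] f g h; first by rewrite big_ord1 /= bin0 mulr1n bpointA.
rewrite (pascal_sum (fun a b => bidiff b f (bidiff a g h))); cbv beta.
pose X a mu nu := bidiff (N - a) (bpartial mu f) (bidiff a g (bpartial nu h)) +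
  bidiff (N - a) f (bidiff a (bpartial mu g) (bpartial nu h)) +
  bidiff (N - a) (bpartial mu f) (bidiff a (bpartial nu g) h).
transitivity (theta_contract (fun mu nu => \sum_(a < N.+1) X a mu nu *+ 'C(N, a))).
  rewrite (theta_contract_sum (fun a => 'C(N, a)) (fun a : 'I_N.+1 => X a)).
  apply: eq_bigr => a _; congr (_ *+ _).
  rewrite subSn; last by rewrite -ltnS.
  rewrite (bidiffS a) (theta_contract_lin (L := bidiff (N - a) f)); last first.
  - by move=> mu nu u; exact: bidiff_thr.
  - exact: bidiff_linr.
  rewrite bidiffS -theta_contractD; apply: eq_theta_contract => mu nu.
  by rewrite bpartial_bidiff (lin_add (bidiff_linr _ _)) [X in X + _]addrC addrAC.
rewrite tridiffS; apply: eq_theta_contract => mu nu; rewrite -!IHN -!big_split /=.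
by apply: eq_bigr => a _; rewrite /X !mulrnDl.
Qed.

End BidiffAlgebra.

(** * Associativity of the Moyal product *)

Section MoyalAlgebra.
Variable R : realType.
Notation C := (R[i]).
Notation B := (moyalB R).

(** The filtration by the order in theta; completeness with respect to it is what
    makes the exponential series meaningful. *)
Definition vanish (d : nat) (f : B) : Prop := forall n, (thdeg n < d)%N -> f n = 0.

Let vanishD d f g : vanish d f -> vanish d g -> vanish d (f + g).
Proof. by move=> vf vg n nd; rewrite -[LHS]/(f n + g n) vf// vg// addr0. Qed.

Let vanishZ d a f : vanish d f -> vanish d (a *: f).
Proof. by move=> vf n nd; rewrite -[LHS]/(a *: f n) vf// scaler0. Qed.

Let vanish_sum d I (r : seq I) P (F : I -> B) : (forall i, vanish d (F i)) ->
  vanish d (\sum_(i <- r | P i) F i).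
Proof. by move=> vF; elim/big_ind: _ => // f g; exact: vanishD. Qed.

Let vanish_bpoint d e f h : vanish d f -> vanish e h -> vanish (d + e) (bpoint f h).
Proof.
move=> vf vh n nde; rewrite /bpoint big1// => k /forallP kn.
have [kd|kd] := ltnP (thdeg [ffun p => k p : nat]) d; first by rewrite vf ?smul0l.
rewrite vh ?smul0//; rewrite -(ltn_add2l d); apply: leq_ltn_trans nde.
apply: leq_trans (leq_add kd (leqnn _)) _.
rewrite -thdegD; apply/eq_leq; congr thdeg; apply/ffunP => p; rewrite !ffunE.
by rewrite subnKC.
Qed.

Let vanish_th d mu nu f : vanish d f -> vanish d.+1 (th_mul mu nu f).
Proof.
move=> vf; have vs p : vanish d.+1 (th_shift p f).
  rewrite th_shiftE; apply: (vanish_bpoint (d := 1)) => // n n0.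
  rewrite /monomial; case: eqP => // nE; have := texp_le_deg n p.
  by rewrite leqNgt {2}nE ffunE eqxx n0.
rewrite /th_mul; case: insub => [p|]; first exact: vs.
case: insub => [p|//]; have := vanishZ (-1) (vs p).
by rewrite scaleN1r.
Qed.

Let vanish_partial d mu f : vanish d f -> vanish d (bpartial mu f).
Proof. by move=> vf n nd; rewrite /bpartial vf// (lin_zero (@spartial_lin R mu)). Qed.

Lemma vanish_bidiff N d e f h : vanish d f -> vanish e h -> vanish (N + (d + e)) (bidiff N f h).
Proof.
elim: N f h => [|N IHN] f h vf vh; first by rewrite add0n; exact: vanish_bpoint.
rewrite addSn; apply: vanish_sum => mu; apply: vanish_sum => nu; apply: vanishZ.
by apply: vanish_th; apply: IHN; exact: vanish_partial.
Qed.

(* Up to order M the Moyal product is this finite sum, which, unlike moyal itself,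
   does not depend on the coefficient under consideration. *)
Let trunc M (f h : B) : B := \sum_(N < M.+1) (N`!%:R : C)^-1 *: bidiff N f h.

Lemma bsum_at I (r : seq I) P (F : I -> B) n :
  (\sum_(i <- r | P i) F i) n = \sum_(i <- r | P i) F i n.
Proof. by elim/big_rec2: _ => // i x y _ <-. Qed.

Let v0 (f : B) : vanish 0 f. Proof. by []. Qed.

Lemma moyal_trunc M (f h : B) n : (thdeg n <= M)%N ->
  moyal f h n = \sum_(N < M.+1) (N`!%:R : C)^-1 *: bidiff N f h n.
Proof.
move=> nM; rewrite /moyal -(big_mkord xpredT (fun N => (N`!%:R : C)^-1 *: bidiff N f h n)).
rewrite -(big_mkord xpredT (fun N => (N`!%:R : C)^-1 *: bidiff N f h n)).
rewrite [RHS](big_cat_nat (n := (thdeg n).+1)) //= [X in _ = _ + X]big_nat_cond.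
rewrite [X in _ = _ + X]big1 ?addr0//.
move=> N /andP[/andP[nN _] _]; rewrite (vanish_bidiff (v0 f) (v0 h)) ?scaler0//.
by rewrite !addn0.
Qed.

Let truncE M f h n : (thdeg n <= M)%N -> moyal f h n = trunc M f h n.
Proof. by move=> nM; rewrite (moyal_trunc _ _ nM) /trunc bsum_at. Qed.

(** The square and the triangle [a + b <= M] differ by terms that vanish; the
    triangle is then summed along its antidiagonals. *)
Lemma triangle_sum (V : zmodType) (Y : nat -> nat -> V) M :
  (forall a b, (M < a + b)%N -> Y a b = 0) ->
  \sum_(b < M.+1) \sum_(a < M.+1) Y a b =
  \sum_(N < M.+1) \sum_(a < N.+1) Y a (N - a)%N.
Proof.
move=> Y0.
transitivity (\sum_(a < M.+1) \sum_(N < M.+1 | (a <= N)%N) Y a (N - a)%N).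
  rewrite exchange_big; apply: eq_bigr => a _ /=.
  have aM : (a <= M.+1)%N by exact: ltnW.
  rewrite -(big_mkord xpredT (Y a)) (big_cat_nat (n := M.+1 - a)) ?leq_subr//=.
  rewrite [X in _ + X]big_nat_cond [X in _ + X]big1 ?addr0; last first.
    by move=> b /andP[/andP[]]; rewrite leq_subLR => Mb _ _; exact: Y0.
  rewrite -(big_mkord (fun N => (a <= N)%N) (fun N => Y a (N - a)%N)).
  rewrite [RHS](big_cat_nat (n := a))//= [X in _ = X + _]big_nat_cond.
  rewrite [X in _ = X + _]big1 ?add0r; last first.
    by move=> N /andP[/andP[_ Na]]; rewrite leqNgt Na.
  transitivity (\sum_(0 + a <= N < M.+1) Y a (N - a)%N).
    by rewrite big_addn; apply: eq_bigr => b _; rewrite addnK.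
  rewrite add0n [LHS]big_nat_cond [RHS]big_nat_cond; apply: eq_bigl => N.
  by rewrite andbT; case: (a <= N)%N; rewrite ?andbT ?andbF.
rewrite (exchange_big_dep xpredT) //=; apply: eq_bigr => N _.
rewrite -(big_mkord (fun a => (a <= N)%N) (fun a => Y a (N - a)%N)).
rewrite -(big_mkord xpredT (fun a => Y a (N - a)%N)).
rewrite (big_cat_nat (n := N.+1)) ?ltn_ord//= [X in _ + X]big_nat_cond.
rewrite [X in _ + X]big1 ?addr0; last first.
  by move=> a /andP[/andP[Na _]]; rewrite leqNgt Na.
by rewrite [LHS]big_nat_cond [RHS]big_nat_cond; apply: eq_bigl => a; rewrite ltnS /= andbb andbT.
Qed.

Lemma triangle_coef (N a : nat) : (a <= N)%N ->
  ((N - a)`!%:R : C)^-1 * (a`!%:R)^-1 = (N`!%:R)^-1 * ('C(N, a))%:R.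
Proof.
move=> aN; have f0 k : (k`!%:R : C) != 0 by rewrite pnatr_eq0 -lt0n fact_gt0.
rewrite -(bin_fact aN) !natrM -invfM.
have b0 : ('C(N, a)%:R : C) != 0 by rewrite pnatr_eq0 -lt0n bin_gt0.
by rewrite [RHS]mulrC [in RHS]invfM mulrA mulfV// mul1r [(N - a)`!%:R * _]mulrC.
Qed.

Let trunc_trunc M (L : nat -> nat -> B) n : (thdeg n <= M)%N ->
  (forall a b, vanish (a + b) (L a b)) ->
  \sum_(b < M.+1) \sum_(a < M.+1) ((b`!%:R : C)^-1 * (a`!%:R)^-1) *: L a b n =
  \sum_(N < M.+1) (N`!%:R : C)^-1 *: (\sum_(a < N.+1) L a (N - a)%N *+ 'C(N, a)) n.
Proof.
move=> nM vL.
rewrite (triangle_sum (Y := fun a b => ((b`!%:R : C)^-1 * (a`!%:R)^-1) *: L a b n)); last first.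
  by move=> a b Mab; rewrite vL ?scaler0// (leq_ltn_trans nM).
apply: eq_bigr => N _; rewrite bsum_at scaler_sumr; apply: eq_bigr => a _.
rewrite triangle_coef -1?ltnS// -scalerA; congr (_ *: _).
rewrite scaler_nat; elim: ('C(N, a)) => [//|m IHm].
by rewrite !mulrS -[RHS]/(L a (N - a)%N n + (L a (N - a)%N *+ m) n) IHm.
Qed.

Lemma moyal_linl (h : B) : linear (fun f => moyal f h).
Proof.
move=> a f g; apply/funext => n.
rewrite -[RHS]/(a *: moyal f h n + moyal g h n) /moyal scaler_sumr -big_split.
apply: eq_bigr => N _ /=; rewrite bidiff_linl.
rewrite -[(_ + _) n]/(a *: bidiff N f h n + bidiff N g h n).
by rewrite scalerDr !scalerA mulrC.
Qed.

(** The terms of order [N] of both bracketings are [tridiff N f g h / N!]. The inner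
    product may be replaced by its truncation, because the error has order greater
    than the degree of the coefficient [n]. *)
Lemma moyalA (f g h : B) : moyal f (moyal g h) = moyal (moyal f g) h.
Proof.
have vr M u v : vanish M.+1 (moyal u v - trunc M u v).
  move=> n nM; rewrite -[LHS]/(moyal u v n - trunc M u v n) (truncE _ _ (M := M)) ?subrr//.
apply/funext => n; pose M := thdeg n.
transitivity (\sum_(N < M.+1) (N`!%:R : C)^-1 *: tridiff N f g h n).
  rewrite -(subrK (trunc M g h) (moyal g h)) (lin_add (moyal_linr f)).
  rewrite -[LHS]/(moyal f (moyal g h - trunc M g h) n + moyal f (trunc M g h) n).
  rewrite [X in X + _](_ : _ = 0) ?add0r; last first.
    rewrite /moyal big1// => N _; rewrite (vanish_bidiff (v0 f) (vr M g h)) ?scaler0//.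
    by rewrite add0n ltn_addl.
  under [RHS]eq_bigr do rewrite -tridiff_right.
  rewrite -(trunc_trunc (L := fun a b => bidiff b f (bidiff a g h)))//; last first.
    move=> a b k kab; apply: (vanish_bidiff (v0 f) (vanish_bidiff (v0 g) (v0 h))).
    by rewrite !addn0 add0n addnC.
  rewrite (moyal_trunc (M := M))//; apply: eq_bigr => b _.
  rewrite (lin_sum (bidiff_linr b f)) bsum_at scaler_sumr; apply: eq_bigr => a _.
  by rewrite (lin_scale (bidiff_linr b f)) -scalerA.
symmetry.
rewrite -(subrK (trunc M f g) (moyal f g)) (lin_add (moyal_linl h)).
rewrite -[LHS]/(moyal (moyal f g - trunc M f g) h n + moyal (trunc M f g) h n).
rewrite [X in X + _](_ : _ = 0) ?add0r; last first.
  rewrite /moyal big1// => N _; rewrite (vanish_bidiff (vr M f g) (v0 h)) ?scaler0//.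
  by rewrite addn0 ltn_addl.
under [RHS]eq_bigr do rewrite -tridiff_left.
rewrite -(trunc_trunc (L := fun a b => bidiff b (bidiff a f g) h))//; last first.
  move=> a b k kab; apply: (vanish_bidiff (vanish_bidiff (v0 f) (v0 g)) (v0 h)).
  by rewrite !addn0 addnC.
rewrite (moyal_trunc (M := M))//; apply: eq_bigr => b _.
rewrite (lin_sum (bidiff_linl b h)) bsum_at scaler_sumr; apply: eq_bigr => a _.
by rewrite (lin_scale (bidiff_linl b h)) -scalerA.
Qed.

End MoyalAlgebra.

(** * Unit and trace property of the Moyal product *)

Section MoyalTrace.
Variable R : realType.
Notation C := (R[i]).
Notation B := (moyalB R).

Let term (f h : B) (N : nat) : B := (N`!%:R : C)^-1 *: bidiff N f h.

Let moyal_head (f h : B) n : (forall N, bidiff N.+1 f h n = 0) ->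
  moyal f h n = bpoint f h n.
Proof.
move=> fh0; rewrite /moyal big_ord_recl [X in _ + X]big1 => [|N _]; last first.
  by rewrite lift0 fh0 scaler0.
by rewrite addr0 fact0 invr1 scale1r.
Qed.

Lemma moyal1f (f : B) : moyal (bone R) f = f.
Proof.
apply/funext => n; rewrite moyal_head ?bpoint1// => N.
have -> // : bidiff N.+1 (bone R) f = 0.
rewrite bidiffS /theta_contract big1// => mu _.
rewrite big1// => nu _; rewrite bpartial1 (lin_zero (bidiff_linl _ _)).
by rewrite (lin_zero (th_mul_lin mu nu)) scaler0.
Qed.

Lemma moyalf1 (f : B) : moyal f (bone R) = f.
Proof.
apply/funext => n; rewrite moyal_head => [|N]; first by rewrite bpointC bpoint1.
have -> // : bidiff N.+1 f (bone R) = 0.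
rewrite bidiffS /theta_contract big1// => mu _.
rewrite big1// => nu _; rewrite bpartial1 (lin_zero (bidiff_linr _ _)).
by rewrite (lin_zero (th_mul_lin mu nu)) scaler0.
Qed.

Lemma bconjP a (f g : B) : bconj (a *: f + g) = a^* *: bconj f + bconj g.
Proof. by apply/funext => n; exact: sconjP. Qed.

Lemma bconjK : involutive (@bconj R).
Proof. by move=> f; apply/funext => n; exact: sconjK. Qed.

Lemma bconj0 : bconj (0 : B) = 0.
Proof.
by have := bconjP (-1) 0 0; rewrite scaler0 addr0 rmorphN1 scaleN1r addNr.
Qed.

Lemma bsuppP_lin a (f g : B) : bsupp_compact f -> bsupp_compact g ->
  bsupp_compact (a *: f + g).
Proof. by move=> cf cg n; exact (ssuppP_lin (cf n) (cg n)). Qed.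

Lemma bsupp0 : bsupp_compact (0 : B).
Proof. by move=> n; exact: ssupp0. Qed.

Lemma bsuppZ a (f : B) : bsupp_compact f -> bsupp_compact (a *: f).
Proof. by move=> cf n; exact (ssuppZ (cf n)). Qed.

Lemma bsuppD (f g : B) : bsupp_compact f -> bsupp_compact g -> bsupp_compact (f + g).
Proof. by move=> cf cg n; exact (ssuppD (cf n) (cg n)). Qed.

Lemma bsupp_sum I (r : seq I) P (F : I -> B) : (forall i, bsupp_compact (F i)) ->
  bsupp_compact (\sum_(i <- r | P i) F i).
Proof.
by move=> cF; elim/big_ind: _ => [|f g|i _]; [exact: bsupp0|exact: bsuppD|exact: cF].
Qed.

Lemma bsupp_conj (f : B) : bsupp_compact f -> bsupp_compact (bconj f).
Proof. by move=> cf n; exact (ssupp_conj (cf n)). Qed.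

Lemma bsupp_partial mu (f : B) : bsupp_compact f -> bsupp_compact (bpartial mu f).
Proof. by move=> cf n; exact (ssupp_partial (cf n)). Qed.

Lemma bsupp_th mu nu (f : B) : bsupp_compact f -> bsupp_compact (th_mul mu nu f).
Proof.
move=> cf; have cs p : bsupp_compact (th_shift p f).
  by move=> n; rewrite /th_shift; case: (n p) => [|k]; [exact: ssupp0|exact: cf].
rewrite /th_mul; case: insub => [p|]; first exact: cs.
case: insub => [p|]; last exact: bsupp0.
by rewrite -scaleN1r; exact: bsuppZ.
Qed.

Lemma bsupp_bpoint (f h : B) : bsupp_compact f \/ bsupp_compact h ->
  bsupp_compact (bpoint f h).
Proof.
move=> cfh n; rewrite /bpoint; elim/big_ind: _ => [|u v|k _].
- exact: ssupp0.
- exact: ssuppD.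
- by case: cfh => [cf|ch]; [apply: ssupp_mull|apply: ssupp_mulr].
Qed.

Lemma bsupp_bidiff N (f h : B) : bsupp_compact f \/ bsupp_compact h ->
  bsupp_compact (bidiff N f h).
Proof.
elim: N f h => [|N IHN] f h cfh; first exact: bsupp_bpoint.
apply: bsupp_sum => mu; apply: bsupp_sum => nu; apply: bsuppZ; apply: bsupp_th.
by apply: IHN; case: cfh => [cf|ch]; [left|right]; exact: bsupp_partial.
Qed.

Lemma bsupp_moyal (f h : B) : bsupp_compact f \/ bsupp_compact h ->
  bsupp_compact (moyal f h).
Proof.
move=> cfh n; rewrite /moyal; elim/big_ind: _ => [|u v|N _].
- exact: ssupp0.
- exact: ssuppD.
- by apply: ssuppZ; exact: bsupp_bidiff.
Qed.

Lemma bintegralP a (f g : B) : bsupp_compact f -> bsupp_compact g ->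
  bintegral (a *: f + g) = a *: bintegral f + bintegral g.
Proof. by move=> cf cg; apply/funext => n; exact: sintegralP. Qed.

Lemma bintegral0 : bintegral (0 : B) = 0.
Proof. by apply/funext => n; exact: sintegral0. Qed.

Lemma bintegralD (f g : B) : bsupp_compact f -> bsupp_compact g ->
  bintegral (f + g) = bintegral f + bintegral g.
Proof. by move=> cf cg; rewrite -[f]scale1r bintegralP// !scale1r. Qed.

Lemma bintegralZ a (f : B) : bsupp_compact f -> bintegral (a *: f) = a *: bintegral f.
Proof.
move=> cf; rewrite -[a *: f]addr0 bintegralP//; last exact: bsupp0.
by rewrite bintegral0 addr0.
Qed.

Lemma bintegral_sum I (r : seq I) P (F : I -> B) : (forall i, bsupp_compact (F i)) ->
  bintegral (\sum_(i <- r | P i) F i) = \sum_(i <- r | P i) bintegral (F i).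
Proof.
move=> cF; elim: r => [|i r IHr]; first by rewrite !big_nil bintegral0.
rewrite !big_cons; case: ifP => // _; rewrite bintegralD ?IHr//.
exact: bsupp_sum.
Qed.

Lemma bintegral_partial mu (f : B) : bsupp_compact f -> bintegral (bpartial mu f) = 0.
Proof. by move=> cf; apply/funext => n; exact: sintegral_partial. Qed.

Lemma theta_contract_sym (F : 'I_4 -> 'I_4 -> B) :
  (forall mu nu, F mu nu = F nu mu) -> theta_contract F = 0.
Proof.
move=> FC; have : theta_contract F = - theta_contract F.
  rewrite {1}/theta_contract exchange_big -sumrN; apply: eq_bigr => mu _ /=.
  by rewrite -sumrN; apply: eq_bigr => nu _; rewrite th_mul_anti scalerN FC.
move/eqP; rewrite -subr_eq0 opprK -mulr2n -scaler_nat scaler_eq0 pnatr_eq0 /=.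
by move/eqP.
Qed.

(** theta being antisymmetric, the terms of positive order are total derivatives. *)
Lemma bintegral_bidiff N (f h : B) : bsupp_compact f \/ bsupp_compact h ->
  bintegral (bidiff N.+1 f h) = 0.
Proof.
move=> cfh; rewrite bidiffS.
have -> : theta_contract (fun mu nu => bidiff N (bpartial mu f) (bpartial nu h)) =
    theta_contract (fun mu nu => bpartial mu (bidiff N f (bpartial nu h))).
  have -> : theta_contract (fun mu nu => bpartial mu (bidiff N f (bpartial nu h))) =
     theta_contract (fun mu nu => bidiff N (bpartial mu f) (bpartial nu h)) +
     theta_contract (fun mu nu => bidiff N f (bpartial mu (bpartial nu h))).
    by rewrite -theta_contractD; apply: eq_theta_contract => mu nu; rewrite bpartial_bidiff.
  rewrite [X in _ = _ + X]theta_contract_sym ?addr0// => mu nu.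
  by rewrite bpartialC.
have cp nu : bsupp_compact (bidiff N f (bpartial nu h)).
  by apply: bsupp_bidiff; case: cfh => [cf|ch]; [left|right; exact: bsupp_partial].
have c1 mu nu : bsupp_compact (('i / 2) *: th_mul mu nu (bpartial mu (bidiff N f (bpartial nu h)))).
  by apply: bsuppZ; apply: bsupp_th; apply: bsupp_partial; exact: cp.
rewrite /theta_contract bintegral_sum ?big1// => mu; last by apply: bsupp_sum => nu.
move=> _; rewrite bintegral_sum ?big1// => nu _.
rewrite -bpartial_th -(lin_scale (@bpartial_lin R mu)) bintegral_partial//.
by apply: bsuppZ; apply: bsupp_th; exact: cp.
Qed.

Lemma bintegral_moyal (f h : B) : bsupp_compact f \/ bsupp_compact h ->
  bintegral (moyal f h) = bintegral (bpoint f h).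
Proof.
move=> cfh; apply/funext => n; rewrite /bintegral.
have E : moyal f h n = (\sum_(N < (thdeg n).+1) term f h N) n.
  by rewrite bsum_at.
rewrite E -[LHS]/(bintegral _ n) bintegral_sum; last first.
  by move=> N; apply: bsuppZ; exact: bsupp_bidiff.
rewrite big_ord_recl [X in _ + X]big1 ?addr0 => [|N _]; last first.
  rewrite lift0 /term bintegralZ; last exact: bsupp_bidiff.
  by rewrite bintegral_bidiff ?scaler0.
by rewrite /term fact0 invr1 scale1r.
Qed.

(** The integral reduces the Moyal product to the pointwise one, which is
    commutative. *)
Lemma bintegral_moyalC (f h : B) : bsupp_compact f \/ bsupp_compact h ->
  bintegral (moyal f h) = bintegral (moyal h f).
Proof.
move=> cfh; rewrite !bintegral_moyal 1?bpointC//.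
by case: cfh; [right|left].
Qed.

(** Test functions that are constant in theta isolate each coefficient of [h], once
    the Moyal product under the integral has become pointwise. *)
Lemma bintegral_nondeg (h : B) :
  (forall f, bsupp_compact f -> bintegral (moyal f h) = 0) -> h = 0.
Proof.
move=> h0; apply/funext => n; apply: sintegral_nondeg => phi cphi.
pose f : B := fun m => smul phi (bone R m).
have cf : bsupp_compact f by move=> m; exact: ssupp_mull.
have := congr1 (@^~ n) (h0 f cf); rewrite bintegral_moyal; last by left.
move=> E; apply: etrans E; congr (Defs.sintegral _).
have fE : bpoint f h n = smul phi (bpoint (bone R) h n).
  rewrite /bpoint (lin_sum (smul_linr phi)); apply: eq_bigr => k _.
  by rewrite smulA.
by rewrite fE bpoint1.
Qed.

End MoyalTrace.

(** * Signs of exterior products and of the Minkowski metric *)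

Section ExteriorSigns.
Variable R : realType.
Notation C := (R[i]).
Notation wsign := (@wsign R).
Notation gram := (@gram R).
Implicit Types I J K : {set 'I_4}.

Lemma wsignUl I J K : [disjoint I & J]%bool -> wsign (I :|: J)%SET K = wsign I K * wsign J K.
Proof.
move=> /pred0P dIJ; rewrite /wsign -exprD -cardUI; congr (_ ^+ _).
rewrite [X in (_ + X)%N]eq_card0 ?addn0 => [|[m n]]; last first.
  rewrite !inE /=; have := dIJ m; rewrite /= => d; apply/negP.
  by move=> /andP[/and3P[mI _ _] /and3P[mJ _ _]]; rewrite mI mJ in d.
apply: eq_card => -[m n]; rewrite !inE /=.
by case: (m \in I); case: (m \in J); case: (n \in K); case: (n < m)%N.
Qed.

Lemma wsignUr I J K : [disjoint J & K]%bool -> wsign I (J :|: K)%SET = wsign I J * wsign I K.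
Proof.
move=> /pred0P dIJ; rewrite /wsign -exprD -cardUI; congr (_ ^+ _).
rewrite [X in (_ + X)%N]eq_card0 ?addn0 => [|[m n]]; last first.
  rewrite !inE /=; have := dIJ n; rewrite /= => d; apply/negP.
  by move=> /andP[/and3P[_ nJ _] /and3P[_ nK _]]; rewrite nJ nK in d.
apply: eq_card => -[m n]; rewrite !inE /=.
by case: (m \in I); case: (n \in J); case: (n \in K); case: (n < m)%N.
Qed.

Lemma wsign_sq I J : wsign I J * wsign I J = 1.
Proof. by rewrite /wsign -exprD addnn -signr_odd odd_double. Qed.

(** Each pair in [I x J] is an inversion on exactly one of the two sides. *)
Lemma wsign_swap I J : [disjoint I & J]%bool -> wsign I J * wsign J I = (-1) ^+ (#|I| * #|J|).
Proof.
move=> /pred0P dIJ; rewrite /wsign -exprD; congr (_ ^+ _).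
pose sw (p : 'I_4 * 'I_4) := (p.2, p.1).
have swK : involutive sw by case.
have -> : #|[pred p : 'I_4 * 'I_4 | [&& p.1 \in J, p.2 \in I & (p.2 < p.1)%N]]| =
          #|[pred p : 'I_4 * 'I_4 | [&& p.1 \in I, p.2 \in J & (p.1 < p.2)%N]]|.
  rewrite -(fintype.card_image (inv_inj swK)); apply: eq_card => -[m n].
  rewrite -[in LHS](swK (m, n)) fintype.mem_image; last exact: inv_inj.
  by rewrite !inE /= andbCA.
rewrite -cardUI [X in (_ + X)%N]eq_card0 ?addn0 => [|[m n]]; last first.
  rewrite !inE /=; apply/negP => /andP[/and3P[_ _ mn] /and3P[_ _]].
  by rewrite ltnNge (ltnW mn).
rewrite -cardX; apply: eq_card => -[m n]; rewrite !inE /=.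
case mI: (m \in I); case nJ: (n \in J) => //=.
rewrite -neq_ltn; apply/eqP => /val_inj nm; have := dIJ m.
by rewrite /= mI -nm nJ.
Qed.

(** An element of [I] outside [J] gives a zero row, the metric being diagonal. *)
Lemma gram_neq I J : I != J -> gram I J = 0.
Proof.
move=> IJ; rewrite /gram; case: eqP => // cIJ.
have [m mI mJ] : exists2 m, m \in I & m \notin J.
  apply/subsetPn; apply: contra IJ => sIJ.
  by rewrite eqEcard sIJ cIJ leqnn.
have iI : (index m (enum I) < #|I|)%N by rewrite cardE index_mem mem_enum.
rewrite (expand_det_row _ (Ordinal iI)) big1// => j _; rewrite !mxE /=.
rewrite nth_index ?mem_enum// /Defs.minkowski ifN ?mul0r//.
apply: contra mJ => /eqP ->; rewrite -mem_enum mem_nth//.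
by rewrite -cardE -cIJ.
Qed.

Lemma gram_diag I : gram I I = 1 \/ gram I I = -1.
Proof.
rewrite /gram eqxx.
pose d : 'rV[C]_#|I| := \row_a (if nth ord0 (enum I) a == ord0 then 1 else -1).
have -> : \matrix_(a < #|I|, b < #|I|)
    Defs.minkowski R (nth ord0 (enum I) a) (nth ord0 (enum I) b) = diag_mx d.
  apply/matrixP => a b; rewrite !mxE /Defs.minkowski.
  rewrite nth_uniq ?enum_uniq -?cardE//.
  by rewrite (inj_eq val_inj); case: (a == b); rewrite ?mulr1n ?mulr0n.
rewrite det_diag; elim/big_ind: _ => [|x y [->|->] [->|->]|a _].
- by left.
- by left; rewrite mulr1.
- by right; rewrite mul1r.
- by right; rewrite mulr1.
- by left; rewrite mulrNN mulr1.
- by rewrite mxE; case: ifP => _; [left|right].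
Qed.

(** The Hodge operator exchanges the components of complementary index sets up to
    this sign; see [hodgeE]. *)
Definition hodge_sign K : C := wsign (~: K)%SET K * gram (~: K)%SET (~: K)%SET.

Lemma hodge_sign_sq K : hodge_sign K * hodge_sign K = 1.
Proof.
rewrite /hodge_sign mulrACA wsign_sq mul1r.
by case: (gram_diag (~: K)%SET) => ->; rewrite ?mulrNN mulr1.
Qed.

End ExteriorSigns.

(** * Noncommutative differential forms *)

Section Forms.
Variable R : realType.
Notation C := (R[i]).
Notation B := (moyalB R).
Notation OB := (forms R).
Notation wsign := (@wsign R).
Implicit Types (I J K : {set 'I_4}) (a b c : OB).

Lemma hodgeE b K : hodge b K = hodge_sign R K *: bconj (b (~: K)%SET).
Proof.
rewrite /hodge (bigD1 (~: K)%SET)//= big1 ?addr0// => J JK.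
by rewrite gram_neq 1?eq_sym// mulr0 scale0r.
Qed.

Let hodge_inverse c : OB := fun I => bconj (hodge_sign R (~: I)%SET *: c (~: I)%SET).

Let hodgeK : cancel (@hodge R) hodge_inverse.
Proof.
move=> b; apply/funext => I; rewrite /hodge_inverse hodgeE finset.setCK.
by rewrite scalerA hodge_sign_sq scale1r bconjK.
Qed.

Let hodge_inverseK : cancel hodge_inverse (@hodge R).
Proof.
move=> c; apply/funext => I; rewrite hodgeE /hodge_inverse finset.setCK bconjK.
by rewrite scalerA hodge_sign_sq scale1r.
Qed.

Lemma hodge_inj : injective (@hodge R).
Proof. exact: can_inj hodgeK. Qed.

Lemma hodge_invK : cancel (@hodge_inv R) (@hodge R).
Proof.
move=> c; rewrite /hodge_inv.
by have := @xgetPex _ 0 [set a | hodge a = c] (ex_intro _ _ (hodge_inverseK c)).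
Qed.

Lemma hodgeP x a b : hodge (x *: a + b) = x^* *: hodge a + hodge b.
Proof.
apply/funext => K; rewrite hodgeE -[RHS]/(x^* *: hodge a K + hodge b K) !hodgeE.
rewrite -[X in bconj X]/(x *: a (~: K)%SET + b (~: K)%SET) bconjP.
by rewrite scalerDr !scalerA mulrC.
Qed.

Lemma hodge_invP x a b : hodge_inv (x *: a + b) = x^* *: hodge_inv a + hodge_inv b.
Proof. by apply: hodge_inj; rewrite hodgeP !hodge_invK conjCK. Qed.

Lemma hodge_inv0 : hodge_inv (0 : OB) = 0.
Proof.
by have := hodge_invP (-1) 0 0; rewrite scaler0 addr0 rmorphN1 scaleN1r addNr.
Qed.

Lemma hodge_invD : {morph @hodge_inv R : a b / a + b}.
Proof. by move=> a b; have := hodge_invP 1 a b; rewrite rmorph1 !scale1r. Qed.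

Lemma hodge_invZ x a : hodge_inv (x *: a) = x^* *: hodge_inv a.
Proof. by have := hodge_invP x a 0; rewrite hodge_inv0 !addr0. Qed.

Lemma hodge0 : hodge (0 : OB) = 0.
Proof. by have := hodgeP (-1) 0 0; rewrite scaler0 addr0 rmorphN1 scaleN1r addNr. Qed.

Lemma hodgeD : {morph @hodge R : a b / a + b}.
Proof. by move=> a b; have := hodgeP 1 a b; rewrite rmorph1 !scale1r. Qed.

Lemma wedge_linl b : linear (fun a => wedge a b).
Proof.
move=> x a a'; apply/funext => K.
rewrite -[RHS]/(x *: wedge a b K + wedge a' b K) /wedge scaler_sumr -big_split.
apply: eq_bigr => I _ /=; rewrite -[(x *: a + a') I]/(x *: a I + a' I) moyal_linl.
by rewrite scalerDr !scalerA mulrC.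
Qed.

Lemma wedge_linr a : linear (wedge a).
Proof.
move=> x b b'; apply/funext => K.
rewrite -[RHS]/(x *: wedge a b K + wedge a b' K) /wedge scaler_sumr -big_split.
apply: eq_bigr => I _ /=.
rewrite -[(x *: b + b') _]/(x *: b (K :\: I)%SET + b' (K :\: I)%SET) moyal_linr.
by rewrite scalerDr !scalerA mulrC.
Qed.

Lemma fdiff_lin : linear (@fdiff R).
Proof.
move=> x a b; apply/funext => K.
rewrite -[RHS]/(x *: fdiff a K + fdiff b K) /fdiff scaler_sumr -big_split.
apply: eq_bigr => mu _ /=.
rewrite -[(x *: a + b) _]/(x *: a (K :\ mu)%SET + b (K :\ mu)%SET) bpartial_lin.
by rewrite scalerDr !scalerA mulrC.
Qed.

Lemma fgrade_lin : linear (@fgrade R).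
Proof.
move=> x a b; apply/funext => K.
rewrite /fgrade -[(x *: a + b) K]/(x *: a K + b K).
rewrite -[RHS]/(x *: ((-1) ^+ #|K| *: a K) + (-1) ^+ #|K| *: b K).
by rewrite scalerDr !scalerA mulrC.
Qed.

Lemma fgradeK : involutive (@fgrade R).
Proof.
by move=> a; apply/funext => K; rewrite /fgrade scalerA -expr2 sqrr_sign scale1r.
Qed.

(** Up to the signs, both sides are the sum over the partitions of K in three parts. *)
Lemma wedgeA a b c : wedge a (wedge b c) = wedge (wedge a b) c.
Proof.
apply/funext => K; rewrite /wedge.
transitivity (\sum_(I : {set 'I_4} | I \subset K) \sum_(J : {set 'I_4} | J \subset (K :\: I)%SET)
   (wsign I (K :\: I)%SET * wsign J ((K :\: I) :\: J)%SET) *: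
     moyal (moyal (a I) (b J)) (c ((K :\: I) :\: J)%SET)).
  apply: eq_bigr => I IK; rewrite (lin_sum (moyal_linr _)) scaler_sumr.
  apply: eq_bigr => J JKI; rewrite (lin_scale (moyal_linr _)) scalerA.
  by rewrite moyalA.
transitivity (\sum_(I : {set 'I_4} | I \subset K) \sum_(L : {set 'I_4} | (L \subset K) && (I \subset L))
   (wsign L (K :\: L)%SET * wsign I (L :\: I)%SET) *:
     moyal (moyal (a I) (b (L :\: I)%SET)) (c (K :\: L)%SET)); last first.
  rewrite (exchange_big_dep (fun L : {set 'I_4} => L \subset K)) /=; last by move=> I L _ /andP[].
  apply: eq_bigr => L LK; rewrite (lin_sum (moyal_linl _)) scaler_sumr.
  apply: eq_big => [I|I /andP[IK IL]].
    by rewrite LK; case IL: (I \subset L); rewrite ?andbF// (fintype.subset_trans IL LK).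
  by rewrite (lin_scale (moyal_linl _)) scalerA.
apply: eq_bigr => I IK.
rewrite [RHS](reindex_onto (fun J => I :|: J)%SET (fun L => L :\: I)%SET) /=; last first.
  move=> L /andP[_ IL]; apply/setP => x; rewrite !inE.
  by have := fintype.subsetP IL x; case: (x \in I) => //= ->.
have KE J : (K :\: (I :|: J) = (K :\: I) :\: J)%SET by rewrite finset.setDDl.
apply: eq_big => [J|J JKI].
  rewrite finset.subsetUl finset.subUset IK /= andbT finset.subsetD.
  case JK: (J \subset K) => //=; rewrite -finset.setI_eq0 finset.setIC.
  rewrite finset.setDUl finset.setDv finset.set0U.
  apply/idP/eqP => [/eqP JI|/finset.setDidPl]; last by rewrite -finset.setI_eq0 finset.setIC.
  by apply/finset.setDidPl; rewrite -finset.setI_eq0 finset.setIC JI.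
move: JKI; rewrite finset.subsetD => /andP[JK dJI].
have JE : ((I :|: J) :\: I = J)%SET.
  by rewrite finset.setDUl finset.setDv finset.set0U; apply/finset.setDidPl.
rewrite JE KE; congr (_ *: _).
have dIJ : [disjoint I & J]%bool by rewrite disjoint_sym.
have dJ : [disjoint J & (K :\: I :\: J)%SET]%bool.
  by apply/pred0P => x; rewrite /= !inE; case: (x \in J).
have KIE : (K :\: I = J :|: (K :\: I :\: J))%SET.
  apply/setP => x; rewrite !inE.
  have := fintype.subsetP JK x; have := pred0P dJI x; rewrite /=.
  case: (x \in J); case: (x \in I); case: (x \in K) => //= h1 h2.
  by have := h2 isT.
have -> : wsign I (K :\: I)%SET = wsign I J * wsign I (K :\: I :\: J)%SET.
  by rewrite -wsignUr// -KIE.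
by rewrite wsignUl// [RHS]mulrC mulrA.
Qed.

Definition top a : B := a [set: 'I_4]%SET.

Lemma topE a b : top (wedge a b) =
  \sum_(I : {set 'I_4}) wsign I (~: I)%SET *: moyal (a I) (b (~: I)%SET).
Proof.
by rewrite /top /wedge; apply: eq_big => [I|I _]; rewrite ?finset.subsetT// finset.setTD.
Qed.

(** The defining property of the Hodge operator. It turns every pairing into the
    integral of a wedge product, to which cyclicity applies. *)
Lemma fpairE a b : fpair a b = top (wedge a (hodge b)).
Proof.
rewrite topE; apply: eq_bigr => I _; rewrite hodgeE finset.setCK.
rewrite (bigD1 I)//= big1 ?addr0 => [|J JI]; last by rewrite gram_neq 1?eq_sym// scale0r.
rewrite (lin_scale (moyal_linr _)) scalerA /hodge_sign finset.setCK mulrA wsign_sq mul1r//.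
Qed.

(** Complementary degrees have the same parity, the dimension being even. *)
Lemma top_fgrade a b : top (wedge (fgrade a) b) = top (wedge a (fgrade b)).
Proof.
rewrite !topE; apply: eq_bigr => I _; rewrite /fgrade.
rewrite (lin_scale (moyal_linl _)) (lin_scale (moyal_linr _)); congr (_ *: (_ *: _)).
rewrite -signr_odd -[RHS]signr_odd; congr (_ ^+ (_ : bool)).
have := finset.cardsC I; rewrite card_ord => /(congr1 odd).
by rewrite oddD /=; case: (odd _); case: (odd _).
Qed.

Lemma fgradeM a b : fgrade (wedge a b) = wedge (fgrade a) (fgrade b).
Proof.
apply/funext => K; rewrite /fgrade /wedge scaler_sumr; apply: eq_bigr => I IK.
rewrite (lin_scale (moyal_linl _)) (lin_scale (moyal_linr _)) !scalerA.
have -> : #|K| = (#|I| + #|(K :\: I)%SET|)%N.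
  by rewrite -(finset.cardsID I K) (finset.setIidPr IK).
by rewrite exprD [_ * wsign _ _]mulrC.
Qed.

Lemma fgrade_homog k a : homog k a -> fgrade a = (-1) ^+ k *: a.
Proof.
move=> ak; apply/funext => I; rewrite /fgrade -[RHS]/((-1) ^+ k *: a I).
by have [->//|/ak ->] := eqVneq #|I| k; rewrite !scaler0.
Qed.

Lemma fsupp_wedge a b : fsupp_compact a \/ fsupp_compact b -> fsupp_compact (wedge a b).
Proof.
move=> cab K; apply: bsupp_sum => I; apply: bsuppZ; apply: bsupp_moyal.
by case: cab => [ca|cb]; [left|right].
Qed.

Lemma fsupp_grade a : fsupp_compact a -> fsupp_compact (fgrade a).
Proof. by move=> ca I; apply: bsuppZ. Qed.

Lemma fsupp_hodge a : fsupp_compact a -> fsupp_compact (hodge a).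
Proof. by move=> ca K; rewrite hodgeE; apply: bsuppZ; apply: bsupp_conj. Qed.

Lemma fsuppP_lin x a b : fsupp_compact a -> fsupp_compact b -> fsupp_compact (x *: a + b).
Proof. by move=> ca cb I; exact: bsuppP_lin. Qed.

Definition wint a b : thseries R := bintegral (top (wedge a b)).

Lemma finnerE a b : finner a b = wint a (hodge b).
Proof. by rewrite /finner fpairE. Qed.

(** Graded cyclicity of the integral: moving a one-form past a three-form. *)
Lemma wint_cyclic a b : homog 1 a -> fsupp_compact b -> wint a b = - wint b a.
Proof.
move=> a1 cb; rewrite /wint !topE.
have cab I J : bsupp_compact (moyal (a I) (b J)) by apply: bsupp_moyal; right; exact: cb.
have cba I J : bsupp_compact (moyal (b J) (a I)) by apply: bsupp_moyal; left; exact: cb.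
rewrite !bintegral_sum => [|I|I]; try by apply: bsuppZ.
rewrite -sumrN (reindex_inj (can_inj (@finset.setCK _))) /=; apply: eq_bigr => I _.
rewrite finset.setCK.
have [cI|cI] := eqVneq #|(~: I)%SET| 1%N; last first.
  rewrite a1// (lin_zero (moyal_linl _)) (lin_zero (moyal_linr _)).
  by rewrite !scaler0 bintegral0 oppr0.
rewrite !bintegralZ// bintegral_moyalC; last by right; exact: cb.
rewrite -scaleNr; congr (_ *: _).
have dI : [disjoint I & ~: I]%bool.
  by rewrite -finset.setI_eq0 finset.setICr.
have := wsign_swap R dI; rewrite cI muln1.
have -> : #|I| = 3%N by have := finset.cardsC I; rewrite cI card_ord addn1 => -[].
move=> /(congr1 (fun z => wsign I (~: I)%SET * z)); rewrite mulrA wsign_sq mul1r => ->.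
by rewrite -signr_odd /= expr1 mulrN1.
Qed.

Let bintegralB (f g : B) : bsupp_compact f -> bsupp_compact g ->
  bintegral (f - g) = bintegral f - bintegral g.
Proof.
move=> cf cg; have := bintegralP (-1) cg cf.
by rewrite !scaleN1r addrC => ->; rewrite addrC.
Qed.

(** Cyclicity carries [A] from the left of [a] to the right of [c], and [top_fgrade]
    carries the sign of [a] over to [c]: the two terms of the commutator change
    places. *)
Lemma wint_gcomm A a c : homog 1 A -> fsupp_compact a \/ fsupp_compact c ->
  wint (gcomm A a) c = wint a (gcomm A (fgrade c)).
Proof.
move=> A1 cac.
have cw : fsupp_compact (wedge a c) by exact: fsupp_wedge.
have cg : fsupp_compact (fgrade a) \/ fsupp_compact c.
  by case: cac => [ca|]; [left; exact: fsupp_grade|right].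
have subE (u v w : OB) : fsupp_compact (wedge u w) -> fsupp_compact (wedge v w) ->
    wint (u - v) w = wint u w - wint v w.
  move=> cu cv; rewrite /wint (lin_sub (wedge_linl w)).
  exact: bintegralB (cu _) (cv _).
have subEr (u v w : OB) : fsupp_compact (wedge w u) -> fsupp_compact (wedge w v) ->
    wint w (u - v) = wint w u - wint w v.
  move=> cu cv; rewrite /wint (lin_sub (wedge_linr w)).
  exact: bintegralB (cu _) (cv _).
rewrite /gcomm subE; last first.
- rewrite -wedgeA; apply: fsupp_wedge; case: cg => [|cc]; [by left|].
  by right; apply: fsupp_wedge; right.
- by rewrite -wedgeA; apply: fsupp_wedge; right.
rewrite fgradeK subEr; last first.
- by rewrite wedgeA; apply: fsupp_wedge; left.
- apply: fsupp_wedge; case: cac => [|cc]; [by left|right].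
  by apply: fsupp_wedge; right; exact: fsupp_grade.
have -> : wint (wedge A a) c = - wint a (wedge c A).
  rewrite -[LHS]/(bintegral (top (wedge (wedge A a) c))) -wedgeA.
  by rewrite -[LHS]/(wint A (wedge a c)) wint_cyclic// /wint wedgeA.
have -> : wint (wedge (fgrade a) A) c = - wint a (wedge A (fgrade c)).
  rewrite -[LHS]/(bintegral (top (wedge (wedge (fgrade a) A) c))) -wedgeA top_fgrade.
  rewrite fgradeM (fgrade_homog A1) expr1 scaleN1r (lin_opp (wedge_linl _)).
  rewrite (lin_opp (wedge_linr _)) -scaleN1r -[top _]/(-1 *: top (wedge a (wedge A (fgrade c)))).
  rewrite bintegralZ ?scaleN1r//; apply: fsupp_wedge; case: cac => [|cc]; [by left|right].
  by apply: fsupp_wedge; right; exact: fsupp_grade.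
by rewrite opprK addrC.
Qed.

End Forms.

(** * Formal adjoints of the differential and of the commutator *)

Section Adjoints.
Variable R : realType.
Notation C := (R[i]).
Notation B := (moyalB R).
Notation OB := (forms R).
Notation wsign := (@wsign R).
Implicit Types (I J K : {set 'I_4}) (a b c : OB) (f h : B).

Lemma bpartial_moyal mu f h :
  bpartial mu (moyal f h) = moyal (bpartial mu f) h + moyal f (bpartial mu h).
Proof.
apply/funext => n.
transitivity (moyal (bpartial mu f) h n + moyal f (bpartial mu h) n); last by [].
rewrite -[LHS]/(spartial mu (moyal f h n)) /moyal (lin_sum (@spartial_lin R mu)) -big_split.
apply: eq_bigr => N _; rewrite (lin_scale (@spartial_lin R mu)) /= -scalerDr; congr (_ *: _).
by rewrite -[LHS]/(bpartial mu (bidiff N f h) n) bpartial_bidiff.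
Qed.

Lemma bintegral_by_parts mu f h : bsupp_compact f \/ bsupp_compact h ->
  bintegral (moyal (bpartial mu f) h) = - bintegral (moyal f (bpartial mu h)).
Proof.
move=> cfh; apply/eqP; rewrite -addr_eq0 -bintegralD.
- by rewrite -bpartial_moyal bintegral_partial//; exact: bsupp_moyal.
- by apply: bsupp_moyal; case: cfh => [cf|]; [left; exact: bsupp_partial|right].
- by apply: bsupp_moyal; case: cfh => [|ch]; [left|right; exact: bsupp_partial].
Qed.

(* The signs of dx^mu dx^I dx^J and of dx^I dx^mu dx^J, J being the complement of I
   and mu; the sizes of I and J have opposite parities. *)
Let sign_fdiff mu I : mu \notin I ->
  wsign (mu |: I)%SET (~: (mu |: I))%SET * wsign [set mu]%SET I =
  - (wsign I (~: I)%SET * wsign [set mu]%SET (~: I :\ mu)%SET * (-1) ^+ #|(~: I :\ mu)%SET|).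
Proof.
move=> mI; pose J := (~: I :\ mu)%SET.
have JE : (~: (mu |: I) = J)%SET.
  by apply/setP => x; rewrite /J !inE negb_or.
have IE : (~: I = mu |: J)%SET.
  apply/setP => x; rewrite /J !inE; have [->|] := eqVneq x mu; first by rewrite mI.
  by [].
have dmI : [disjoint [set mu]%SET & I]%bool by rewrite finset.disjoints1.
have dmJ : [disjoint [set mu]%SET & J]%bool by rewrite finset.disjoints1 !inE eqxx.
rewrite JE -/J IE wsignUl// wsignUr//.
have sw := wsign_swap R dmI; rewrite finset.cards1 mul1n in sw.
have sI : wsign [set mu]%SET I = (-1) ^+ #|I| * wsign I [set mu]%SET.
  by rewrite -sw -mulrA wsign_sq mulr1.
have sJ : (-1) ^+ #|I| = - (-1) ^+ #|J| :> C.
  have : (#|I| + #|J|.+1 = 4)%N.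
    have := finset.cardsC I.
    by rewrite card_ord IE finset.cardsU1 !inE eqxx /= add1n.
  move=> /(congr1 odd); rewrite oddD [odd _.+1]/= => oIJ.
  rewrite -[LHS]signr_odd -[in RHS]signr_odd.
  by move: oIJ; case: (odd _); case: (odd _) => //= _; rewrite ?expr0 ?expr1 ?opprK.
rewrite sI sJ; move: (wsign _ _) (wsign _ _) (wsign _ _) (_ ^+ _) => p q r s.
by ring.
Qed.

(** Stokes and the graded Leibniz rule. Only pairs of components [a I], [c J] with
    index sets that miss a single index [mu] contribute, and for each of them this
    is integration by parts in the direction [mu]. *)
Lemma wint_fdiff a c : fsupp_compact a \/ fsupp_compact c ->
  wint (fdiff a) c = wint a (fdiff (fgrade c)).
Proof.
move=> cac; rewrite /wint !topE.
have cm mu I J : bsupp_compact (moyal (bpartial mu (a I)) (c J)).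
  apply: bsupp_moyal; case: cac => [ca|cc]; [left|right; exact: cc].
  exact/bsupp_partial/ca.
have cm' mu I J : bsupp_compact (moyal (a I) (bpartial mu (c J))).
  apply: bsupp_moyal; case: cac => [ca|cc]; [left; exact: ca|right].
  exact/bsupp_partial/cc.
transitivity (\sum_(mu < 4) \sum_(I : {set 'I_4} | mu \notin I)
   (wsign (mu |: I)%SET (~: (mu |: I))%SET * wsign [set mu]%SET I) *:
      bintegral (moyal (bpartial mu (a I)) (c (~: (mu |: I))%SET))).
  transitivity (\sum_(K : {set 'I_4}) \sum_(mu in K)
     (wsign K (~: K)%SET * wsign [set mu]%SET (K :\ mu)%SET) *:
        bintegral (moyal (bpartial mu (a (K :\ mu)%SET)) (c (~: K)%SET))).
    have E K : wsign K (~: K)%SET *: moyal (fdiff a K) (c (~: K)%SET) =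
       \sum_(mu in K) (wsign K (~: K)%SET * wsign [set mu]%SET (K :\ mu)%SET) *:
         moyal (bpartial mu (a (K :\ mu)%SET)) (c (~: K)%SET).
      rewrite (lin_sum (moyal_linl _)) scaler_sumr; apply: eq_bigr => mu _.
      by rewrite (lin_scale (moyal_linl _)) scalerA.
    under eq_bigr do rewrite E.
    rewrite bintegral_sum; last by move=> K; apply: bsupp_sum => mu; apply: bsuppZ.
    apply: eq_bigr => K _; rewrite bintegral_sum; last by move=> mu; apply: bsuppZ.
    by apply: eq_bigr => mu _; rewrite bintegralZ.
  rewrite (exchange_big_dep xpredT) //=; apply: eq_bigr => mu _.
  rewrite (reindex_onto (fun I => mu |: I)%SET (fun K => K :\ mu)%SET) /=; last first.
    by move=> K mK; exact: finset.setD1K.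
  have cond I : ((mu \in (mu |: I)) && ((mu |: I) :\ mu == I))%SET = (mu \notin I).
    rewrite finset.setU11 /=; apply/eqP/idP => [<-|]; last exact: finset.setU1K.
    by rewrite !inE eqxx.
  apply: eq_big => // I; rewrite cond => mI.
  by rewrite finset.setU1K.
transitivity (\sum_(mu < 4) \sum_(I : {set 'I_4} | mu \notin I)
   (wsign I (~: I)%SET * wsign [set mu]%SET (~: I :\ mu)%SET * (-1) ^+ #|(~: I :\ mu)%SET|) *:
      bintegral (moyal (a I) (bpartial mu (c (~: I :\ mu)%SET)))).
  apply: eq_bigr => mu _; apply: eq_bigr => I mI.
  rewrite bintegral_by_parts; last by case: cac; [left|right].
  rewrite sign_fdiff// scaleNr scalerN opprK; congr (_ *: bintegral (moyal _ (bpartial _ (c _)))).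
  by apply/setP => x; rewrite !inE negb_or.
rewrite (exchange_big_dep xpredT) //=.
have E I : wsign I (~: I)%SET *: moyal (a I) (fdiff (fgrade c) (~: I)%SET) =
   \sum_(mu | mu \notin I)
     (wsign I (~: I)%SET * wsign [set mu]%SET (~: I :\ mu)%SET * (-1) ^+ #|(~: I :\ mu)%SET|) *:
       moyal (a I) (bpartial mu (c (~: I :\ mu)%SET)).
  rewrite (lin_sum (moyal_linr _)) scaler_sumr; apply: eq_big => [mu|mu _]; first by rewrite !inE.
  rewrite (lin_scale (moyal_linr _)) /fgrade (lin_scale (@bpartial_lin R mu)).
  by rewrite (lin_scale (moyal_linr _)) !scalerA mulrA.
under [in RHS]eq_bigr do rewrite E.
rewrite bintegral_sum; last by move=> I; apply: bsupp_sum => mu; apply: bsuppZ.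
apply: eq_bigr => I _; rewrite bintegral_sum; last by move=> mu; apply: bsuppZ.
by apply: eq_bigr => mu _; rewrite bintegralZ.
Qed.

Lemma hodge_homog k b : (k <= 4)%N -> homog k b -> homog (4 - k) (hodge b).
Proof.
move=> k4 bk K cK; rewrite hodgeE bk ?bconj0 ?scaler0//.
apply: contra cK => /eqP ck; have cC := finset.cardsC K; rewrite card_ord in cC.
by apply/eqP; rewrite -(addnK #|(~: K)%SET| #|K|) cC ck.
Qed.

Lemma hcomp_homog k b : homog k (hcomp k b).
Proof. by move=> I cI; rewrite /hcomp (negPf cI). Qed.

Lemma homog_gt4 k b : (4 < k)%N -> homog k b -> b = 0.
Proof.
move=> k4 bk; apply/funext => I; apply: bk; apply/eqP => cI.
by move: k4; rewrite -cI ltnNge -[X in (_ <= X)%N](card_ord 4) max_card.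
Qed.

Lemma hcomp_sum b : b = \sum_(k < 5) hcomp k b.
Proof.
apply/funext => I.
have -> : (\sum_(k < 5) hcomp k b) I = \sum_(k < 5) hcomp k b I.
  by elim/big_rec2: _ => // i x y _ <-.
have cI : (#|I| < 5)%N by rewrite ltnS -[X in (_ <= X)%N](card_ord 4) max_card.
rewrite (bigD1 (Ordinal cI))//= big1 => [|k kI]; first by rewrite /hcomp eqxx addr0.
by rewrite /hcomp ifN// eq_sym; exact: kI.
Qed.

Let fdiff_top b : homog 4 b -> fdiff b = 0.
Proof.
move=> b4; apply/funext => K; rewrite /fdiff big1// => mu muK.
rewrite b4 ?(lin_zero (@bpartial_lin R mu)) ?scaler0//.
have := finset.cardsD1 mu K; rewrite muK add1n => cK.
by apply/eqP => c4; have := max_card K; rewrite card_ord cK c4.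
Qed.

(** The signs (-1)^(k+1) of the codifferential are those of the grading involution
    on Hodge duals. *)
Lemma codiffE b : codiff b = hodge_inv (fdiff (fgrade (hodge b))).
Proof.
rewrite [in RHS](hcomp_sum b) (big_morph (@hodge R) (@hodgeD R) (@hodge0 R)).
rewrite (lin_sum (@fgrade_lin R)) (lin_sum (@fdiff_lin R)).
rewrite (big_morph (@hodge_inv R) (@hodge_invD R) (@hodge_inv0 R)).
rewrite big_ord_recl [X in _ = X + _](_ : _ = 0) ?add0r; last first.
  have h4 : homog 4 (hodge (hcomp 0 b)).
    by apply: (@hodge_homog 0) => //; exact: hcomp_homog.
  rewrite (fgrade_homog h4) (lin_scale (@fdiff_lin R)).
  by rewrite fdiff_top// scaler0 hodge_inv0.
apply: eq_bigr => k _.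
have hk : homog (4 - k.+1) (hodge (hcomp k.+1 b)).
  exact: (@hodge_homog k.+1 _ (ltn_ord k) (@hcomp_homog _ _)).
rewrite lift0 (fgrade_homog hk) (lin_scale (@fdiff_lin R)) hodge_invZ.
rewrite rmorphXn rmorphN1; congr (_ *: _).
by rewrite -signr_odd -[RHS]signr_odd oddB//= ltn_ord.
Qed.

Lemma finner_fdiff a b : fsupp_compact a \/ fsupp_compact b ->
  finner (fdiff a) b = finner a (codiff b).
Proof.
move=> cab; rewrite !finnerE codiffE hodge_invK wint_fdiff//.
by case: cab => [|cb]; [left|right; exact: fsupp_hodge].
Qed.

(** As in [codiffE], the grading involution on Hodge duals replaces the signs that
    depend on the degree. *)
Definition gcomm_adjoint (A : OB) b : OB := hodge_inv ('i *: gcomm A (fgrade (hodge b))).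

Lemma gcomm_lin (A : OB) : linear (gcomm A).
Proof.
move=> x b b'; rewrite /gcomm wedge_linr fgrade_lin wedge_linl scalerBr opprD.
by rewrite !addrA; congr (_ + _); rewrite addrAC.
Qed.

Lemma fsupp_gcomm (A : OB) a : fsupp_compact a -> fsupp_compact (gcomm A a).
Proof.
move=> ca; rewrite /gcomm addrC -scaleN1r; apply: fsuppP_lin; apply: fsupp_wedge.
  by left; exact: fsupp_grade.
by right.
Qed.

Lemma finner_gcomm (A : OB) a b : homog 1 A -> fsupp_compact a \/ fsupp_compact b ->
  finner ('i *: gcomm A a) b = finner a (gcomm_adjoint A b).
Proof.
move=> A1 cab; rewrite !finnerE /gcomm_adjoint hodge_invK.
have cab' : fsupp_compact a \/ fsupp_compact (hodge b).
  by case: cab => [|cb]; [left|right; exact: fsupp_hodge].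
have wZl x u v : fsupp_compact u \/ fsupp_compact v -> wint (x *: u) v = x *: wint u v.
  move=> c; rewrite /wint (lin_scale (wedge_linl v)).
  by rewrite -[top _]/(x *: top (wedge u v)) bintegralZ//; exact: fsupp_wedge.
have wZr x u v : fsupp_compact u \/ fsupp_compact v -> wint u (x *: v) = x *: wint u v.
  move=> c; rewrite /wint (lin_scale (wedge_linr u)).
  by rewrite -[top _]/(x *: top (wedge u v)) bintegralZ//; exact: fsupp_wedge.
rewrite wZl; last by case: cab' => [ca|]; [left; exact: fsupp_gcomm|right].
rewrite wint_gcomm// wZr//; case: cab' => [|cb]; [by left|right].
by apply: fsupp_gcomm; exact: fsupp_grade.
Qed.

Lemma gcomm_adjoint_homog (A : OB) k b : homog k.+1 b ->
  gcomm_adjoint A b = ((-1) ^+ k * 'i) *: hodge_inv (gcomm A (hodge b)).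
Proof.
move=> bk; have [k4|k4] := ltnP k 4; last first.
  rewrite (homog_gt4 (k := k.+1) _ bk)// /gcomm_adjoint hodge0 (lin_zero (@fgrade_lin R)).
  by rewrite (lin_zero (gcomm_lin A)) scaler0 hodge_inv0 scaler0.
rewrite /gcomm_adjoint (fgrade_homog (hodge_homog k4 bk)) (lin_scale (gcomm_lin A)).
rewrite scalerA hodge_invZ rmorphM /= conjCi rmorphXn rmorphN1; congr (_ *: _).
have -> : (-1) ^+ (4 - k.+1) = - (-1) ^+ k :> C.
  rewrite -[LHS]signr_odd -[in RHS]signr_odd oddB//=.
  by case: (odd k); rewrite ?expr0 ?expr1 ?opprK.
by rewrite ?mulNr ?mulrN ?opprK 1?mulrC.
Qed.

(** The pairing only sees the components of the Hodge dual, one at a time. *)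
Lemma finner_nondeg b b' : (forall a, fsupp_compact a -> finner a b = finner a b') -> b = b'.
Proof.
move=> E; apply: hodge_inj; apply/funext => K; apply/eqP; rewrite -subr_eq0; apply/eqP.
apply: bintegral_nondeg => f cf.
pose a : OB := fun I => if I == (~: K)%SET then f else 0.
have ca : fsupp_compact a by move=> I; rewrite /a; case: ifP => // _; exact: bsupp0.
have aE c : top (wedge a c) = wsign (~: K)%SET K *: moyal f (c K).
  rewrite topE (bigD1 (~: K)%SET)//= big1 => [|I IK]; last first.
    by rewrite /a (negPf IK) (lin_zero (moyal_linl _)) scaler0.
  by rewrite addr0 /a eqxx finset.setCK.
have := E a ca; rewrite !finnerE /wint !aE !bintegralZ; try by apply: bsupp_moyal; left.
move=> /(congr1 (fun z => wsign (~: K)%SET K *: z)); rewrite !scalerA wsign_sq !scale1r => e.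
have := bintegralP (-1) (bsupp_moyal (or_introl cf : _ \/ bsupp_compact (hodge b' K)))
  (bsupp_moyal (or_introl cf : _ \/ bsupp_compact (hodge b K))).
rewrite !scaleN1r e addNr addrC => <-; congr bintegral.
exact: (lin_sub (moyal_linr f)).
Qed.

End Adjoints.

(** * The differential calculus on the structure group *)

Section Calculus.
Variables (R : realType) (G : bcalc R).
Notation C := (R[i]).
Notation H := (laurent R).
Notation Env := (envelope G).
Notation z := (zpow R 1).
Notation theta0 := (vtheta G).

Lemma bd1 : bd G 1 = 0.
Proof.
have := bd_leibniz G 1 1; rewrite mulr1 ract1 lact1 => /(congr1 (fun x => x - bd G 1)).
by rewrite subrr addrK.
Qed.

Lemma lactN g x : lact g (- x) = - lact g x :> G.
Proof. exact: lin_opp ((lact_bilin G).2 g) x. Qed.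

Lemma ractN x h : ract (- x) h = - ract x h :> G.
Proof. exact: lin_opp ((ract_bilin G).1 h) x. Qed.

Lemma lact0 g : lact g 0 = 0 :> G.
Proof. exact: lin_zero ((lact_bilin G).2 g). Qed.

Lemma ract0 h : ract 0 h = 0 :> G.
Proof. exact: lin_zero ((ract_bilin G).1 h). Qed.

Lemma germ_zpow n : germ G (zpow R n) = lact (zpow R (- n)) (bd G (zpow R n)).
Proof.
rewrite /germ /hcoprod lext_zpow tlift_ox /hantipode ?lext_zpow//.
by apply: bilin_comp (lact_bilin G) _ (bd_lin G); exact: lext_linear.
Qed.

Lemma qgerm1 : qgerm G 1 = 0.
Proof. by apply/val_inj; rewrite /= germ_zpow bd1 lact0. Qed.

Lemma qgerm_lin : linear (qgerm G).
Proof. by move=> a x y; apply/val_inj; exact: germ_lin. Qed.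

(** From [0 = d(z^-1 z)]. *)
Lemma bd_zV : bd G (zpow R (-1)) = - ract (germ G z) (zpow R (-1)).
Proof.
have := bd_leibniz G (zpow R (-1)) z; rewrite -zpowD addNr zpow0 bd1.
rewrite -germ_zpow => /eqP; rewrite eq_sym addr_eq0 => /eqP e.
by rewrite -ractN -e -ractM -zpowD subrr zpow0 ract1.
Qed.

(** If [pi(z) = 0], then [dz = 0] and [d(z^-1) = 0], so that [d] vanishes on all
    powers of [z]; the calculus being spanned by the [g dh], it would be 0. *)
Lemma germ_z_neq0 : dim_inv1 G -> germ G z != 0.
Proof.
move=> [v v0 _]; apply/eqP => g0.
have dz : bd G z = 0.
  have := germ_zpow 1; rewrite g0 => /(congr1 (lact z)).
  by rewrite lact0 -lactM -zpowD subrr zpow0 lact1.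
have dzV : bd G (zpow R (-1)) = 0 by rewrite bd_zV g0 ract0 oppr0.
have dM g h : bd G g = 0 -> bd G h = 0 -> bd G (g * h) = 0.
  by move=> dg dh; rewrite bd_leibniz dg dh ract0 lact0 addr0.
have dn (n : nat) : bd G (zpow R n) = 0 /\ bd G (zpow R (- n%:Z)) = 0.
  elim: n => [|n [IH1 IH2]]; first by rewrite oppr0 zpow0 bd1.
  by rewrite -addn1 PoszD opprD !zpowD; split; apply: dM.
have d0 h : bd G h = 0.
  apply: (@laurent_ext _ _ (bd G) (fun=> 0)) => [||n]; first exact: bd_lin.
    by move=> a x y; rewrite scaler0 addr0.
  by case: (intP n) => [|m|m]; [exact: (dn 0%N).1|exact: (dn m.+1).1|exact: (dn m.+1).2].
move/eqP: v0; apply; apply/val_inj; have [s ->] := bd_surj (val v).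
by rewrite big1// => p _; rewrite d0 lact0.
Qed.

Section Coordinate.
Hypothesis Gdim : dim_inv1 G.

Lemma vtheta_neq0 : theta0 != 0.
Proof.
rewrite /vtheta scaler_eq0 (negPf (neq0Ci _)) /=; apply: contra (germ_z_neq0 Gdim) => /eqP e.
by rewrite -[germ G z]/(val (qgerm G z)) e.
Qed.

Lemma vcoordP x : x = vcoord x *: theta0.
Proof.
rewrite /vcoord; case: xgetP => [a _ //|nP].
have [v v0 vs] := Gdim; have [b be] := vs theta0; have [a ae] := vs x.
have b0 : b != 0.
  by apply: contraNneq vtheta_neq0 => b0; rewrite be b0 scale0r.
have [] := nP (a / b).
by rewrite /= be scalerA divfK// ae.
Qed.

Lemma vcoord_unique x a : x = a *: theta0 -> vcoord x = a.
Proof.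
move=> xa; apply/eqP; have := vcoordP x; rewrite {1}xa => /eqP.
rewrite eq_sym -subr_eq0 -scalerBl scaler_eq0 (negPf vtheta_neq0) orbF.
by rewrite subr_eq0.
Qed.

Lemma vcoord_vtheta : vcoord theta0 = 1.
Proof. by apply: vcoord_unique; rewrite scale1r. Qed.

Lemma vcoord_lin : linear (@vcoord R G : invG G -> C^o).
Proof.
move=> a x y; apply: vcoord_unique.
by rewrite {1}(vcoordP x) {1}(vcoordP y) scalerA -scalerDl.
Qed.

Lemma linear_vtheta (V : lmodType C) (f : invG G -> V) x : linear f ->
  f x = vcoord x *: f theta0.
Proof. by move=> fl; rewrite {1}(vcoordP x) (lin_scale fl). Qed.

Lemma vcoord_scale_lin (V : lmodType C) (v : V) : linear (fun x : invG G => vcoord x *: v).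
Proof. by move=> a x y; rewrite vcoord_lin scalerDl -scalerA. Qed.

End Coordinate.

(** * The universal differential envelope *)

Lemma env_H_linear : linear (@env_H R G).
Proof.
move=> a g h; rewrite -[RHS]/(eadd (escale a (env_H G g)) (env_H G h)).
by rewrite epi_scale epi_add; apply/epiE; constructor.
Qed.

Lemma env_G_linear : linear (@env_G R G).
Proof.
move=> a x y; rewrite -[RHS]/(eadd (escale a (env_G x)) (env_G y)).
by rewrite epi_scale epi_add; apply/epiE; constructor.
Qed.

Lemma env_H1 : env_H G 1 = 1.
Proof. by []. Qed.

Lemma env_GlactM h (x : G) : env_G (lact h x) = env_H G h * env_G x.
Proof. by rewrite -[RHS]/(emul _ _) epi_mul; apply/epiE; constructor. Qed.

Lemma env_GractM h (x : G) : env_G (ract x h) = env_G x * env_H G h.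
Proof. by rewrite -[RHS]/(emul _ _) epi_mul; apply/epiE; constructor. Qed.

Definition env_counit (w : Env) : C^o := ecounit (repr w).

Let env_counitE t : env_counit (\pi_Env t)%qT = ecounit t.
Proof. by apply: ecounit_rel; exact: repr_epi. Qed.

Lemma env_counit_lin : linear env_counit.
Proof.
move=> a v w; rewrite -[v]reprK -[w]reprK -[(_ + _)]/(eadd (escale a _) _).
by rewrite epi_scale epi_add !env_counitE.
Qed.

Lemma env_counit1 : env_counit 1 = 1.
Proof. by rewrite env_counitE /= -zpow0 /hcounit lext_zpow. Qed.

Let envGN (x : G) : env_G (- x) = - env_G x.
Proof. exact: lin_opp env_G_linear x. Qed.

(* The generators of the ideal are quadratic, so that the two signs cancel. *)
Let egr_rel s t : env_rel (G := G) s t -> env_rel (egr s) (egr t).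
Proof.
elim=> {s t} /=; try by move=> *; constructor.
- by move=> s t u _ st _ tu; exact: env_trans st tu.
- move=> a x y; rewrite opprD -scalerN; exact: env_G_lin.
- move=> h x; rewrite -lactN; exact: env_G_lact.
- move=> h x; rewrite -ractN; exact: env_G_ract.
move=> s /env_ideal; apply: env_trans; elim: s => [|p s IHs] /=; first exact: env_refl.
apply: env_addc IHs; apply/epiE; rewrite -!epi_mul.
by rewrite -[LHS]/(env_G (- _) * env_G (- _)) !envGN mulrNN.
Qed.

Lemma env_invE t : env_inv (\pi_Env t)%qT = (\pi_Env (egr t))%qT.
Proof. by apply/epiE; apply: egr_rel; exact: repr_epi. Qed.

Lemma env_inv_lin : linear (@env_inv R G).
Proof.
move=> a v w; rewrite -[v]reprK -[w]reprK -[LHS]/(env_inv (eadd (escale a _) _)).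
rewrite -[RHS]/(eadd (escale a _) _).
by rewrite epi_scale epi_add !env_invE epi_scale epi_add.
Qed.

Lemma env_inv_H h : env_inv (env_H G h) = env_H G h.
Proof. by rewrite /env_H env_invE. Qed.

Lemma env_inv_G x : env_inv (env_G x) = - env_G x :> Env.
Proof. by rewrite /env_G env_invE /= -[LHS]/(env_G _) envGN. Qed.

Section Differential.
Variable d : Env -> Env.
Hypothesis Hd : env_differential d.

Lemma env_d1 : d 1 = 0.
Proof. by rewrite -env_H1 (env_d_H Hd) bd1 (lin_zero env_G_linear). Qed.

(** The structure equation. Applying [d] to [pi(z) = z^-1 dz] gives [d pi(z) = d(z^-1) dz], and
    [d(z^-1) = - pi(z) z^-1] turns this into [- pi(z) pi(z)]. *)
Lemma env_d_vtheta :
  d (env_G (ginv theta0)) = 'i *: (env_G (ginv theta0) * env_G (ginv theta0)).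
Proof.
have gE : env_G (germ G z) = env_H G (zpow R (-1)) * env_G (bd G z).
  by rewrite germ_zpow env_GlactM.
have dg : d (env_G (germ G z)) = - (env_G (germ G z) * env_G (germ G z)).
  rewrite {1}gE -(env_d_H Hd) (env_d_leibniz Hd _ (env_deg_H _ _)) (env_dd Hd).
  rewrite mulr0 scaler0 addr0 !(env_d_H Hd) bd_zV envGN env_GractM mulNr -mulrA.
  by rewrite -gE.
have -> : env_G (ginv theta0) = 'i *: env_G (germ G z).
  by rewrite -(lin_scale env_G_linear).
rewrite (lin_scale (env_d_lin Hd)) dg -scalerAl -scalerAr !scalerA.
by congr (_ *: _); rewrite -mulrA -expr2 sqrCi.
Qed.

End Differential.

End Calculus.

(** * Balanced tensor products *)

Section Tensors.
Variable K : comNzRingType.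

Lemma btens_ind (V W : lmodType K) (X : Type) (ra : V -> X -> V) (la : X -> W -> W)
    (P : btens ra la -> Prop) :
  P 0 -> (forall v w x, P x -> P (tpure ra la v w + x)) -> forall x, P x.
Proof.
move=> P0 Pa x; rewrite -[x]reprK; elim: (repr x) => [//|[v w] s IHs].
rewrite (_ : \pi_(btens ra la)%qT ((v, w) :: s) =
  tpure ra la v w + \pi_(btens ra la)%qT s); first exact: Pa.
apply: btensP => U b b1 b2.
rewrite -[_ + _]/(tadd _ _) tlift_add// tlift_pure// !tlift_pi//.
by rewrite big_cons.
Qed.

Lemma bilin_addf (V W U : lmodType K) (b c : V -> W -> U) :
  is_bilinear b -> is_bilinear c -> is_bilinear (fun v w => b v w + c v w).
Proof.
move=> [b1 b2] [c1 c2]; split=> [w|v] a x y.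
  by rewrite b1 c1 scalerDr !addrA; congr (_ + _); rewrite addrAC.
by rewrite b2 c2 scalerDr !addrA; congr (_ + _); rewrite addrAC.
Qed.

Lemma tlift_bilin (V W V' W' U : lmodType K) (f : V -> W -> V' -> W' -> U) :
  (forall a b, is_bilinear (f a b)) ->
  (forall a' b', is_bilinear (fun a b => f a b a' b')) ->
  forall y : tens V' W', is_bilinear (fun a b => tlift (f a b) y).
Proof.
move=> f1 f2; elim/tens_ind => [|a' b' y [IH1 IH2]].
  by split=> [w|v] a x y; rewrite !tlift_tens0// scaler0 addr0.
split=> [w|v] a x y'; rewrite !tlift_tensD// ?IH1 ?IH2 ?(f2 _ _).1 ?(f2 _ _).2;
  by rewrite scalerDr !addrA; congr (_ + _); rewrite addrAC.
Qed.

End Tensors.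

(** * Coinvariant elements *)

Section Coinvariants.
Variables (R : realType) (V : lmodType R[i]).
Notation C := (R[i]).
Notation H := (laurent R).

Lemma hcoprod1 : hcoprod (1 : H) = 1 \ox 1.
Proof. by rewrite -zpow0 /hcoprod lext_zpow. Qed.

(** The coactions on [P] and on the horizontal forms are the instances of this for
    functions and for forms. *)
Definition coact : tens V H -> tens (tens V H) H :=
  tlift (fun b h => tlift (fun h1 h2 => (b \ox h1 : tens V H) \ox h2) (hcoprod h)).

Definition coef0 : tens V H -> V := tlift (fun (b : V) (h : H) => h 0 *: b).

Let eval0_lin : linear (fun h : H => h 0 : C^o).
Proof. by []. Qed.

Let scale_bilin (U : lmodType C) : is_bilinear (fun (u : U) (h : H) => h 0 *: u).
Proof.
split=> [h|u] a x y; first by rewrite scalerDr !scalerA mulrC.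
by rewrite eval0_lin scalerDl scalerA.
Qed.

Let coact_inner (b : V) :
  is_bilinear (fun h1 h2 : H => (b \ox h1 : tens V H) \ox h2 : tens (tens V H) H).
Proof.
apply: (@bilin_comp _ _ _ _ _ _ _ (fun h => b \ox h) id (ox_bilinear _ H)) => //.
exact: (ox_bilinear V H).2.
Qed.

Lemma coact_bilin : is_bilinear (fun (b : V) (h : H) =>
  tlift (fun h1 h2 => (b \ox h1 : tens V H) \ox h2) (hcoprod h) : tens (tens V H) H).
Proof.
split=> [h|b] a x y; last by rewrite /hcoprod lext_linear (tlift_lin (coact_inner b)).
elim/tens_ind: (hcoprod h) => [|h1 h2 z IHz].
  by rewrite !tlift_tens0// scaler0 addr0.
rewrite !tlift_tensD// IHz (ox_bilinear V H).1 (ox_bilinear _ H).1.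
by rewrite scalerDr !addrA; congr (_ + _); rewrite addrAC.
Qed.

Lemma coact_lin : linear coact.
Proof. exact: tlift_lin coact_bilin. Qed.

Lemma coact_ox1 b : coact (b \ox 1) = (b \ox 1) \ox 1.
Proof. by rewrite /coact (tlift_ox _ _ coact_bilin) hcoprod1 (tlift_ox _ _ (coact_inner b)). Qed.

Lemma coef0_lin : linear coef0.
Proof. exact: tlift_lin (scale_bilin V). Qed.

Lemma coef0_ox b h : coef0 (b \ox h) = h 0 *: b.
Proof. exact: tlift_ox (scale_bilin V). Qed.

Lemma coef0_ox1 b : coef0 (b \ox 1) = b.
Proof. by rewrite coef0_ox /= scale1r. Qed.

(** Projecting the last factor of [coact x] onto [z^0] kills all components of
    [x] except that in [V (x) z^0], whereas it maps [x (x) 1] to [x]. *)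
Lemma coinvariantP x : x \ox 1 = coact x -> x = coef0 x \ox 1.
Proof.
pose p : tens (tens V H) H -> tens V H := tlift (fun (y : tens V H) (h : H) => h 0 *: y).
have p_lin : linear p by exact: tlift_lin (scale_bilin _).
have o_lin : linear (fun v : V => v \ox (1 : H)) by exact: (ox_bilinear V H).1.
have pE y (h : H) : p (y \ox h) = h 0 *: y by exact: tlift_ox (scale_bilin _).
have e y : p (coact y) = coef0 y \ox 1.
  elim/tens_ind: y => [|b h y IHy].
    by rewrite (lin_zero coact_lin) (lin_zero p_lin) (lin_zero coef0_lin) (lin_zero o_lin).
  rewrite (lin_add coact_lin) (lin_add p_lin) (lin_add coef0_lin) (lin_add o_lin) IHy.
  congr (_ + _); rewrite coef0_ox /coact (tlift_ox _ _ coact_bilin).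
  move: h; apply: laurent_ext => [a x' y'|a x' y'|n].
  - by rewrite coact_bilin.2 p_lin.
  - by rewrite eval0_lin scalerDl -scalerA o_lin.
  rewrite /hcoprod lext_zpow (tlift_ox _ _ (coact_inner b)) pE /=.
  case: (eqVneq 0 n) => [<-|_]; last by rewrite !scale0r (lin_zero o_lin).
  by rewrite !scale1r.
by move=> /(congr1 p); rewrite pE e /= scale1r.
Qed.

End Coinvariants.

(** * Forms on the total space *)

Section TotalSpace.
Variables (R : realType) (G : bcalc R).
Notation C := (R[i]).
Notation H := (laurent R).
Notation B := (moyalB R).
Notation OB := (forms R).
Notation Env := (envelope G).
Notation OP := (tens OB Env).

(* The projections onto the even (s = 1) and odd (s = -1) parts *)
Let parity (s : C) (b : OB) : OB := 2^-1 *: (b + s *: fgrade b).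

Let parity_lin s : linear (parity s).
Proof.
move=> a x y; rewrite /parity fgrade_lin !scalerDr !scalerA.
by rewrite addrACA ![_ * a]mulrC mulrA.
Qed.

Let mul_bilin : is_bilinear (fun v w : Env => v * w).
Proof. by split=> [w|v] a x y; rewrite ?mulrDl ?mulrDr -?scalerAl -?scalerAr. Qed.

Let pm (a : OB) (b : Env) (a' : OB) (b' : Env) : OP :=
  wedge a (parity 1 a') \ox (b * b') + wedge a (parity (-1) a') \ox (env_inv b * b').

(* The Koszul sign of the graded tensor product sits in pm. *)
Let pmulE x y : pmul x y = tlift (fun a b => tlift (pm a b) y) x :> OP.
Proof.
rewrite /pmul /gt_mul /tlift; apply: eq_bigr => p _; apply: eq_bigr => q _.
by rewrite /pm /parity scale1r scaleN1r.
Qed.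

Let pm_bilin2 a b : is_bilinear (pm a b).
Proof.
apply: bilin_addf; apply: bilin_comp (ox_bilinear _ _) _ _; try exact: mul_bilin.2.
- by move=> c x y; rewrite parity_lin wedge_linr.
- by move=> c x y; rewrite parity_lin wedge_linr.
Qed.

Let pm_bilin1 a' b' : is_bilinear (fun a b => pm a b a' b').
Proof.
apply: bilin_addf; apply: bilin_comp (ox_bilinear _ _) _ _; try exact: wedge_linl.
  exact: mul_bilin.1.
by move=> c x y; rewrite env_inv_lin mul_bilin.1.
Qed.

Let pm_bilin (y : OP) : is_bilinear (fun a b => tlift (pm a b) y).
Proof. exact: tlift_bilin pm_bilin2 pm_bilin1 y. Qed.

Lemma pmul_linl (y : OP) : linear (fun x : OP => pmul x y).
Proof. by move=> a x x'; rewrite !pmulE (tlift_lin (pm_bilin y)). Qed.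

Lemma pmul_linr (x : OP) : linear (pmul x).
Proof.
move=> a y y'; elim/tens_ind: x => [|b w x IHx].
  by rewrite !(lin_zero (pmul_linl _)) scaler0 addr0.
rewrite !(lin_add (pmul_linl _)) IHx scalerDr addrACA; congr (_ + _).
by rewrite !pmulE !(tlift_ox _ _ (pm_bilin _)) (tlift_lin (pm_bilin2 b w)).
Qed.

Lemma pmul_bilin : is_bilinear (@pmul R G).
Proof. by split=> [w|v]; [exact: pmul_linl|exact: pmul_linr]. Qed.

Let pmul_ox a b a' b' : pmul (a \ox b : OP) (a' \ox b') = pm a b a' b'.
Proof. by rewrite pmulE (tlift_ox _ _ (pm_bilin _)) (tlift_ox _ _ (pm_bilin2 _ _)). Qed.

Let half2 : (2^-1 + 2^-1 : C) = 1.
Proof. by field. Qed.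

Lemma pmul_oxH a h a' w :
  pmul (a \ox env_H G h) (a' \ox w) = wedge a a' \ox (env_H G h * w).
Proof.
rewrite pmul_ox /pm env_inv_H -(lin_add ((ox_bilinear _ _).1 _)).
rewrite -(lin_add (wedge_linr a)) -scalerDr scale1r scaleN1r addrACA subrr addr0.
by rewrite scalerDr -scalerDl half2 scale1r.
Qed.

Lemma pmul_ox1 a a' w : pmul (a \ox 1 : OP) (a' \ox w) = wedge a a' \ox w.
Proof. by rewrite -(env_H1 G) pmul_oxH mul1r. Qed.

Lemma pmul_oxG a x a' w :
  pmul (a \ox env_G x : OP) (a' \ox w) = wedge a (fgrade a') \ox (env_G x * w).
Proof.
rewrite pmul_ox /pm env_inv_G mulNr (lin_opp ((ox_bilinear _ _).2 _)).
rewrite -(lin_sub ((ox_bilinear _ _).1 _)) -(lin_sub (wedge_linr a)).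
rewrite -scalerBr scale1r scaleN1r opprD opprK addrACA subrr add0r.
by rewrite scalerDr -scalerDl half2 scale1r.
Qed.

Lemma ox1_lin : linear (fun a : OB => a \ox (1 : Env)).
Proof. exact: (ox_bilinear OB Env).1. Qed.

(** The counit of the envelope is a left inverse. *)
Lemma ox1_inj (a b : OB) : a \ox (1 : Env) = b \ox 1 -> a = b.
Proof.
have cb : is_bilinear (fun (a : OB) (w : Env) => env_counit w *: a).
  split=> [w|c] x y z; first by rewrite scalerDr !scalerA mulrC.
  by rewrite env_counit_lin scalerDl scalerA.
by move/(congr1 (tlift (fun (a : OB) (w : Env) => env_counit w *: a)));
   rewrite !tlift_ox// env_counit1 !scale1r.
Qed.

Section Differential.
Variable d : Env -> Env.
Hypothesis Hd : env_differential d.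

Let pdiff_bilin : is_bilinear (fun (a : OB) (w : Env) =>
  fdiff a \ox w + fgrade a \ox d w : OP).
Proof.
apply: bilin_addf; apply: bilin_comp (ox_bilinear _ _) _ _ => //.
- exact: fdiff_lin.
- exact: fgrade_lin.
- exact: env_d_lin Hd.
Qed.

Lemma pdiff_lin : linear (pdiff d : OP -> OP).
Proof. exact: tlift_lin pdiff_bilin. Qed.

Lemma pdiff_ox a w : pdiff d (a \ox w) = fdiff a \ox w + fgrade a \ox d w.
Proof. exact: tlift_ox pdiff_bilin. Qed.

Lemma pdiff_ox1 a : pdiff d (a \ox 1) = fdiff a \ox 1.
Proof.
by rewrite pdiff_ox (env_d1 Hd) (lin_zero ((ox_bilinear _ _).2 _)) addr0.
Qed.

End Differential.

Lemma fone_set0 : fone R finset.set0 = bone R. Proof. by rewrite /fone eqxx. Qed.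

Lemma fgrade_fone : fgrade (fone R) = fone R.
Proof.
apply/funext => I; rewrite /fgrade /fone; case: eqP => [->|_]; last by rewrite scaler0.
by rewrite cards0 expr0 scale1r.
Qed.

Lemma fdiff_fone : fdiff (fone R) = 0.
Proof.
apply/funext => K; rewrite /fdiff big1// => mu _; rewrite /fone.
case: ifP => _; first by rewrite bpartial1 scaler0.
by rewrite (lin_zero (@bpartial_lin R mu)) scaler0.
Qed.

Let wsign0l I : @wsign R finset.set0 I = 1.
Proof. by rewrite /wsign eq_card0 // => p; rewrite inE /= finset.in_set0. Qed.

Let wsign0r I : @wsign R I finset.set0 = 1.
Proof. by rewrite /wsign eq_card0 // => p; rewrite inE /= finset.in_set0 andbF. Qed.

Lemma wedge1f a : wedge (fone R) a = a.
Proof.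
apply/funext => K; rewrite /wedge (bigD1 finset.set0) ?finset.sub0set//=.
rewrite big1 => [|I /andP[_ I0]].
  by rewrite fone_set0 moyal1f finset.setD0 wsign0l scale1r addr0.
by rewrite /fone (negPf I0) (lin_zero (moyal_linl _)) scaler0.
Qed.

Lemma wedgef1 a : wedge a (fone R) = a.
Proof.
apply/funext => K; rewrite /wedge (bigD1 K) //=.
rewrite big1 => [|I /andP[IK I0]].
  by rewrite finset.setDv fone_set0 moyalf1 wsign0r scale1r addr0.
rewrite /fone finset.setD_eq0; case: ifP => [KI|_].
  by case/negP: I0; rewrite finset.eqEsubset IK.
by rewrite (lin_zero (moyal_linr _)) scaler0.
Qed.

End TotalSpace.

(** * The associated bundle *)

Section Bundle.
Variables (R : realType) (G : bcalc R).
Notation C := (R[i]).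
Notation H := (laurent R).
Notation B := (moyalB R).
Notation OB := (forms R).
Notation Env := (envelope G).
Notation OP := (tens OB Env).
Notation Hor := (tens OB H).
Notation P := (tens B H).
Notation theta0 := (vtheta G).
Hypothesis Gdim : dim_inv1 G.

Lemma tmap_ad (V : lmodType C) (f : invG G -> V) x : linear f ->
  tmap f id (ad x) = f x \ox (1 : H).
Proof. by move=> fl; rewrite /ad tmap_ox. Qed.

Lemma linear_coinvariant (V : lmodType C) (v : V) :
  linear (fun x : invG G => vcoord x *: (v \ox (1 : H)) : tens V H) /\
  forall x, tmap (fun x : invG G => vcoord x *: (v \ox (1 : H)) : tens V H) id (ad x) =
    coact (vcoord x *: (v \ox (1 : H))).
Proof.
have l := vcoord_scale_lin Gdim (v \ox (1 : H) : tens V H).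
split=> // x; rewrite tmap_ad// (lin_scale (@coact_lin _ _)) coact_ox1.
by rewrite (lin_scale ((ox_bilinear _ _).1 _)).
Qed.

Lemma mor_horE (tau : invG G -> Hor) : mor_hor tau -> exists a, tau theta0 = a \ox 1.
Proof.
move=> [tl tc]; exists (coef0 (tau theta0)).
by apply: coinvariantP; rewrite -[RHS]tc tmap_ad.
Qed.

Lemma mor_hor_exists (a : OB) : exists2 tau : invG G -> Hor, mor_hor tau & tau theta0 = a \ox 1.
Proof.
exists (fun x => vcoord x *: (a \ox (1 : H))); last by rewrite vcoord_vtheta// scale1r.
exact: linear_coinvariant.
Qed.

Lemma assoc_exists (b : B) : exists T : assoc G, T theta0 = b \ox 1.
Proof.
have h : (fun x => vcoord x *: (b \ox (1 : H))) \in @mor_prin R G.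
  by apply/asboolP; exact: linear_coinvariant.
by exists (Assoc h); rewrite /= vcoord_vtheta// scale1r.
Qed.

Lemma assocE (T : assoc G) : T theta0 = coef0 (T theta0) \ox 1.
Proof.
case: T => T /= /asboolP[Tl Tc].
by apply: coinvariantP; rewrite -[RHS]Tc tmap_ad.
Qed.

Lemma assoc_ext (S T : assoc G) : S theta0 = T theta0 -> S = T.
Proof.
case: S T => [S hS] [T hT] /= e; apply/val_inj/funext => x /=.
move: hS hT => /asboolP[Sl _] /asboolP[Tl _].
by rewrite (linear_vtheta Gdim _ Sl) (linear_vtheta Gdim _ Tl) e.
Qed.

Lemma T_oneE : T_one G theta0 = bone R \ox 1.
Proof. by have := xgetPex 0 (assoc_exists (bone R)). Qed.

Lemma assoc_free (T : assoc G) : T = assoc_act (coef0 (T theta0)) (T_one G).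
Proof.
apply: assoc_ext; rewrite [LHS]assocE /= T_oneE /prin_act tmap_ox//.
  by rewrite moyalf1.
exact: moyal_linr.
Qed.

Lemma vtens_lin (T : assoc G) : linear (fun a => vtens a T).
Proof. exact: (tpure_bilinear _ _).1. Qed.

Lemma vtens_act (a : OB) b (T : assoc G) : vtens (form_act a b) T = vtens a (assoc_act b T).
Proof. by apply: btensP => U f f1 f2; rewrite !tlift_pure. Qed.

(** Every section of the bundle is [b T_one], and [b] moves across the balanced
    tensor product into the form. *)
Lemma qvforms_free (y : qvforms G) : exists a, y = vtens a (T_one G).
Proof.
elim/btens_ind: y => [|a T y [c ->]].
  by exists 0; rewrite (lin_zero (vtens_lin _)).
exists (form_act a (coef0 (T theta0)) + c).
by rewrite (lin_add (vtens_lin _)) vtens_act -assoc_free.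
Qed.

Lemma form_act_linl b : linear (fun a : OB => form_act a b).
Proof. by move=> x a c; apply/funext => I; exact: moyal_linl. Qed.

Lemma form_act_linr a : linear (@form_act R a).
Proof. by move=> x b c; apply/funext => I; exact: moyal_linr. Qed.

Lemma coef0_act b (x : P) : coef0 (prin_act b x) = moyal b (coef0 x).
Proof.
elim/tens_ind: x => [|c h x IHx].
  rewrite (lin_zero (prin_act_lin _)) !(lin_zero (@coef0_lin _ _)).
  by rewrite (lin_zero (moyal_linr _)).
rewrite (lin_add (prin_act_lin _)) !(lin_add (@coef0_lin _ _)) IHx.
rewrite (lin_add (moyal_linr _)) /prin_act tmap_ox//; last exact: moyal_linr.
by rewrite !coef0_ox (lin_scale (moyal_linr _)).
Qed.

(** The balanced map [(a, T) |-> a T_0], where [T vtheta = T_0 (x) 1], is a left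
    inverse; it is balanced because the Moyal product is associative. *)
Lemma vtens_inj a b : vtens a (T_one G) = vtens b (T_one G) -> a = b.
Proof.
pose f (a : OB) (T : assoc G) : OB := form_act a (coef0 (T theta0)).
have fb : is_bilinear f.
  split=> [T|c] x y z; first exact: form_act_linl.
  by rewrite /f -[(x *: y + z) theta0]/(x *: y theta0 + z theta0) coef0_lin form_act_linr.
have fc : balanced (@form_act R) (@assoc_act R G) f.
  move=> c x T; rewrite /f /= coef0_act; apply/funext => I.
  by rewrite /form_act moyalA.
have fE c : tlift f (vtens c (T_one G)) = c.
  rewrite /vtens tlift_pure// /f T_oneE coef0_ox1; apply/funext => I.
  exact: moyalf1.
by move=> /(congr1 (tlift f)); rewrite !fE.
Qed.

Lemma vcompE a : vcomp (vtens a (T_one G)) = a.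
Proof.
apply/esym/vtens_inj.
by have := xgetPex 0 (ex_intro (fun c => vtens a (T_one G) = vtens c (T_one G)) a erefl).
Qed.

Lemma vcompK (y : qvforms G) : vtens (vcomp y) (T_one G) = y.
Proof. by have [a ->] := qvforms_free y; rewrite vcompE. Qed.

Lemma UpsilonE (tau : invG G -> OP) a : tau theta0 = a \ox 1 ->
  Upsilon tau = vtens a (T_one G).
Proof.
move=> ta; congr (vtens _ _); apply: (@ox1_inj R G).
apply: etrans (ta); apply/esym.
exact: (xgetPex 0 (ex_intro (fun c => tau theta0 = c \ox 1) a ta)).
Qed.

Lemma hor_incl_ox1 (a : OB) : hor_incl G (a \ox 1) = a \ox 1.
Proof. by rewrite /hor_incl tmap_ox//; exact: env_H_linear. Qed.

Lemma hor_grade_ox1 (a : OB) : hor_grade (a \ox 1 : Hor) = fgrade a \ox 1.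
Proof. by rewrite /hor_grade tmap_ox//; exact: fgrade_lin. Qed.

Lemma Upsilon_invP (y : qvforms G) :
  mor_hor (Upsilon_inv y) /\ Upsilon (hor_incl G \o Upsilon_inv y) = y.
Proof.
have [tau tm te] := mor_hor_exists (vcomp y).
apply: (xgetPex 0 (P := fun tau => mor_hor tau /\ Upsilon (hor_incl G \o tau) = y)).
exists tau; split=> //; rewrite -[RHS]vcompK; apply: UpsilonE.
by rewrite /= te hor_incl_ox1.
Qed.

Lemma Upsilon_invE (y : qvforms G) : Upsilon_inv y theta0 = vcomp y \ox 1.
Proof.
have [/mor_horE[a ae] yE] := Upsilon_invP y.
rewrite ae -{1}yE (@UpsilonE _ a) ?vcompE//.
by rewrite /= ae hor_incl_ox1.
Qed.

(** * Covariant derivative and curvature *)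

Section Connection.
Variables (d : Env -> Env) (om : invG G -> OP) (A : invG G -> OB).
Hypotheses (Hd : env_differential d) (om_lin : linear om) (HA : gauge_potential om A).

Lemma om1 : om (qgerm G 1) = 0.
Proof. by rewrite qgerm1 (lin_zero om_lin). Qed.

Let connection_term_bilin :
  is_bilinear (fun (psi : Hor) (g : H) => pmul (hor_incl G psi) (om (qgerm G g))).
Proof.
apply: bilin_comp (pmul_bilin G) _ _.
  by apply: tmap_lin => //; exact: env_H_linear.
by move=> a x y; rewrite qgerm_lin om_lin.
Qed.

(** The connection does not act on coinvariant forms, because [pi(1) = 0]. *)
Lemma cov_diff_ox1 (a : OB) : cov_diff d om (a \ox 1) = fdiff a \ox 1.
Proof.
rewrite /cov_diff hor_incl_ox1 (pdiff_ox1 Hd) hor_grade_ox1.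
rewrite -[hor_coact _]/(coact _) coact_ox1 (tlift_ox _ _ connection_term_bilin).
by rewrite om1 (lin_zero (@pmul_linr _ _ _)) subr0.
Qed.

Lemma nabla_diffE (y : qvforms G) : nabla_diff d om y = vtens (fdiff (vcomp y)) (T_one G).
Proof. by apply: UpsilonE; rewrite Upsilon_invE cov_diff_ox1. Qed.

Let Theta_vtheta : Theta theta0 = 'i *: (theta0 \ox theta0).
Proof. by rewrite /Theta vcoord_vtheta// scale1r. Qed.

Let bracketP_vtheta (s t : invG G -> OP) : linear s -> linear t ->
  bracketP s t theta0 = 'i *: pmul (s theta0) (t theta0).
Proof.
move=> sl tl; have b := bilin_comp (pmul_bilin G) sl tl.
by rewrite /bracketP Theta_vtheta (lin_scale (tlift_lin b)) (tlift_ox _ _ b).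
Qed.

Notation gth := (env_G (ginv theta0)).

Let omE : om theta0 = A theta0 \ox 1 + fone R \ox gth.
Proof. exact: potE HA theta0. Qed.

(** The third term of the operator vanishes as [pi(1) = 0]. The parts
    [fone (x) vtheta] of [om vtheta] contribute the same term to
    [<om, tau>] and to [<tau, om>], up to the sign of the grading, and cancel. *)
Lemma S_diffE (y : qvforms G) :
  S_diff om y = vtens ('i *: gcomm (A theta0) (vcomp y)) (T_one G).
Proof.
pose tau := Upsilon_inv y; set a := vcomp y.
have [[tl _] _] := Upsilon_invP y; rewrite -/tau in tl.
have il : linear (@hor_incl R G) by apply: tmap_lin => //; exact: env_H_linear.
have gl : linear (@hor_grade R) by apply: tmap_lin => //; exact: fgrade_lin.
have t0l : linear (hor_incl G \o tau) by move=> c x x'; rewrite /= tl il.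
have t1l : linear (hor_incl G \o hor_grade (R := R) \o tau).
  by move=> c x x'; rewrite /= tl gl il.
have te : tau theta0 = a \ox 1 by exact: Upsilon_invE.
apply: UpsilonE; rewrite /Sop -/tau !bracketP_vtheta// /ad_comm /ad.
have adb : is_bilinear (fun u g =>
    pmul ((hor_incl G \o hor_grade (R := R) \o tau) u) (om (qgerm G g))).
  by apply: bilin_comp (pmul_bilin G) t1l _ => c x x'; rewrite qgerm_lin om_lin.
rewrite (tlift_ox _ _ adb) om1 (lin_zero (@pmul_linr _ _ _)) subr0 /=.
rewrite te hor_grade_ox1 !hor_incl_ox1 -scalerBr omE.
rewrite (lin_add (@pmul_linl _ _ _)) (lin_add (@pmul_linr _ _ _)) !pmul_ox1.
rewrite pmul_oxG mulr1 wedge1f wedgef1 opprD addrACA subrr addr0.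
rewrite -(lin_sub (@ox1_lin R G)) -(lin_scale (@ox1_lin R G)).
by [].
Qed.

Let wedgeA_bilin : is_bilinear (fun u v => wedge (A u) (A v)).
Proof.
apply: (bilin_comp _ (pot_lin HA) (pot_lin HA)).
by split=> [w|v]; [exact: wedge_linl|exact: wedge_linr].
Qed.

Lemma field_strength_lin : linear (field_strength A).
Proof.
move=> a x y; rewrite /field_strength /bracketB (pot_lin HA) fdiff_lin.
rewrite /Theta (vcoord_lin Gdim) !(lin_scale (tlift_lin wedgeA_bilin)).
rewrite scalerDl -scalerA; set u := _ *: _ (theta0 \ox theta0).
by rewrite scalerBr opprD addrACA.
Qed.

Lemma field_strengthE : field_strength A theta0 =
  fdiff (A theta0) - 'i *: wedge (A theta0) (A theta0).
Proof.
rewrite /field_strength /bracketB Theta_vtheta.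
by rewrite (lin_scale (tlift_lin wedgeA_bilin)) (tlift_ox _ _ wedgeA_bilin).
Qed.

(** The mixed terms cancel since [vtheta] is odd, the terms in [1 (x) vtheta] by
    the structure equation [d vtheta = i vtheta vtheta]. *)
Lemma curvature_vtheta : curvature d om theta0 = field_strength A theta0 \ox 1.
Proof.
have oxl a : linear (fun w : Env => a \ox w : OP) by exact: (ox_bilinear _ _).2.
have oxr w : linear (fun a : OB => a \ox w : OP) by exact: (ox_bilinear _ _).1.
have square : pmul (om theta0) (om theta0) =
    wedge (A theta0) (A theta0) \ox 1 + fone R \ox (gth * gth).
  rewrite omE (lin_add (@pmul_linl _ _ _)) !(lin_add (@pmul_linr _ _ _)).
  rewrite !pmul_ox1 !pmul_oxG mulr1 fgrade_fone !wedge1f wedgef1.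
  rewrite (fgrade_homog (pot_deg HA theta0)) expr1 scaleN1r (lin_opp (oxr _)).
  by rewrite addrA addrK.
rewrite /curvature bracketP_vtheta// square {1}omE (lin_add (pdiff_lin Hd)).
rewrite (pdiff_ox1 Hd) (pdiff_ox Hd) fdiff_fone fgrade_fone (env_d_vtheta Hd).
rewrite (lin_zero (oxr _)) add0r (lin_scale (oxl _)) scalerDr opprD addrCA.
rewrite field_strengthE (lin_sub (oxr _)) (lin_scale (oxr _)).
by move: ('i *: (fone R \ox _)) => u; rewrite (addrK u) addrC.
Qed.

End Connection.

End Bundle.

(** * The Yang-Mills equation *)

Theorem proposition3p5 (R : realType) (G : bcalc R)
    (Gdim : dim_inv1 G) (Ganti : germ_anticomm G)
    (d : envelope G -> envelope G) (Hd : env_differential d)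
    (D : envelope G -> tens (envelope G) (envelope G))
    (HD : env_coproduct d D)
    (om : invG G -> tens (forms R) (envelope G)) (Hom : connection D om)
    (A : invG G -> forms R) (HA : gauge_potential om A) :
  let F := field_strength A in
  let UR := Upsilon (curvature d om) in
  let th := vtheta G in
  [/\ exists dn, vadjoint (nabla_diff d om) dn,
      exists dE, vadjoint (S_diff om) dE,
      exists dT, ladjoint (dS A) dT &
      forall (dn dE : qvforms G -> qvforms G)
             (dT : (invG G -> forms R) -> invG G -> forms R),
        vadjoint (nabla_diff d om) dn ->
        vadjoint (S_diff om) dE ->
        ladjoint (dS A) dT ->
        [/\ UR = vtens (F th) (T_one G),
            dn UR - dE UR = vtens (codiff (F th) - dT F th) (T_one G),
            dn UR - dE UR = 0 <-> codiff (F th) - dT F th = 0 &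
            forall (k : nat) (T : invG G -> forms R),
              linear T -> (forall x, homog k.+1 (T x)) ->
              dT T th = ((-1) ^+ k * 'i) *:
                          hodge_inv (gcomm (A th) (hodge (T th))) /\
              forall x, dT T x = (-1) ^+ k.+1 *:
                on_value (@hodge_inv R) (dS A (on_value (@hodge R) T)) x]].
Proof.
move=> F UR th.
have A1 : homog 1 (A th) := pot_deg HA th.
have oml : linear om := conn_lin Hom.
have thc (a : forms R) : vcoord th *: a = a by rewrite vcoord_vtheta// scale1r.
have nE y := nabla_diffE Gdim Hd oml y.
have SE y := S_diffE Gdim oml HA y.
have nadj y y' : vsupp_compact y \/ vsupp_compact y' ->
    vinner (nabla_diff d om y) y' = finner (vcomp y) (codiff (vcomp y')).
  by move=> cpt; rewrite /vinner nE vcompE// finner_fdiff.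
have Sadj y y' : vsupp_compact y \/ vsupp_compact y' ->
    vinner (S_diff om y) y' = finner (vcomp y) (gcomm_adjoint (A th) (vcomp y')).
  by move=> cpt; rewrite /vinner SE vcompE// finner_gcomm.
have Tadj T T' : lsupp_compact T \/ lsupp_compact T' ->
    linner (dS A T) T' = finner (T th) (gcomm_adjoint (A th) (T' th)).
  by move=> cpt; rewrite /linner /dS thc finner_gcomm.
split.
- exists (fun y => vtens (codiff (vcomp y)) (T_one G)); split=> // y y' _ _ cpt.
  by rewrite nadj// /vinner vcompE.
- exists (fun y => vtens (gcomm_adjoint (A th) (vcomp y)) (T_one G)).
  by split=> // y y' _ _ cpt; rewrite Sadj// /vinner vcompE.
- exists (fun T x => vcoord x *: gcomm_adjoint (A th) (T th)); split.
    by move=> T _; exact: vcoord_scale_lin.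
  by move=> T T' _ _ cpt; rewrite Tadj// /linner thc.
move=> dn dE dT [_ dnP] [_ dEP] [dTl dTP].
(* Nondegeneracy of the pairing makes formal adjoints unique. *)
have dnE y : dn y = vtens (codiff (vcomp y)) (T_one G).
  rewrite -[LHS](vcompK Gdim); congr (vtens _ _); apply: finner_nondeg => a ca.
  have cpt : vsupp_compact (vtens a (T_one G)) by rewrite /vsupp_compact vcompE.
  have := dnP (vtens a (T_one G)) y I I (or_introl cpt).
  by rewrite nadj; [rewrite /vinner vcompE|left].
have dEE y : dE y = vtens (gcomm_adjoint (A th) (vcomp y)) (T_one G).
  rewrite -[LHS](vcompK Gdim); congr (vtens _ _); apply: finner_nondeg => a ca.
  have cpt : vsupp_compact (vtens a (T_one G)) by rewrite /vsupp_compact vcompE.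
  have := dEP (vtens a (T_one G)) y I I (or_introl cpt).
  by rewrite Sadj; [rewrite /vinner vcompE|left].
have dTE T : linear T -> dT T th = gcomm_adjoint (A th) (T th).
  move=> Tl; apply: finner_nondeg => a ca.
  pose Ta (x : invG G) := vcoord x *: a.
  have Tal : linear Ta by exact: vcoord_scale_lin.
  have cpt : lsupp_compact Ta by rewrite /lsupp_compact /Ta thc.
  have := dTP Ta T Tal Tl (or_introl cpt).
  by rewrite Tadj; [rewrite /linner /Ta thc|left].
have URE : UR = vtens (F th) (T_one G).
  by apply: UpsilonE; exact: curvature_vtheta.
have YM : dn UR - dE UR = vtens (codiff (F th) - dT F th) (T_one G).
  rewrite dnE dEE URE !vcompE// (dTE _ (field_strength_lin Gdim HA)).
  by rewrite (lin_sub (vtens_lin _)).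
split=> //.
  rewrite YM; split=> [|->]; last exact: lin_zero (vtens_lin _).
  by rewrite -(lin_zero (vtens_lin (T_one G))) => /(vtens_inj Gdim).
move=> k T Tl Tk.
have e : dT T th = ((-1) ^+ k * 'i) *: hodge_inv (gcomm (A th) (hodge (T th))).
  by rewrite dTE// (gcomm_adjoint_homog _ (Tk th)).
split=> // x.
(* The Hodge inverse is antilinear and turns i into - i. *)
rewrite (linear_vtheta Gdim _ (dTl T Tl)) e /on_value /dS !thc hodge_invZ conjCi.
rewrite !scalerA; congr (_ *: _).
by rewrite exprS mulN1r mulrN !mulNr opprK mulrA (mulrC (vcoord x)).
Qed.
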